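(* Let $X=\mathcal{S}(\mathbb{R}^n)$ or $X=\mathcal{V}(\mathbb{R}^n)$, let $K\in\mathcal{K}^n_{(o)}$, let $T:X\to X$ be a rearrangement, and let $\Phi$ be a Young function. If $T$ is $K$-smoothing and $f\in X$ is Lipschitz, then $Tf$ coincides with a Lipschitz function $\mathcal{H}^n$-almost everywhere on $\mathbb{R}^n$, and $$\int_{\mathbb{R}^n}\Phi\left(h_{-K}(\nabla Tf(x))\right)\,dx\leq \int_{\mathbb{R}^n}\Phi\left(h_{-K}(\nabla f(x))\right)\,dx,$$ where the integrals may be infinite.
   Context: Throughout $n\ge 2$ and $\mathcal{H}^n$ is $n$-dimensional Hausdorff (Lebesgue) measure in $\mathbb{R}^n$. ''Essentially'' means up to a set of $\mathcal{H}^n$-measure zero. $\mathcal{M}^n$ is the class of measurable subsets of $\mathbb{R}^n$ and $\mathcal{L}^n$ the class of measurable sets of finite measure. $\mathcal{K}^n_{(o)}$ is the class of compact convex subsets of $\mathbb{R}^n$ containing the origin in their interiors; $-K$ is the reflection of $K$ in the origin; $h_K(x)=\sup\{x\cdot y:y\in K\}$ is the support function of $K$. $\mathcal{S}(\mathbb{R}^n)$ is the set of real-valued measurable functions $f$ on $\mathbb{R}^n$ with $\mathcal{H}^n(\{x:f(x)>t\})<\infty$ for all $t>\operatorname{ess\,inf} f$; $\mathcal{V}(\mathbb{R}^n)$ is the set of nonnegative real-valued measurable functions $f$ with $\mathcal{H}^n(\{x:f(x)>t\})<\infty$ for all $t>0$. A rearrangement $T:X\to X$ is a map that is equimeasurable,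 i.e. $\mathcal{H}^n(\{x:Tf(x)>t\})=\mathcal{H}^n(\{x:f(x)>t\})$ for all $t\in\mathbb{R}$ and $f\in X$, and monotonic, i.e. for $f,g\in X$, $f\le g$ essentially implies $Tf\le Tg$ essentially. For $A\in\mathcal{M}^n$, $A^*$ denotes the set of Lebesgue density points of $A$ (points of $\mathbb{R}^n$ where $A$ has density $1$). For $A\in\mathcal{L}^n$ put $\diamondsuit_TA=\{x:T1_A(x)=1\}$ and $\diamondsuit_T^*A=(\diamondsuit_TA)^*$. $T$ is $K$-smoothing if for each $d>0$ and each bounded $A\in\mathcal{M}^n$, $(\diamondsuit_T^*A)+dK\subset\diamondsuit_T^*(A+dK)$, essentially (Minkowski sums). A Young function is a left-continuous convex function $\Phi:[0,\infty)\to[0,\infty]$ with $\Phi(0)=0$. $\nabla Tf$ is the weak gradient of $Tf$, equivalently the a.e. gradient of the Lipschitz function with which $Tf$ coincides a.e. *)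

(* Defs.v *)
From HB Require Import structures.
From mathcomp Require Import all_boot all_order all_algebra.
From mathcomp Require Import all_classical all_reals all_analysis.
From mathcomp Require Import ess_sup_inf.
Set Implicit Arguments.
Unset Strict Implicit.
Unset Printing Implicit Defensive.
Import Order.TTheory GRing.Theory Num.Theory.
Import numFieldNormedType.Exports.

Local Open Scope classical_set_scope.
Local Open Scope ring_scope.

Section lebesgue_outer.
Context (R : realType) (n : nat).

Definition box (c : 'rV[R]_n * 'rV[R]_n) : set 'rV[R]_n :=
  [set x | forall i, c.1 0 i < x 0 i <= c.2 0 i].

Definition box_volume (c : 'rV[R]_n * 'rV[R]_n) : \bar R :=
  (\prod_i Num.max 0 (c.2 0 i - c.1 0 i))%:E.

Definition box_cover (A : set 'rV[R]_n) : set (set ('rV[R]_n * 'rV[R]_n)) :=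
  [set C | countable C /\ A `<=` \bigcup_(c in C) box c].

(* Lebesgue outer measure, which is n-dimensional Hausdorff measure in R^n with
   its usual normalization. Covers are countable sets of half-open boxes. *)
Definition lebesgue_outer (A : set 'rV[R]_n) : \bar R :=
  ereal_inf [set \esum_(c in C) box_volume c | C in box_cover A]%E.

Lemma box_volume_ge0 c : (0 <= box_volume c)%E.
Proof. by rewrite lee_fin prodr_ge0// => i _; rewrite le_max lexx. Qed.

Lemma lebesgue_outer_ge0 A : (0 <= lebesgue_outer A)%E.
Proof.
apply: le_ereal_inf_tmp => _ [C _ <-]; apply: esum_ge0 => c _.
exact: box_volume_ge0.
Qed.

Lemma lebesgue_outer0 : lebesgue_outer set0 = 0%E.
Proof.
apply/eqP; rewrite eq_le lebesgue_outer_ge0 andbT.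
apply: ereal_inf_lbound; exists set0; last by rewrite esum_set0.
by split => //; exact: countable0.
Qed.

Lemma le_lebesgue_outer :
  {homo lebesgue_outer : A B / A `<=` B >-> (A <= B)%E}.
Proof.
move=> A B AB; apply: ereal_inf_le_tmp => _ [C [cC BC] <-].
by exists C => //; split => //; exact: subset_trans BC.
Qed.

Lemma lebesgue_outer_sigma_subadditive : sigma_subadditive lebesgue_outer.
Proof.
move=> A; have [[i ioo]|] := pselect (exists i, lebesgue_outer (A i) = +oo%E).
  rewrite (eseries_pinfty _ _ ioo) ?leey// => k _.
  by rewrite -ltNye (lt_le_trans _ (lebesgue_outer_ge0 _)).
rewrite -forallNE => Aoo.
suff add2e (e : {posnum R}) : (lebesgue_outer (\bigcup_n A n) <=
    \sum_(i <oo) lebesgue_outer (A i) + e%:num%:E)%E.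
  by apply/lee_addgt0Pr => _/posnumP[].
rewrite (le_trans _ (epsilon_trick _ _ _))//; last first.
  by move=> k; exact: lebesgue_outer_ge0.
pose P k (C : set ('rV[R]_n * 'rV[R]_n)) := box_cover (A k) C /\
  (\esum_(c in C) box_volume c <=
     lebesgue_outer (A k) + (e%:num / (2 ^ k.+1)%:R)%:E)%E.
have [G PG] : {G : nat -> set ('rV[R]_n * 'rV[R]_n) & forall k, P k (G k)}.
  apply: (@choice _ _ P) => k.
  have ek : 0 < e%:num / (2 ^ k.+1)%:R by [].
  have fA : lebesgue_outer (A k) \is a fin_num.
    by rewrite ge0_fin_numE ?lebesgue_outer_ge0// ltey; exact/eqP/Aoo.
  have [_ [C cC <-] /ltW CA] := lb_ereal_inf_adherent ek fA.
  by exists C.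
apply: (@le_trans _ _ (\esum_(c in \bigcup_k seqDU G k) box_volume c)).
  apply: ereal_inf_lbound; exists (\bigcup_k seqDU G k) => //.
  rewrite -seqDU_bigcup_eq; split.
    by apply: bigcup_countable => // k _; have [[]] := PG k.
  move=> x [k _ Akx]; have [[_ /(_ _ Akx) [c Gc cx]] _] := PG k.
  by exists c => //; exists k.
rewrite nneseries_sum_bigcup//; last exact: box_volume_ge0.
apply: lee_nneseries => [k _ _|k _].
  by apply: esum_ge0 => c _; exact: box_volume_ge0.
apply: le_trans (PG k).2; apply: ge_ereal_sup => _ [X [finX XG] <-].
apply: esum_ge; exists X => //; split => //.
by apply: subset_trans XG _; exact: subset_seqDU.
Qed.

HB.instance Definition _ := isOuterMeasure.Build R _ lebesgue_outer
  lebesgue_outer0 lebesgue_outer_ge0 le_lebesgue_outer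
  lebesgue_outer_sigma_subadditive.

End lebesgue_outer.

(* A copy of 'rV[R]_n with the sigma-algebra of Lebesgue measurable sets, which
   is complete (larger than the Borel sigma-algebra). *)
Definition leb_space (R : realType) (n : nat) :=
  caratheodory_type (@lebesgue_outer R n).

HB.instance Definition _ (R : realType) (n : nat) :=
  Measurable.on (@leb_space R n).

Definition lebesgue (R : realType) (n : nat) : set (leb_space R n) -> \bar R :=
  @lebesgue_outer R n.

HB.instance Definition _ (R : realType) (n : nat) :=
  isMeasure.Build _ (leb_space R n) R (@lebesgue R n)
    (@caratheodory_measure0 R _ (@lebesgue_outer R n))
    (@caratheodory_measure_ge0 R _ (@lebesgue_outer R n))
    (@caratheodory_measure_sigma_additive R _ (@lebesgue_outer R n)).
Arguments lebesgue : clear implicits.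

Section geometry.
Context (R : realType) (n : nat).
Implicit Types (x y : 'rV[R]_n) (A B K : set 'rV[R]_n) (d r : R).

Definition dot x y : R := \sum_i x 0 i * y 0 i.

(* The norm of the library on 'rV[R]_n is the sup norm; it induces the same
   topology, bounded sets and Lipschitz functions as the Euclidean one. *)
Definition enorm x : R := Num.sqrt (dot x x).

Definition eball x r : set 'rV[R]_n := [set y | enorm (y - x) < r].

Definition minkowski_sum A B : set 'rV[R]_n := [set x + y | x in A & y in B].

Definition dilate d K : set 'rV[R]_n := [set d *: x | x in K].

Definition reflect_set K : set 'rV[R]_n := [set - x | x in K].

Definition support_fun K x : R := sup [set dot x y | y in K].

Definition convex_body_o K :=
  [/\ compact K, convex_set (K : set (convex_lmodType 'rV[R]_n))
    & interior K 0].

(* The pointwise gradient. 'D_v f is total; its value where the limit does not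
   exist does not affect integrals when f is Lipschitz (Rademacher), and then
   grad f is a.e. the weak gradient of f. *)
Definition grad (f : 'rV[R]_n -> R) x : 'rV[R]_n :=
  \row_i 'D_(delta_mx 0 i) f x.

Definition density_points A : set 'rV[R]_n :=
  [set x | (fine (lebesgue R n (A `&` eball x r)) /
            fine (lebesgue R n (eball x r))) @[r --> 0^'+] --> (1 : R)].

End geometry.

Section rearrangements.
Context (R : realType) (n : nat).
Local Notation mu := (lebesgue R n).
Local Notation fct := ('rV[R]_n -> R).
Implicit Types (f g : fct) (A K : set 'rV[R]_n).

Definition level_set f (t : R) : set (leb_space R n) := [set x | t < f x].

Definition class_S : set fct :=
  [set f | measurable_fun [set: leb_space R n] (f : leb_space R n -> R) /\
    forall t : R, (ess_inf mu (fun x => (f x)%:E) < t%:E)%E ->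
      (mu (level_set f t) < +oo)%E].

Definition class_V : set fct :=
  [set f | [/\ measurable_fun [set: leb_space R n] (f : leb_space R n -> R),
    (forall x, 0 <= f x) &
    forall t : R, 0 < t -> (mu (level_set f t) < +oo)%E]].

(* A map X -> X is a map on all functions that sends X to X; nothing is
   assumed about its values outside X. *)
Definition rearrangement (X : set fct) (T : fct -> fct) :=
  [/\ forall f, X f -> X (T f),
      forall f t, X f -> mu (level_set (T f) t) = mu (level_set f t) &
      forall f g, X f -> X g ->
        {ae mu, forall x, f x <= g x} -> {ae mu, forall x, T f x <= T g x}].

(* Used for A of finite measure, for which \1_A lies in both class_S and class_V. *)
Definition diamond (T : fct -> fct) A : set 'rV[R]_n := [set x | T \1_A x = 1].

Definition diamond_star T A := density_points (diamond T A).

Definition smoothing K (T : fct -> fct) :=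
  forall (d : R) A, 0 < d -> measurable (A : set (leb_space R n)) ->
    bounded_set A ->
    {ae mu, forall x, minkowski_sum (diamond_star T A) (dilate d K) x ->
                      diamond_star T (minkowski_sum A (dilate d K)) x}.

End rearrangements.

(* Only the values on [0, +oo[ matter; 0 * +oo = 0 in \bar R. *)
Definition young_function (R : realType) (Phi : R -> \bar R) :=
  [/\ Phi 0 = 0%E,
      forall t, 0 <= t -> (0 <= Phi t)%E,
      forall s t l, 0 <= s -> 0 <= t -> 0 <= l <= 1 ->
        (Phi (l * s + (1 - l) * t)%R <=
           l%:E * Phi s + (1 - l)%:E * Phi t)%E &
      forall t, 0 < t -> Phi s @[s --> t^'-] --> Phi t].

(* Main.v *)
(** The rearrangement acts on superlevel sets: up to null sets, [{T f > s}] is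
the image under [diamond T] of [{f > s}], and [diamond T] preserves inclusions
and measures. Smoothing turns a bound on the growth of [{f > s}] under Minkowski
sums with [d K] into the same bound for [{T f > s}], hence a Lipschitz version
[g] of [T f]. Put [f_d x = sup_(y in K) f (x - d y)], so that
[{f_d > s} = {f > s} + d K]. Smoothing then bounds the measure of
[{g_d > t + c} \ {g > t}] by that of [{f_d > t + c} \ {f > t}]. Integrating over
[t] with [c = d b], dividing by [d] and letting [d] tend to 0, where
[(f_d - f) / d] tends to [h_(-K) (grad f)] by Rademacher's theorem, gives the
inequality for the hinges [(h_(-K) (grad .) - b)^+], [0 <= b]. A Young function is
a limit from below of nonnegative combinations of hinges. *)
Require Import Defs.
From HB Require Import structures.
From mathcomp Require Import all_boot all_order all_algebra.
From mathcomp Require Import all_classical all_reals all_analysis.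
From mathcomp Require Import measurable_realfun ess_sup_inf.
From mathcomp Require Import ring lra.
Set Implicit Arguments.
Unset Strict Implicit.
Unset Printing Implicit Defensive.
Import Order.TTheory GRing.Theory Num.Theory.
Import numFieldNormedType.Exports.
Local Open Scope classical_set_scope.
Local Open Scope ring_scope.

(** * Lebesgue measure of boxes and balls *)

Section lebesgue_boxes.
Context {R : realType}.

(** Smoothing speaks only of bounded sets, of density points and of inclusions up to null sets,
    whereas superlevel sets may be unbounded and [g] enters through exact Minkowski sums. Truncation
    by balls removes the first restriction. Since [K] has interior, a point of an open set plus
    [d K] can be rewritten with its base moved to a nearby point where smoothing applies, which
    removes the second. Identities between sets are obtained as essential inclusions between sets of
    equal finite measure, so levels with superlevel sets of infinite measure are excluded. A point
    above no admissible level is a global minimum of [g], where the gradient vanishes if it exists.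
    Above them, a level [tau] for [g] is paired with a lower level [tau'] for [f]. The gap absorbs
    the growth [L M d] of [f] under sup-convolution, and [{f > tau'}] has finite measure, so
    dominated convergence serves for [f] and Fatou's lemma for [g]. The measure is given by box
    covers; the volume of boxes, the density theorem and Rademacher's theorem are derived from it,
    the last two by one Vitali argument. *)

Lemma countable_enum (T : choiceType) (x0 : T) (C : set T) (v : T -> \bar R) :
  countable C -> (forall c, 0 <= v c)%E -> v x0 = 0%E ->
  exists c : nat -> T, (forall x, C x -> exists k, c k = x) /\
    (\sum_(0 <= k <oo) v (c k) = \esum_(x in C) v x)%E.
Proof.
move=> /countable_injP[h hinj] v0 vx0.
pose e k := if pselect (exists2 x, C x & h x = k) is left P
            then projT1 (cid2 P) else x0.
have eh x : C x -> e (h x) = x.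
  move=> Cx; rewrite /e; case: pselect => [P|]; last by case; exists x.
  by case: cid2 => y Cy /= /hinj; rewrite !inE; exact.
exists e; split => [x Cx|]; first by exists (h x); exact: eh.
rewrite nneseries_esumT//.
transitivity (\esum_(k in h @` C) v (e k)).
  rewrite [RHS]esum_mkcond; apply: eq_esum => k _.
  case: ifPn => //; rewrite notin_setE /= => nk.
  rewrite /e; case: pselect => // -[x Cx xk]; by case: nk; exists x.
rewrite (@reindex_esum _ _ _ C _ h).
  by apply: eq_esum => x Cx; rewrite eh.
split => //.
Qed.

(** This box pads the enumeration of a cover. In dimension 0 every box has volume 1, hence the
    successor. *)
Lemma box_volume_degenerate n : @box_volume R n.+1 (0, 0) = 0%E.
Proof.
by rewrite /box_volume big_ord_recl/= !mxE subrr maxxx mul0r.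
Qed.

Lemma lebesgue_outer_box_le n (c : 'rV[R]_n * 'rV[R]_n) :
  (lebesgue_outer (box c) <= box_volume c)%E.
Proof.
apply: ereal_inf_lbound; exists [set c]; last first.
  by rewrite esum_set1// box_volume_ge0.
by split; [exact: countable1|move=> x bx; exists c].
Qed.

Lemma lebesgue_outer_cover n (A : set 'rV[R]_n.+1) (e : R) : 0 < e ->
  (lebesgue_outer A < +oo)%E ->
  exists c : nat -> 'rV[R]_n.+1 * 'rV[R]_n.+1,
    A `<=` \bigcup_k box (c k) /\
    (\sum_(0 <= k <oo) box_volume (c k) <= lebesgue_outer A + e%:E)%E.
Proof.
move=> e0 Aoo.
have fA : lebesgue_outer A \is a fin_num.
  by rewrite ge0_fin_numE// lebesgue_outer_ge0.
have [_ [C [cC AC] <-] /ltW CA] := lb_ereal_inf_adherent e0 fA.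
have [c [Cc sc]] := countable_enum cC (@box_volume_ge0 R n.+1)
  (box_volume_degenerate n).
exists c; split; last by rewrite sc.
move=> x /AC [b Cb bx]; have [k ck] := Cc _ Cb; exists k => //.
by rewrite ck.
Qed.

Definition upd n (x : 'rV[R]_n) (i : 'I_n) (t : R) : 'rV[R]_n :=
  \row_j (if j == i then t else x 0 j).

Lemma upd_same n (x : 'rV[R]_n) i t : upd x i t 0 i = t.
Proof. by rewrite mxE eqxx. Qed.

Lemma upd_other n (x : 'rV[R]_n) i j t : j != i -> upd x i t 0 j = x 0 j.
Proof. by rewrite mxE => /negPf ->. Qed.

Definition half n (i : 'I_n) (a : R) : set 'rV[R]_n := [set x | x 0 i <= a].

(** A hyperplane cuts each box of a cover into two boxes whose volumes add up to that of the box;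
    this is Carathéodory's criterion up to [e]. *)
Lemma half_measurable n (i : 'I_n) a :
  measurable (half i a : set (leb_space R n)).
Proof.
case: n i => [[]//|n] i.
apply: le_caratheodory_measurable => X.
change (lebesgue_outer (X `&` half i a) + lebesgue_outer (X `&` ~` half i a) <= lebesgue_outer X)%E.
have [->|Xoo] := eqVneq (lebesgue_outer X) +oo%E; first by rewrite leey.
have {}Xoo : (lebesgue_outer X < +oo)%E by rewrite ltey.
apply/lee_addgt0Pr => e e0.
have [c [Xc sc]] := lebesgue_outer_cover e0 Xoo.
apply: le_trans sc.
pose l k : 'rV[R]_n.+1 * 'rV[R]_n.+1 :=
  ((c k).1, upd (c k).2 i (Num.min ((c k).2 0 i) a)).
pose r k : 'rV[R]_n.+1 * 'rV[R]_n.+1 :=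
  (upd (c k).1 i (Num.max ((c k).1 0 i) a), (c k).2).
have lrE k : (box_volume (c k) = box_volume (l k) + box_volume (r k))%E.
  rewrite /box_volume -EFinD; congr (_%:E).
  pose w := \prod_(j | j != i) Num.max 0 ((c k).2 0 j - (c k).1 0 j).
  have -> : \prod_j Num.max 0 ((c k).2 0 j - (c k).1 0 j) =
            Num.max 0 ((c k).2 0 i - (c k).1 0 i) * w by rewrite (bigD1 i).
  have -> : \prod_j Num.max 0 ((l k).2 0 j - (l k).1 0 j) =
            Num.max 0 (Num.min ((c k).2 0 i) a - (c k).1 0 i) * w.
    rewrite (bigD1 i)//= upd_same; congr (_ * _).
    by apply: eq_bigr => j ji; rewrite upd_other.
  have -> : \prod_j Num.max 0 ((r k).2 0 j - (r k).1 0 j) =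
            Num.max 0 ((c k).2 0 i - Num.max ((c k).1 0 i) a) * w.
    rewrite (bigD1 i)//= upd_same; congr (_ * _).
    by apply: eq_bigr => j ji; rewrite upd_other.
  rewrite -mulrDl; congr (_ * _).
  move: ((c k).2 0 i) ((c k).1 0 i) => u v.
  rewrite /Num.max /Num.min; do ! case: ifPn; rewrite -?leNgt; lra.
under eq_eseriesr do rewrite lrE.
rewrite nneseriesD//; try by move=> *; exact: box_volume_ge0.
apply: leeD.
  apply: (@le_trans _ _ (\sum_(0 <= k <oo) lebesgue_outer (box (l k)))%E); last first.
    by apply: lee_nneseries => *; [exact: lebesgue_outer_ge0|exact: lebesgue_outer_box_le].
  apply: le_trans (lebesgue_outer_sigma_subadditive _).
  apply: le_lebesgue_outer => x [Xx xa]; have [k _ bk] := Xc _ Xx.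
  exists k => // j; have /andP[-> /= xj] := bk j.
  rewrite mxE; case: eqP => [->|//]; rewrite le_min.
  by have /andP[_ ->] := bk i.
apply: (@le_trans _ _ (\sum_(0 <= k <oo) lebesgue_outer (box (r k)))%E); last first.
  by apply: lee_nneseries => *; [exact: lebesgue_outer_ge0|exact: lebesgue_outer_box_le].
apply: le_trans (lebesgue_outer_sigma_subadditive _).
apply: le_lebesgue_outer => x [Xx /negP]; rewrite -ltNge => xa; have [k _ bk] := Xc _ Xx.
exists k => // j; have /andP[xj ->/=] := bk j.
rewrite andbT mxE; case: eqP => [->|//]; rewrite gt_max xa andbT.
by have /andP[-> _] := bk i.
Qed.

Lemma box_measurable n (c : 'rV[R]_n * 'rV[R]_n) :
  measurable (box c : set (leb_space R n)).
Proof.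
rewrite (_ : box c = \big[setI/setT]_(i < n) (half i (c.2 0 i) `\` half i (c.1 0 i))).
  apply: bigsetI_measurable => i _; apply: measurableD; exact: half_measurable.
rewrite -bigcap_seq; apply/seteqP; split => x /=.
  by move=> cx i _; rewrite /half/=; have /andP[? ?] := cx i; split => //; apply/negP; rewrite -ltNge.
move=> h i; have [|h1 /negP h2] := h i; first by rewrite /= mem_index_enum.
rewrite -ltNge in h2; exact/andP.
Qed.



Definition ins n (i : 'I_n.+1) (t : R) (x : 'rV[R]_n) : 'rV[R]_n.+1 :=
  \row_j (if unlift i j is Some k then x 0 k else t).

Lemma ins_lift n (i : 'I_n.+1) t (x : 'rV[R]_n) k : ins i t x 0 (lift i k) = x 0 k.
Proof. by rewrite mxE liftK. Qed.

Lemma ins_same n (i : 'I_n.+1) t (x : 'rV[R]_n) : ins i t x 0 i = t.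
Proof. by rewrite mxE unlift_none. Qed.

Definition box_face n (i : 'I_n.+1) (c : 'rV[R]_n.+1 * 'rV[R]_n.+1) :=
  (col' i c.1, col' i c.2).

Definition side n (c : 'rV[R]_n * 'rV[R]_n) (i : 'I_n) : R :=
  Num.max 0 (c.2 0 i - c.1 0 i).

Lemma box_volume_face n (i : 'I_n.+1) c :
  box_volume c = ((side c i)%:E * box_volume (box_face i c))%E.
Proof.
rewrite /box_volume -EFinM (bigD1_ord i)//=; congr (_ * _)%:E.
by apply: eq_bigr => j _; rewrite !mxE.
Qed.

Lemma box_ins n (i : 'I_n.+1) c t x :
  box c (ins i t x) <-> c.1 0 i < t <= c.2 0 i /\ box (box_face i c) x.
Proof.
split=> [h|[h1 h2] j].
  split; first by have := h i; rewrite ins_same.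
  by move=> k; have := h (lift i k); rewrite ins_lift !mxE.
case: (unliftP i j) => [k|] ->; last by rewrite ins_same.
by have := h2 k; rewrite ins_lift !mxE.
Qed.

(* Integrate, over the face of [q], the one-dimensional covering inequality on
   each segment in direction [i]. *)
Lemma box_volume_le_cover n (i : 'I_n.+1) (q : 'rV[R]_n.+1 * 'rV[R]_n.+1)
    (A : set 'rV[R]_n.+1) (c : nat -> 'rV[R]_n.+1 * 'rV[R]_n.+1) :
  (box_volume (box_face i q) <= lebesgue_outer (box (box_face i q)))%E ->
  (forall x, lebesgue_measure.-negligible [set t | A (ins i t x)]) ->
  box q `\` A `<=` \bigcup_k box (c k) ->
  (box_volume q <= \sum_(0 <= k <oo) box_volume (c k))%E.
Proof.
move=> qvol A0 qc.
pose mu := lebesgue R n.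
pose D : set (leb_space R n) := box (box_face i q).
pose Dk k : set (leb_space R n) := box (box_face i (c k)).
have mD : measurable D by exact: box_measurable.
have mDk k : measurable (Dk k) by exact: box_measurable.
have side0 b : 0 <= side b i by rewrite le_max lexx.
have itvE (b : 'rV[R]_n.+1 * 'rV[R]_n.+1) : (lebesgue_measure (`]b.1 0%R i, b.2 0%R i] : set R) = (side b i)%:E)%E.
  rewrite lebesgue_measure_itv/= lte_fin /side.
  case: ltP => h; first by rewrite -EFinD max_r// subr_ge0 ltW.
  by rewrite max_l// subr_le0.
have seg x : D x ->
    ((side q i)%:E <= \sum_(0 <= k <oo) (side (c k) i)%:E * (\1_(Dk k) x)%:E)%E.
  move=> Dx; have [N [mN N0 AN]] := A0 x.
  pose J k : set R := if x \in Dk k then `](c k).1 0 i, (c k).2 0 i]%classic else set0.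
  have mJ k : measurable (J k) by rewrite /J; case: ifP.
  rewrite -(itvE q).
  apply: (@le_trans _ _ (lebesgue_measure (N `|` \bigcup_k J k))).
    apply: le_measure; rewrite ?inE//.
      by apply: measurableU => //; exact: bigcupT_measurable.
    move=> t /=; rewrite in_itv/= => tq.
    have [At|nAt] := pselect (A (ins i t x)); first by left; exact: AN.
    right; have [|k _ /box_ins[ck Dkx]] := qc (ins i t x).
      by split => //; apply/box_ins.
    exists k => //; rewrite /J ifT; first by rewrite /= in_itv.
    by rewrite inE.
  apply: (le_trans (measureU2 _ _ _)) => //; first exact: bigcupT_measurable.
  rewrite [X in (X + _)%E]N0 add0e.
  apply: (@le_trans _ _ (\sum_(0 <= k <oo) lebesgue_measure (J k))%E).
    by apply: measure_sigma_subadditive => //; exact: bigcupT_measurable.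
  apply: lee_nneseries => [//|k _]; rewrite /J indicE.
  case: (x \in Dk k); first by rewrite itvE mule1.
  by rewrite measure0 mule0.
pose F k : leb_space R n -> \bar R :=
  fun x => ((side (c k) i)%:E * (\1_(Dk k) x)%:E)%E.
have mf k : measurable_fun D (F k).
  apply: measurable_funeM; apply/measurable_EFinP; exact: measurable_indic.
apply: (@le_trans _ _ ((side q i)%:E * mu D)%E).
  by rewrite (box_volume_face i) lee_wpmul2l// lee_fin.
rewrite -integral_cst//.
apply: (@le_trans _ _
  (\int[mu]_(x in D) \sum_(0 <= k <oo) (side (c k) i)%:E * (\1_(Dk k) x)%:E)%E).
  apply: ge0_le_integral; [exact: mD|by move=> x _; rewrite lee_fin| | |exact: seg].
    exact: measurable_cst.
  apply: (@ge0_emeasurable_sum _ _ _ _ F xpredT) => [k x _ _|k _]; last exact: mf.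
  by rewrite mule_ge0// lee_fin.
rewrite (@integral_nneseries _ _ _ _ _ mD F mf); last first.
  by move=> k x _; rewrite mule_ge0// lee_fin.
apply: lee_nneseries => [k _ _|k _].
  by apply: integral_ge0 => x _; rewrite mule_ge0// lee_fin.
rewrite /F ge0_integralZl_EFin; [|exact: mD|by move=> x _; rewrite lee_fin|
  by apply/measurable_EFinP; exact: measurable_indic|exact: side0].
rewrite integral_indic; [|exact: mD|exact: mDk].
rewrite (box_volume_face i) lee_wpmul2l ?lee_fin//.
apply: le_trans (lebesgue_outer_box_le _).
by apply: le_lebesgue_outer; exact: subIsetl.
Qed.

(** Induction on the dimension: the bound on the face required by [box_volume_le_cover] is the
    induction hypothesis, and the discarded set is empty. *)
Lemma lebesgue_box n (c : 'rV[R]_n * 'rV[R]_n) :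
  lebesgue_outer (box c) = box_volume c.
Proof.
apply/eqP; rewrite eq_le lebesgue_outer_box_le/=.
elim: n c => [|n IH] c.
  (* In dimension 0 the box is a single point, and a cover of it contains at least one box, of
     volume 1. *)
  apply: le_ereal_inf_tmp => _ [C [cC AC] <-].
  have [|b Cb _] := AC 0; first by move=> [].
  apply: esum_ge; exists [set b].
    by split; [exact: finite_set1|move=> _ ->].
  by rewrite fsbig_set1 /box_volume !big_ord0.
have [->|Xoo] := eqVneq (lebesgue_outer (box c)) +oo%E; first by rewrite leey.
have {}Xoo : (lebesgue_outer (box c) < +oo)%E by rewrite ltey.
apply/lee_addgt0Pr => e e0.
have [b [Xb sb]] := lebesgue_outer_cover e0 Xoo.
apply: le_trans sb.
apply: (@box_volume_le_cover _ ord0 _ set0); first exact: IH.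
  by move=> x; exact: negligible_set0.
by rewrite setD0.
Qed.

(** Removing [A] from a box does not make the box cheaper to cover, since [A] is negligible on every
    line in direction [i]; measurability of [A] then leaves no measure for its part in the box. *)
Lemma null_slices n (i : 'I_n.+1) (A : set 'rV[R]_n.+1) :
  measurable (A : set (leb_space R n.+1)) ->
  (forall x, lebesgue_measure.-negligible [set t | A (ins i t x)]) ->
  lebesgue_outer A = 0%E.
Proof.
move=> mA A0.
have box0 c : lebesgue_outer (A `&` box c) = 0%E.
  have Xoo : (lebesgue_outer (box c `\` A) < +oo)%E.
    rewrite (@le_lt_trans _ _ (lebesgue_outer (box c)))//.
      by apply: le_lebesgue_outer; exact: subDsetl.
    by rewrite lebesgue_box ltry.
  have h : (box_volume c <= lebesgue_outer (box c `\` A))%E.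
    apply/lee_addgt0Pr => e e0.
    have [b [Xb sb]] := lebesgue_outer_cover e0 Xoo.
    apply: le_trans sb; apply: box_volume_le_cover A0 Xb.
    by rewrite lebesgue_box.
  have := mA (box c); rewrite -/(lebesgue_outer _).
  rewrite [X in X = _](lebesgue_box c) setIC => E; apply/eqP.
  rewrite eq_le lebesgue_outer_ge0 andbT.
  rewrite -(leeD2rE (x := lebesgue_outer (box c `\` A)))//.
    by rewrite add0e [X in (X <= _)%E](_ : _ = box_volume c)// E.
  by rewrite ge0_fin_numE// lebesgue_outer_ge0.
pose Q k : 'rV[R]_n.+1 * 'rV[R]_n.+1 := (const_mx (- k%:R), const_mx k%:R).
apply/eqP; rewrite eq_le lebesgue_outer_ge0 andbT.
apply: (@le_trans _ _ (lebesgue_outer (\bigcup_k (A `&` box (Q k))))).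
  apply: le_lebesgue_outer => x Ax.
  have [k kx] : exists k : nat, forall j, `|x 0 j| < k%:R.
    exists (Num.truncn (\sum_j `|x 0 j|)).+1 => j.
    apply: (@le_lt_trans _ _ (\sum_j `|x 0 j|)).
      by rewrite (bigD1 j)//= lerDl sumr_ge0.
    by rewrite truncnS_gt.
  exists k => //; split => // j; rewrite !mxE.
  by have := kx j; rewrite ltr_norml => /andP[-> /ltW].
apply: le_trans (lebesgue_outer_sigma_subadditive _) _.
by rewrite eseries0// => k _ _; exact: box0.
Qed.

End lebesgue_boxes.

Section rowvec_norm.
Context {R : realType} {n : nat}.
Implicit Types x : 'rV[R]_n.

Lemma coord_le_norm x i : `|x 0 i| <= `|x|.
Proof.
rewrite [leRHS]/Num.Def.normr/= mx_normrE.
exact: (le_bigmax _ (fun ij : 'I_1 * 'I_n => `|x ij.1 ij.2|) (0, i)).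
Qed.

Lemma norm_row_le x (r : R) : 0 <= r -> (forall i, `|x 0 i| <= r) -> `|x| <= r.
Proof.
move=> r0 h; rewrite [leLHS]/Num.Def.normr/= mx_normrE.
by apply: bigmax_le => // -[a b] _ /=; rewrite ord1.
Qed.

Lemma norm_row_lt x (r : R) : 0 < r -> (forall i, `|x 0 i| < r) -> `|x| < r.
Proof.
move=> r0 h; rewrite [ltLHS]/Num.Def.normr/= mx_normrE.
by apply: bigmax_lt => // -[a b] _ /=; rewrite ord1.
Qed.

Lemma ball_rowE x (r : R) : ball x r = [set y | `|y - x| < r].
Proof.
by rewrite -ball_normE; apply/seteqP; split => y /=; rewrite distrC.
Qed.

End rowvec_norm.

(** * Open sets, outer regularity and null sets *)

Section lebesgue_topology.
Context {R : realType}.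

(** An open set is the union of the boxes with rational corners that it contains. *)
Lemma open_lebesgue_measurable n (U : set 'rV[R]_n) : open U ->
  measurable (U : set (leb_space R n)).
Proof.
move=> oU.
pose qbox (q : 'rV[rat]_n * 'rV[rat]_n) : set (leb_space R n) :=
  box (map_mx (ratr : rat -> R) q.1, map_mx (ratr : rat -> R) q.2).
pose F q : set (leb_space R n) := if `[< qbox q `<=` U >] then qbox q else set0.
have -> : U = \bigcup_q F q.
  apply/seteqP; split => [x Ux|x [q _]]; last first.
    by rewrite /F; case: asboolP => // qU; exact: qU.
  have /nbhs_ballP[e /= e0 xeU] : nbhs x U by rewrite nbhsE; exists U.
  have /choice[a ax] : forall i, exists q : rat, x 0 i - e < ratr q < x 0 i.
    move=> i; have [|q] := @rat_in_itvoo R (x 0 i - e) (x 0 i).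
      by rewrite ltrBlDr ltrDl.
    by rewrite in_itv/=; exists q.
  have /choice[b bx] : forall i, exists q : rat, x 0 i < ratr q < x 0 i + e.
    move=> i; have [|q] := @rat_in_itvoo R (x 0 i) (x 0 i + e).
      by rewrite ltrDl.
    by rewrite in_itv/=; exists q.
  exists (\row_i a i, \row_i b i) => //; rewrite /F asboolT.
    by move=> i; rewrite !mxE; have := ax i; have := bx i; lra.
  move=> y yq; apply: xeU; rewrite ball_rowE/=; apply: norm_row_lt => // i.
  rewrite ltr_norml !mxE; have := ax i; have := bx i; have := yq i.
  by rewrite !mxE; lra.
apply: countable_bigcupT_measurable => [|q]; first exact: countableP.
by rewrite /F; case: asboolP => // _; exact: box_measurable.
Qed.

(** The lower faces are open already. Only the upper corner moves, by [h], and the volume is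
    continuous in [h]. *)
Lemma box_volume_enlarge n (c : 'rV[R]_n * 'rV[R]_n) (e : R) : 0 < e ->
  exists U : set 'rV[R]_n, [/\ open U, box c `<=` U &
    (lebesgue_outer U <= box_volume c + e%:E)%E].
Proof.
move=> e0.
pose v h := \prod_i Num.max 0 (c.2 0 i + h - c.1 0 i).
have v0 : v h @[h --> (0:R)] --> v 0.
  apply: cvg_big => [|i _]; first exact: mul_continuous.
  apply: (@continuous_max R R (cst 0) (fun h => c.2 0 i + h - c.1 0 i) 0).
    exact: cvg_cst.
  apply: (@cvgB R R^o); last exact: cvg_cst.
  by apply: (@cvgD R R^o); [exact: cvg_cst|exact: cvg_id].
have [h h0 vh] : exists2 h, 0 < h & v h <= v 0 + e.
  move/cvgrPdist_lt : v0 => /(_ _ e0) /nbhs_ballP[d /= d0 dv].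
  exists (d / 2); first by rewrite divr_gt0.
  have := dv (d / 2); rewrite /ball/= sub0r normrN gtr0_norm ?divr_gt0//.
  rewrite ltr_pdivrMr// ltr_pMr// ltr1n => /(_ erefl).
  by rewrite ltr_norml => /andP[+ _]; lra.
pose w : 'rV[R]_n := \row_i (c.2 0 i + h).
pose B : set 'rV[R]_n := [set x | forall i, c.1 0 i < x 0 i < w 0 i].
exists B; split.
- rewrite (_ : B = \big[setI/setT]_(i < n)
      ((fun x : 'rV[R]_n => x 0 i) @^-1` `]c.1 0 i, w 0 i[%classic)).
    elim/big_ind : _ => [|U V|i _]; [exact: openT|exact: openI|].
    apply: open_comp; last exact: interval_open.
    by move=> x _; exact: coord_continuous.
  rewrite -bigcap_seq; apply/seteqP; split => x /= hx i.
    by move=> _; have := hx i; rewrite /preimage/= in_itv.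
  by have := hx i (mem_index_enum i); rewrite /preimage/= in_itv.
- move=> x xc i; have /andP[-> /= h2] := xc i.
  by rewrite mxE (le_lt_trans h2)// ltrDl.
- apply: (@le_trans _ _ (box_volume (c.1, w))).
    rewrite -lebesgue_box; apply: le_lebesgue_outer => x hx i /=.
    by have /andP[-> /ltW] := hx i.
  rewrite /box_volume -EFinD lee_fin/=.
  have -> : \prod_i Num.max 0 (w 0 i - c.1 0 i) = v h.
    by apply: eq_bigr => i _; rewrite mxE.
  apply: (le_trans vh); rewrite lerD2r /v.
  by under eq_bigr do rewrite addr0.
Qed.

Lemma lebesgue_outer_regular n (A : set 'rV[R]_n.+1) (e : R) : 0 < e ->
  (lebesgue_outer A < +oo)%E ->
  exists U : set 'rV[R]_n.+1, [/\ open U, A `<=` U &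
    (lebesgue_outer U <= lebesgue_outer A + e%:E)%E].
Proof.
move=> e0 Aoo; have e20 : 0 < e / 2 by rewrite divr_gt0.
have [c [Ac sc]] := lebesgue_outer_cover e20 Aoo.
have /choice[U hU] : forall k, exists U : set 'rV[R]_n.+1,
  [/\ open U, box (c k) `<=` U &
    (lebesgue_outer U <= box_volume (c k) + ((e / 2) / (2 ^ k.+1)%:R)%:E)%E].
  by move=> k; apply: box_volume_enlarge; rewrite divr_gt0.
exists (\bigcup_k U k); split.
- by apply: bigcup_open => k _; have [] := hU k.
- by move=> x /Ac[k _ xk]; exists k => //; have [_ h _] := hU k; exact: h.
apply: le_trans (lebesgue_outer_sigma_subadditive _) _.
apply: (@le_trans _ _ (\sum_(0 <= k <oo) (box_volume (c k) + ((e / 2) / (2 ^ k.+1)%:R)%:E))%E).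
  by apply: lee_nneseries => [k _ _|k _]; [exact: lebesgue_outer_ge0|have [] := hU k].
apply: (le_trans (epsilon_trick _ _ _)); [by move=> k; exact: box_volume_ge0|exact: ltW|].
by rewrite [in leRHS](splitr e) EFinD addeA leeD2r.
Qed.

Lemma cube_volume n (x : 'rV[R]_n) (a b : R) : a <= b ->
  box_volume (x + const_mx a, x + const_mx b) = ((b - a) ^+ n)%:E.
Proof.
move=> ab; rewrite /box_volume; congr (_%:E).
rewrite (eq_bigr (fun=> b - a)) ?prodr_const ?card_ord// => i _.
by rewrite !mxE max_r//; [ring|rewrite subr_ge0 lerD2l].
Qed.

Lemma lebesgue_ball_ge n (x : 'rV[R]_n) r : 0 < r ->
  ((r ^+ n)%:E <= lebesgue_outer (ball x r))%E.
Proof.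
move=> r0; have <- : r / 2 - (- (r / 2)) = r by lra.
rewrite -(cube_volume x); last by lra.
rewrite -lebesgue_box; apply: le_lebesgue_outer => y yb.
rewrite ball_rowE/=; apply: norm_row_lt; first by lra.
by move=> i; have := yb i; rewrite !mxE ltr_norml; lra.
Qed.

Lemma lebesgue_ball_le n (x : 'rV[R]_n) r : 0 < r ->
  (lebesgue_outer (ball x r) <= ((2 * r) ^+ n)%:E)%E.
Proof.
move=> r0; have -> : 2 * r = r - (- r) by lra.
rewrite -(cube_volume x); last by lra.
rewrite -lebesgue_box; apply: le_lebesgue_outer => y.
rewrite ball_rowE/= => yx i; have := le_lt_trans (coord_le_norm _ i) yx.
by rewrite !mxE ltr_norml; lra.
Qed.

Lemma ball_lebesgue_measurable n (x : 'rV[R]_n) r :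
  measurable (ball x r : set (leb_space R n)).
Proof. exact/open_lebesgue_measurable/ball_open. Qed.

Lemma bigcup_ball0 n : \bigcup_k ball (0 : 'rV[R]_n) k.+1%:R = setT.
Proof.
apply/seteqP; split => // x _; exists (Num.truncn `|x|) => //.
by rewrite ball_rowE/= subr0 truncnS_gt.
Qed.

Lemma lebesgue_sigma_finite n : sigma_finite setT (lebesgue R n).
Proof.
exists (fun k => ball (0 : 'rV[R]_n) k.+1%:R); first by rewrite bigcup_ball0.
move=> k; split; first exact: ball_lebesgue_measurable.
by apply: (le_lt_trans (lebesgue_ball_le _ _)); rewrite ?ltry ?ltr0n.
Qed.

HB.instance Definition _ n := Measure_isSigmaFinite.Build _ _ _ (lebesgue R n)
  (lebesgue_sigma_finite n).

(** Every set of outer measure 0 is Carathéodory measurable, so almost-everywhere statements can be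
    handled by outer measure alone. *)
Lemma lebesgue_negligibleP n (A : set 'rV[R]_n) :
  (lebesgue R n).-negligible (A : set (leb_space R n)) <-> lebesgue_outer A = 0%E.
Proof.
split => [[B [mB B0 AB]]|A0].
  apply/eqP; rewrite eq_le lebesgue_outer_ge0 andbT.
  by rewrite (le_trans (le_lebesgue_outer AB))// [X in (X <= _)%E]B0.
exists A; split => //; apply: le_caratheodory_measurable => X.
change (lebesgue_outer (X `&` A) + lebesgue_outer (X `&` ~` A) <= lebesgue_outer X)%E.
have -> : lebesgue_outer (X `&` A) = 0%E.
  apply/eqP; rewrite eq_le lebesgue_outer_ge0 andbT -A0.
  by apply: le_lebesgue_outer; exact: subIsetr.
by rewrite add0e; apply: le_lebesgue_outer; exact: subIsetl.
Qed.

End lebesgue_topology.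

(** * Vitali coverings and density points *)

Section vitali.
Context {R : realType}.

(* Zorn's lemma on the disjoint subfamilies [D] of [V] such that whatever meets
   [D] meets a member of [D] of at least half its size. *)
Lemma vitali_covering (I T : Type) (B : I -> set T) (r : I -> R) (V : set I) (M : R) :
  (forall i, V i -> B i !=set0) -> (forall i, V i -> 0 < r i <= M) ->
  exists D : set I, [/\ D `<=` V, trivIset D B &
    forall i, V i -> exists2 j, D j & B i `&` B j !=set0 /\ r i <= 2 * r j].
Proof.
move=> B0 rM.
pose meets (D : set I) i := exists2 j, D j & B i `&` B j !=set0.
pose P (D : set I) := [/\ D `<=` V, trivIset D B & forall i, V i -> meets D i ->
  exists2 j, D j & B i `&` B j !=set0 /\ r i <= 2 * r j].
have [D [[DV tD DP] Dmax]] : exists D, P D /\ forall D', D `<` D' -> ~ P D'.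
  apply: Zorn_bigcup => F FP Ftot; split.
  - by move=> i [D FD Di]; have [DV _ _] := FP _ FD; exact: DV.
  - move=> i j [D FD Di] [E FE Ej] ij.
    have [DE|ED] := Ftot _ _ FD FE.
      by have [_ tE _] := FP _ FE; apply: tE => //; exact: DE.
    by have [_ tD _] := FP _ FD; apply: tD => //; exact: ED.
  - move=> i Vi [j [D FD Dj] ij]; have [_ _ DP] := FP _ FD.
    by have [|k Dk ik] := DP i Vi; [exists j|exists k => //; exists D].
exists D; split => // i Vi; apply: (DP _ Vi).
apply: contrapT => nmi.
(* Among the members that meet nothing in [D], one larger than half the supremum of their sizes can
   be added to [D], against maximality. *)
pose W := [set p | V p /\ ~ meets D p].
have supW : has_sup (r @` W).
  by split; [exists (r i); exists i|exists M => _ [p [Vp _] <-]; have /andP[] := rM p Vp].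
have s0 : 0 < sup (r @` W).
  have /andP[ri0 _] := rM i Vi.
  by apply: (lt_le_trans ri0); apply: ub_le_sup; [exact: supW.2|exists i].
have s20 : 0 < sup (r @` W) / 2 by rewrite divr_gt0.
have [_ [p [Vp nmp] <-] sp] := sup_adherent s20 supW.
apply: (Dmax (D `|` [set p])).
  split; first by move=> x Dx; left.
  move=> /(_ p (or_intror erefl)) Dp; apply: nmp; exists p => //.
  by rewrite setIid; exact: B0.
split.
- by move=> x [/DV|->].
- move=> x y [Dx|->] [Dy|->] xy //; first exact: tD.
    by exfalso; apply: nmp; exists x => //; rewrite setIC.
  by exfalso; apply: nmp; exists y.
- move=> x Vx [y Dy xy]; have [mx|nmx] := pselect (meets D x).
    by have [k Dk ?] := DP _ Vx mx; exists k => //; left.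
  exists p; first by right.
  case: Dy xy => [Dy|->] xy; first by exfalso; apply: nmx; exists y.
  split => //; have : r x <= sup (r @` W).
    by apply: ub_le_sup; [exact: supW.2|exists x].
  by move: sp; lra.
Qed.

Lemma countable_seq (T : Type) (x0 : T) (C : set T) : countable C -> ~ C x0 ->
  exists c : nat -> T, [/\ forall x, C x -> exists k, c k = x,
    forall k, c k = x0 \/ C (c k) & forall k l, C (c k) -> c k = c l -> k = l].
Proof.
move=> /countable_injP[h hinj] Cx0.
pose e k := if pselect (exists2 x, C x & h x = k) is left P
            then projT1 (cid2 P) else x0.
have eP k : e k = x0 \/ C (e k) /\ h (e k) = k.
  rewrite /e; case: pselect => [P|_]; last by left.
  by right; case: cid2.
exists e; split => [x Cx|k|k l Ck kl].
- exists (h x); case: (eP (h x)) => [|[Ce /hinj]]; last by rewrite !inE; apply.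
  rewrite /e; case: pselect => [P|]; last by case; exists x.
  by case: cid2 => /= y Cy _ yx0; rewrite yx0 in Cy.
- by case: (eP k) => [|[]]; [left|right].
- case: (eP k) => [ek|[_ <-]]; first by rewrite ek in Ck.
  case: (eP l) => [el|[_ <-]]; first by rewrite kl el in Ck.
  by rewrite kl.
Qed.

Lemma rat_in_ball n (x : 'rV[R]_n) r : 0 < r ->
  exists q : 'rV[rat]_n, ball x r (map_mx ratr q).
Proof.
move=> r0; have /choice[a ax] : forall i, exists q : rat, x 0 i - r < ratr q < x 0 i + r.
  move=> i; have [|q] := @rat_in_itvoo R (x 0 i - r) (x 0 i + r); first by lra.
  by rewrite in_itv/=; exists q.
exists (\row_i a i); rewrite ball_rowE/=; apply: norm_row_lt => // i.
by rewrite !mxE ltr_norml; have := ax i; lra.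
Qed.

Lemma trivIset_balls_countable n (D : set ('rV[R]_n * R)) :
  (forall p, D p -> 0 < p.2) -> trivIset D (fun p => ball p.1 p.2) -> countable D.
Proof.
move=> D0 tD.
have /choice[f fP] : forall p : 'rV[R]_n * R, exists q : 'rV[rat]_n,
    0 < p.2 -> ball p.1 p.2 (map_mx ratr q).
  move=> p; have [p0|p0] := ltP 0 p.2; last by exists 0.
  by have [q pq] := rat_in_ball p.1 p0; exists q.
apply/countable_injP; exists (pickle \o f) => p q; rewrite !inE => Dp Dq.
move=> /(pcan_inj pickleK) pq; apply: tD => //; exists (map_mx ratr (f p)).
by split; [apply: fP; exact: D0|rewrite pq; apply: fP; exact: D0].
Qed.

Lemma lebesgue_split n (F : set 'rV[R]_n) (X : set 'rV[R]_n) :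
  measurable (F : set (leb_space R n)) ->
  lebesgue_outer X = (lebesgue_outer (X `&` F) + lebesgue_outer (X `\` F))%E.
Proof. by move=> mF; exact: mF. Qed.

(** Each small ball around a point of [E] loses a fixed proportion outside [F]. Disjoint balls
    chosen inside an open set barely larger than [F] lose at most the small excess in total, and
    their threefold dilates cover [E]. *)
Lemma vitali_null n (E F : set 'rV[R]_n.+1) (c : R) :
  measurable (F : set (leb_space R n.+1)) -> E `<=` F -> 0 < c ->
  (forall x, E x -> forall d, 0 < d -> exists r, 0 < r < d /\
    ((c * r ^+ n.+1)%:E <= lebesgue_outer (ball x r `\` F))%E) ->
  lebesgue_outer E = 0%E.
Proof.
move=> mF EF c0 hE; pose mu := lebesgue R n.+1.
suff bdd k : lebesgue_outer (E `&` ball 0 k.+1%:R) = 0%E.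
  apply/eqP; rewrite eq_le lebesgue_outer_ge0 andbT -(setIT E) -bigcup_ball0.
  rewrite setI_bigcupr (le_trans (lebesgue_outer_sigma_subadditive _))//.
  by rewrite eseries0.
set Ek := _ `&` _; pose Fk := F `&` ball 0 k.+1%:R.
have mFk : measurable (Fk : set (leb_space R n.+1)).
  by apply: measurableI => //; exact: ball_lebesgue_measurable.
have Fkoo : (lebesgue_outer Fk < +oo)%E.
  apply: (@le_lt_trans _ _ (lebesgue_outer (ball 0 k.+1%:R))).
    by apply: le_lebesgue_outer; exact: subIsetr.
  by apply: (le_lt_trans (lebesgue_ball_le _ _)); rewrite ?ltry ?ltr0n.
have C0 : 0 < 6 ^+ n.+1 / c by rewrite divr_gt0// exprn_gt0.
apply/eqP; rewrite eq_le lebesgue_outer_ge0 andbT.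
apply/lee_addgt0Pr => e e0; rewrite add0e.
(* The 6 is 2 times 3: a ball of radius [r] is a cube of side [2 r], and a ball meeting one of at
   least half its radius has its centre in the threefold dilate. *)
pose eta := e / (6 ^+ n.+1 / c).
have eta0 : 0 < eta by rewrite divr_gt0.
have [U [oU FU Ueta]] := lebesgue_outer_regular eta0 Fkoo.
have mU : measurable (U : set (leb_space R n.+1)) by exact: open_lebesgue_measurable.
have UF : (mu (U `\` Fk) <= eta%:E)%E.
  move: Ueta; rewrite (lebesgue_split U mFk) (setIidr FU) leeD2lE//.
  by rewrite ge0_fin_numE// lebesgue_outer_ge0.
pose V : set ('rV[R]_n.+1 * R) := [set p | [/\ Ek p.1, 0 < p.2 <= 1,
  ball p.1 p.2 `<=` U & ((c * p.2 ^+ n.+1)%:E <= lebesgue_outer (ball p.1 p.2 `\` F))%E]].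
have EV x : Ek x -> exists r, V (x, r).
  move=> Ekx; have Ux : U x by apply: FU; split; [exact/EF/Ekx.1|exact: Ekx.2].
  have /nbhs_ballP[d /= d0 xdU] : nbhs x U by rewrite nbhsE; exists U.
  have [|r [/andP[r0 rd] cr]] := hE x Ekx.1 (Num.min d 1); first by rewrite lt_min d0/=.
  move: rd; rewrite lt_min => /andP[rd r1].
  exists r; split => //=; first by rewrite r0 ltW.
  by apply: subset_trans xdU; apply: le_ball; exact: ltW.
have [|p [_ /andP[p0 p1] _ _]|D [DV tD Dcov]] :=
  @vitali_covering _ _ (fun p : 'rV[R]_n.+1 * R => ball p.1 p.2) snd V 1.
- by move=> p [_ /andP[p0 _] _ _]; exists p.1; exact: ballxx.
- by rewrite p0.
have cD : countable D.
  by apply: trivIset_balls_countable => // p /DV[_ /andP[]].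
have [|b [bD b0 binj]] := @countable_seq _ (0, 0) D cD.
  by move=> /DV[_ /=]; rewrite ltxx.
have b20 j : 0 <= (b j).2.
  by case: (b0 j) => [->|/DV[_ /andP[/ltW]]].
pose G j := ball (b j).1 (b j).2 `\` F.
have ball00 : ball (0 : 'rV[R]_n.+1) 0 = set0.
  by rewrite ball_rowE; apply/seteqP; split => // y /=; rewrite ltNge normr_ge0.
have mG j : measurable (G j : set (leb_space R n.+1)).
  by apply: measurableD => //; exact: ball_lebesgue_measurable.
have tG : trivIset setT G.
  move=> i j _ _ [x [[xi Fx] [xj _]]].
  case: (b0 i) => [bi|Di]; first by move: xi; rewrite bi /= ball00.
  case: (b0 j) => [bj|Dj]; first by move: xj; rewrite bj /= ball00.
  by apply: binj => //; apply: tD => //; exists x.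
apply: (@le_trans _ _ (lebesgue_outer (\bigcup_j ball (b j).1 (3 * (b j).2)))).
  apply: le_lebesgue_outer => x Ekx; have [r Vxr] := EV _ Ekx.
  have [q Dq [[y [/= xy qy]] /= rq]] := Dcov _ Vxr.
  have [j bj] := bD _ Dq; exists j => //; rewrite bj.
  move: xy qy; rewrite !ball_rowE /= => xy qy.
  rewrite -(subrKA y) (le_lt_trans (ler_normD _ _))// distrC.
  by move: xy qy rq; lra.
apply: (le_trans (lebesgue_outer_sigma_subadditive _)).
apply: (@le_trans _ _ (\sum_(0 <= j <oo) (6 ^+ n.+1 / c)%:E * mu (G j))%E).
  apply: lee_nneseries => [j _ _|j _]; first exact: lebesgue_outer_ge0.
  case: (b0 j) => [bj|/DV[_ /andP[bj0 _] _ bjc]].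
    rewrite bj /= mulr0 ball00 lebesgue_outer0.
    by rewrite mule_ge0// lee_fin ltW.
  apply: (le_trans (lebesgue_ball_le _ _)); first by rewrite mulr_gt0.
  rewrite mulrA -natrM -[leLHS]mul1e.
  apply: le_trans (lee_wpmul2l _ bjc); last by rewrite lee_fin ltW.
  by rewrite mul1e -EFinM lee_fin exprMn mulrA divfK ?gt_eqF.
rewrite nneseriesZl; last by move=> j _; exact: measure_ge0.
apply: (@le_trans _ _ ((6 ^+ n.+1 / c)%:E * eta%:E)%E).
  rewrite lee_wpmul2l ?lee_fin ?(ltW C0)//.
  have <- : mu (\bigcup_j G j) = (\sum_(0 <= j <oo) mu (G j))%E.
    rewrite [LHS](measure_bigcup (lebesgue R n.+1) setT G (fun j _ => mG j) tG).
    by apply: eq_eseriesl => j; rewrite in_setT.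
  apply: le_trans UF; apply: le_lebesgue_outer => x [j _ [xj Fx]].
  case: (b0 j) => [bj|/DV[_ _ jU _]]; first by move: xj; rewrite bj /= ball00.
  by split; [exact: jU|move=> []].
by rewrite -EFinM lee_fin mulrC divfK ?gt_eqF.
Qed.


Lemma enorm_coord_le n (x : 'rV[R]_n) i : `|x 0 i| <= enorm x.
Proof.
rewrite -sqrtr_sqr ler_wsqrtr// /dot (bigD1 i)//= expr2 lerDl.
by apply: sumr_ge0 => j _; rewrite -expr2 sqr_ge0.
Qed.

Lemma enorm_le n (x : 'rV[R]_n.+1) : enorm x <= n.+1%:R * `|x|.
Proof.
rewrite -[leRHS]ger0_norm ?mulr_ge0// -sqrtr_sqr ler_wsqrtr//.
apply: (@le_trans _ _ (\sum_(i < n.+1) `|x| ^+ 2)).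
  apply: ler_sum => i _; rewrite -expr2 -real_normK ?num_real//.
  by rewrite lerXn2r ?nnegrE//; exact: coord_le_norm.
rewrite sumr_const card_ord -[leLHS]mulr_natl exprMn ler_wpM2r ?exprn_ge0//.
by rewrite -[leLHS]expr1 ler_weXn2l// ler1n.
Qed.

Lemma eball_sub_ball n (x : 'rV[R]_n) r : 0 < r -> eball x r `<=` ball x r.
Proof.
move=> r0 y yx; rewrite ball_rowE/=; apply: norm_row_lt => // i.
exact: le_lt_trans (enorm_coord_le _ i) yx.
Qed.

Lemma ball_sub_eball n (x : 'rV[R]_n.+1) r : ball x (r / n.+1%:R) `<=` eball x r.
Proof.
move=> y; rewrite ball_rowE/= ltr_pdivlMr// mulrC => yx.
exact: le_lt_trans (enorm_le _) yx.
Qed.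

Lemma lebesgue_eball_fin n (x : 'rV[R]_n) r : 0 < r ->
  (lebesgue_outer (eball x r) < +oo)%E.
Proof.
move=> r0; apply: le_lt_trans (le_lebesgue_outer (eball_sub_ball r0)) _.
by apply: (le_lt_trans (lebesgue_ball_le _ _)); rewrite ?ltry.
Qed.

Lemma lebesgue_eball_ge n (x : 'rV[R]_n.+1) r : 0 < r ->
  (((r / n.+1%:R) ^+ n.+1)%:E <= lebesgue_outer (eball x r))%E.
Proof.
move=> r0; apply: le_trans (le_lebesgue_outer (@ball_sub_eball _ x r)).
by apply: lebesgue_ball_ge; rewrite divr_gt0.
Qed.

(** * Lebesgue's density theorem *)

Section density.
Context {n : nat}.
Variable A : set 'rV[R]_n.+1.
Hypothesis mA : measurable (A : set (leb_space R n.+1)).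

Let a x r := fine (lebesgue R n.+1 (A `&` eball x r)).
Let b x r := fine (lebesgue R n.+1 (eball x r)).

Let lebesgueI_fin (B : set 'rV[R]_n.+1) x r : 0 < r ->
  lebesgue_outer (B `&` eball x r) \is a fin_num.
Proof.
move=> r0; rewrite ge0_fin_numE; last exact: lebesgue_outer_ge0.
apply: le_lt_trans (lebesgue_eball_fin x r0).
by apply: le_lebesgue_outer; exact: subIsetr.
Qed.

Let b_gt0 x r : 0 < r -> 0 < b x r.
Proof.
move=> r0; rewrite -lte_fin fineK.
  by apply: lt_le_trans (lebesgue_eball_ge x r0); rewrite lte_fin exprn_gt0// divr_gt0.
by rewrite -[eball _ _]setTI; exact: lebesgueI_fin.
Qed.

Let abE x r : 0 < r ->
  b x r = a x r + fine (lebesgue_outer (~` A `&` eball x r)).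
Proof.
move=> r0; rewrite /b /a [lebesgue R n.+1 (eball x r)](lebesgue_split (eball x r) mA).
rewrite fineD; [by rewrite setIC setDE [X in _ + fine (_ X)]setIC| |].
  by rewrite setIC; exact: lebesgueI_fin.
by rewrite setDE setIC; exact: lebesgueI_fin.
Qed.

Let rn (r : R) : (r / n.+1%:R) ^+ n.+1 = (n.+1%:R^-1 ^+ n.+1) * r ^+ n.+1.
Proof. by rewrite mulrC exprMn. Qed.

Let c0 : 0 < n.+1%:R^-1 ^+ n.+1 :> R. Proof. by rewrite exprn_gt0// invr_gt0. Qed.

(** [eball x r] lies in [ball x r] and contains [ball x (r / n.+1)]; the power of [n.+1%:R^-1] is
    the price of passing from Euclidean to sup-norm balls. *)
Let le_lebesgueI (B : set 'rV[R]_n.+1) x r t : 0 < r -> 0 < t ->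
  t * b x r <= fine (lebesgue_outer (B `&` eball x r)) ->
  ((t * (n.+1%:R^-1 ^+ n.+1) * r ^+ n.+1)%:E <= lebesgue_outer (ball x r `&` B))%E.
Proof.
move=> r0 t0 h.
apply: (@le_trans _ _ (lebesgue_outer (B `&` eball x r))); last first.
  by apply: le_lebesgue_outer => y [By xy]; split => //; exact: eball_sub_ball.
rewrite -(fineK (lebesgueI_fin _ _ r0)) lee_fin (le_trans _ h)// -mulrA -rn.
rewrite ler_pM2l// -lee_fin fineK; first exact: lebesgue_eball_ge.
by rewrite -[eball _ _]setTI; exact: lebesgueI_fin.
Qed.

(** Around a density point outside [A], the set [A] fills half of every small ball; [vitali_null]
    applies with the complement of [A] as [F]. *)
Lemma density_points_subset_ae :
  lebesgue_outer (density_points A `\` A) = 0%E.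
Proof.
apply: (@vitali_null _ _ (~` A) (2^-1 * (n.+1%:R^-1 ^+ n.+1))).
- exact: measurableC.
- by move=> x [].
- by rewrite mulr_gt0.
move=> x [dx _] d d0.
move/cvgrPdist_lt : dx => /(_ 2^-1 ltac:(by [])) dx.
have [r [r0 rd hr]] : exists r, [/\ 0 < r, r < d & `|1 - a x r / b x r| < 2^-1].
  near (0 : R)^'+ => r; exists r; split.
  - by near: r; exact: nbhs_right_gt.
  - by near: r; exact: nbhs_right_lt.
  - by near: r; exact: dx.
exists r; rewrite r0 rd; split => //; rewrite setDE setCK.
apply: le_lebesgueI => //; rewrite -/(a x r) -ler_pdivlMr ?b_gt0//.
by move: hr; rewrite ltr_norml => /andP[_]; lra.
Unshelve. all: by end_near. Qed.

(** Where the density is not 1, the complement of [A] occupies a proportion [1/(k+1)] of arbitrarily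
    small balls for some [k]; for each [k] such points of [A] form a null set. *)
Lemma subset_density_points_ae :
  lebesgue_outer (A `\` density_points A) = 0%E.
Proof.
pose E k := [set x | A x /\ forall d, 0 < d -> exists r, 0 < r < d /\
  k.+1%:R^-1 * b x r <= fine (lebesgue_outer (~` A `&` eball x r))].
have E0 k : lebesgue_outer (E k) = 0%E.
  apply: (@vitali_null _ _ A (k.+1%:R^-1 * (n.+1%:R^-1 ^+ n.+1))) => //.
  - by move=> x [].
  move=> x [Ax h] d d0; have [r [/andP[r0 rd] hr]] := h d d0; exists r.
  by rewrite r0 rd; split => //; rewrite setDE; exact: le_lebesgueI.
apply/eqP; rewrite eq_le lebesgue_outer_ge0 andbT.
apply: (@le_trans _ _ (lebesgue_outer (\bigcup_k E k))); last first.
  by rewrite (le_trans (lebesgue_outer_sigma_subadditive _))// eseries0.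
apply: le_lebesgue_outer => x [Ax ndx].
apply: contrapT => nE; apply: ndx; rewrite /density_points/=.
apply/cvgrPdist_lt => e e0.
have [k ke] : exists k : nat, k.+1%:R^-1 < e.
  exists (Num.truncn e^-1); rewrite invf_plt ?posrE//.
  exact: truncnS_gt.
have [d d0 hd] : exists2 d, 0 < d & forall r, 0 < r < d ->
    fine (lebesgue_outer (~` A `&` eball x r)) < k.+1%:R^-1 * b x r.
  apply: contrapT => h; apply: nE; exists k => //; split => // d d0.
  apply: contrapT => h'; apply: h; exists d => // r rd.
  by rewrite ltNge; apply/negP => h''; apply: h'; exists r.
near=> r; have r0 : 0 < r by near: r; exact: nbhs_right_gt.
have rd : r < d by near: r; exact: nbhs_right_lt.
have := hd r; rewrite r0 rd => /(_ erefl) hr.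
have br := b_gt0 x r0; rewrite -/(a x r) -/(b x r).
have -> : 1 - a x r / b x r = fine (lebesgue_outer (~` A `&` eball x r)) / b x r.
  have -> : fine (lebesgue_outer (~` A `&` eball x r)) = b x r - a x r.
    by rewrite abE// addrAC subrr add0r.
  by rewrite mulrBl divff// gt_eqF.
rewrite ger0_norm; last by rewrite divr_ge0 ?(ltW br)// fine_ge0 ?lebesgue_outer_ge0.
by rewrite (le_lt_trans _ ke)// ler_pdivrMr// ltW.
Unshelve. all: by end_near. Qed.

End density.

End vitali.

(** * Rademacher's theorem *)

Section lipschitz_derivable.
Context {R : realType}.

Lemma wlength_lipschitz (F : R -> R) (M : R) (X : set R) :
  (forall x y, x <= y -> F y - F x <= M * (y - x)) -> ocitv X ->
  (wlength F X <= M%:E * wlength idfun X)%E.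
Proof.
move=> FM [[a b] _ <-] /=.
rewrite !wlength_itv/= lte_fin; case: ltP => ab; last by rewrite mule0.
by rewrite -!EFinB -EFinM lee_fin; exact/FM/ltW.
Qed.

(** Both measures are computed from covers by intervals, and the [F]-length of an interval is at
    most [M] times its length. *)
Lemma lebesgue_stieltjes_dominated (F : cumulative R R) (M : R) :
  (forall x y, x <= y -> F y - F x <= M * (y - x)) ->
  lebesgue_stieltjes_measure F `<< @lebesgue_measure R.
Proof.
move=> FM A A0 B mB BA; have B0 := A0 _ mB BA.
have M0 : 0 <= M.
  have := FM 0 1 ler01; rewrite subr0 mulr1; apply: le_trans.
  by rewrite subr_ge0; exact: cumulative_is_nondecreasing.
apply/eqP; rewrite eq_le measure_ge0 andbT.
apply/lee_addgt0Pr => e e0; rewrite add0e.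
(* The divisor is [M + 1] because [M] may be 0. *)
have d0 : 0 < e / (M + 1) by rewrite divr_gt0// ltr_wpDl.
have [_ [C [mC BC] <-]] := @lb_ereal_inf_adherent R
  [set (\sum_(0 <= k <oo) wlength idfun (C k))%E | C in
    @measurable_cover _ (ocitv_type R) B] _ d0
  (ltac:(by rewrite [X in X \is a fin_num]B0)).
rewrite [ereal_inf _]B0 add0e => CM.
apply: (@le_trans _ _ (\sum_(0 <= k <oo) wlength F (C k))%E).
  by apply: ereal_inf_lbound; exists C.
apply: (@le_trans _ _ (\sum_(0 <= k <oo) M%:E * wlength idfun (C k))%E).
  apply: lee_nneseries => [k _ _|k _]; first exact: wlength_ge0.
  by apply: wlength_lipschitz => //; exact: mC.
rewrite nneseriesZl; last by move=> k _; exact: wlength_ge0.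
apply: (@le_trans _ _ (M%:E * (e / (M + 1))%:E)%E).
  by rewrite lee_wpmul2l ?lee_fin// ltW.
rewrite -EFinM lee_fin mulrCA ler_piMr ?(ltW e0)//.
by rewrite ler_pdivrMr ?ltr_wpDl// mul1r lerDl.
Qed.

Lemma lebesgue_stieltjes_itv (F : cumulative R R) (a b : R) : a <= b ->
  lebesgue_stieltjes_measure F `]a, b]%classic = (F b - F a)%:E.
Proof.
move=> ab; rewrite /lebesgue_stieltjes_measure /measure_extension.
by rewrite measurable_mu_extE/=; [rewrite wlength_itv_bnd|exact: is_ocitv].
Qed.

(* Radon-Nikodym and the Lebesgue differentiation theorem. *)
Lemma cumulative_derivable_ae (F : cumulativeBounded (0 : R) 1) (M a : R) :
  (forall x y, x <= y -> F y - F x <= M * (y - x)) -> F a = 0 ->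
  lebesgue_measure.-negligible [set x | a < x /\ ~ derivable F x 1].
Proof.
move=> FM Fa.
pose nu := charge_of_finite_measure (lebesgue_stieltjes_measure F).
have numu : nu `<< @lebesgue_measure R by exact: lebesgue_stieltjes_dominated FM.
pose h x := fine (Radon_Nikodym nu (@lebesgue_measure R) x).
have hE : EFin \o h = Radon_Nikodym nu (@lebesgue_measure R).
  by apply/funext => x /=; rewrite fineK//; exact: Radon_Nikodym_fin_num.
have ih : (@lebesgue_measure R).-integrable setT (EFin \o h).
  by rewrite hE; exact: Radon_Nikodym_integrable.
have Fint x : a < x -> F x = (\int[lebesgue_measure]_(t in [set` Interval (BRight a) (BRight x)]) h t)%R.
  move=> ax; rewrite /Rintegral.
  have -> : (\int[lebesgue_measure]_(t in `]a, x]) (h t)%:E =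
      nu `]a, x]%classic)%E.
    have E := Radon_Nikodym_integral numu (measurable_itv `]a, x]).
    by rewrite [RHS]E; apply: eq_integral => t _; rewrite -hE.
  rewrite [nu _]lebesgue_stieltjes_itv ?ltW//= Fa subr0//.
have := lebesgue_differentiation (open_integrable_locally openT ih).
apply: negligibleS => x [ax nd] lx; apply: nd.
have [|||] := @FTC1_lebesgue_pt R h (BRight a) x (x + 1) _ _ _ lx.
- by rewrite ltrDl.
- exact: integrableS ih.
- by first [exact: ax|rewrite lteBSide|rewrite /Order.lt/=].
move=> + _.
apply: near_eq_derivable; near=> y; rewrite Fint//.
by near: y; exact: lt_nbhsr.
Unshelve. all: by end_near.
Qed.


(** Adding [(L + 1) x] makes [f] strictly increasing. Stopped outside [[a, b]] and rescaled to run
    from 0 to 1, the sum is a distribution function [F], to which [cumulative_derivable_ae] applies.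
    Between [a] and [b], [f] is recovered from [F] by affine operations. *)
Lemma lipschitz_derivable_ae (f : R -> R) (L : R) :
  (forall x y, `|f x - f y| <= L * `|x - y|) ->
  lebesgue_measure.-negligible [set x | ~ derivable f x 1].
Proof.
move=> fL.
suff bdd (k : nat) : lebesgue_measure.-negligible
    [set x | - k.+1%:R < x < k.+1%:R /\ ~ derivable f x 1].
  apply: negligibleS (negligible_bigcup bdd) => x nd.
  exists (Num.truncn `|x|) => //=; split => //.
  by rewrite -ltr_norml truncnS_gt.
set a : R := - k.+1%:R; set b : R := k.+1%:R.
have ab : a < b by rewrite /a /b; have : 0 < k.+1%:R :> R by []; lra.
have L0 : 0 <= L.
  by have := fL 1 0; rewrite subr0 normr1 mulr1; apply: le_trans.
pose c (x : R) := Num.max a (Num.min x b).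
pose g x := f x + (L + 1) * x.
pose F x := (g (c x) - g a) / (g b - g a).
have gmono x y : x <= y -> y - x <= g y - g x <= (2 * L + 1) * (y - x).
  move=> xy; have := fL y x; rewrite /g ler_norml.
  rewrite [`|y - x|]ger0_norm ?subr_ge0//; lra.
have cmono x y : x <= y -> 0 <= c y - c x <= y - x.
  by rewrite /c /Num.max /Num.min => xy; do ! case: ifPn; rewrite -?leNgt; move: ab; lra.
have gab : 0 < g b - g a by have := gmono a b (ltW ab); lra.
pose M := (2 * L + 1) / (g b - g a).
have FM x y : x <= y -> 0 <= F y - F x <= M * (y - x).
  move=> xy; have := cmono _ _ xy => /andP[c1 c2].
  have /andP[g1 g2] : c y - c x <= g (c y) - g (c x) <= (2 * L + 1) * (c y - c x).
    by apply: gmono; rewrite -subr_ge0.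
  rewrite /F -mulrBl /M; apply/andP; split.
    by apply: divr_ge0; [lra|exact: ltW].
  rewrite mulrAC ler_pM2r ?invr_gt0//.
  apply: (@le_trans _ _ ((2 * L + 1) * (c y - c x))); first by lra.
  by rewrite ler_wpM2l//; lra.
have M0 : 0 <= M by rewrite /M divr_ge0 ?(ltW gab)//; lra.
have Fnd : {homo F : x y / x <= y}.
  by move=> x y /FM/andP[+ _]; rewrite subr_ge0.
have Fcont : continuous F.
  move=> x; apply/cvgrPdist_le => e e0.
  near=> y; apply: (@le_trans _ _ (M * `|x - y|)).
    have [xy|/ltW yx] := leP x y.
      rewrite distrC [`|x - y|]distrC !ger0_norm ?subr_ge0//.
        by have /andP[] := FM _ _ xy.
      exact: Fnd.
    rewrite !ger0_norm ?subr_ge0//.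
      by have /andP[] := FM _ _ yx.
    exact: Fnd.
  rewrite (@le_trans _ _ ((M + 1) * `|x - y|))// ?ler_wpM2r ?lerDl//.
  rewrite mulrC -ler_pdivlMr ?ltr_wpDl//; near: y.
  by apply: cvgr_dist_le; [exact: cvg_id|rewrite divr_gt0// ltr_wpDl].
have F0 x : x <= a -> F x = 0.
  move=> xa; rewrite /F (_ : c x = a) ?subrr ?mul0r//.
  by rewrite /c /Num.max /Num.min; do ! case: ifPn; rewrite -?leNgt; move: ab xa; lra.
have F1 x : b <= x -> F x = 1.
  move=> xa; rewrite /F (_ : c x = b) ?divff ?gt_eqF//.
  by rewrite /c /Num.max /Num.min; do ! case: ifPn; rewrite -?leNgt; move: ab xa; lra.
have FNy : F x @[x --> -oo] --> (0 : R).
  apply: cvg_near_cst; exists a; split; [exact: num_real|by move=> y /ltW /F0].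
have Fy : F x @[x --> +oo] --> (1 : R).
  apply: cvg_near_cst; exists b; split; [exact: num_real|by move=> y /ltW /F1].
pose FC := isCumulative.Build R _ R F Fnd (right_continuousW Fcont).
pose FB := isCumulativeBounded.Build R 0 1 F FNy Fy.
pose G : cumulativeBounded (0 : R) 1 := HB.pack F FC FB.
have FM' x y : x <= y -> G y - G x <= M * (y - x) by move=> /FM/andP[].
apply: negligibleS (cumulative_derivable_ae FM' (F0 _ (lexx _))).
move=> x [/andP[ax xb] nd]; split; [exact: ax|move=> dF'; apply: nd].
have dF : derivable F x 1 := dF'.
have : derivable (((g b - g a) \*: F \+ cst (g a)) \- ((L + 1) \*: id)) x 1.
  apply: derivableB.
    by apply: derivableD; [exact: derivableZ|exact: derivable_cst].
  by apply: derivableZ; exact: derivable_id.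
apply: near_eq_derivable; near=> y.
have FE : F y = (g y - g a) / (g b - g a).
  rewrite /F (_ : c y = y)//.
  have ay : a < y by near: y; exact: lt_nbhsr.
  have yb : y < b by near: y; exact: lt_nbhsl.
  by rewrite /c /Num.max /Num.min; do ! case: ifPn; rewrite -?leNgt; move: ay yb; lra.
change ((g b - g a) * F y + g a - (L + 1) * y = f y).
by rewrite FE mulrC divfK ?gt_eqF// /g; lra.
Unshelve. all: by end_near. Qed.

End lipschitz_derivable.

Lemma lipschitz_open_gt (R : realType) n (phi : 'rV[R]_n -> R) (M a : R) :
  (forall x y, `|phi x - phi y| <= M * `|x - y|) -> open [set x | a < phi x].
Proof.
move=> phiM; rewrite openE => x /= ax; apply/nbhs_ballP.
have M0 : 0 < `|M| + 1 by rewrite ltr_wpDl.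
exists ((phi x - a) / (`|M| + 1)); first by rewrite /= divr_gt0// subr_gt0.
move=> y; rewrite ball_rowE/= ltr_pdivlMr// mulrC => yx.
have := phiM x y; rewrite distrC [`|x - y|]distrC => h.
have : `|phi y - phi x| < phi x - a.
  apply: le_lt_trans yx; apply: (le_trans h); rewrite ler_wpM2r//.
  by rewrite (le_trans (ler_norm _))// lerDl.
by rewrite ltr_norml; lra.
Qed.

Section rademacher.
Context {R : realType} {n : nat}.
Variables (f : 'rV[R]_n.+1 -> R) (L : R).
Hypothesis fL : forall x y, `|f x - f y| <= L * `|x - y|.
Local Notation e_ i := (delta_mx 0 i : 'rV[R]_n.+1).

Let L_ge0 : 0 <= L.
Proof.
have := fL (const_mx 1) 0; rewrite subr0 => h.
have c0 : 0 < `|const_mx 1 : 'rV[R]_n.+1|.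
  by rewrite normr_gt0; apply/eqP => /rowP/(_ 0); rewrite !mxE; apply/eqP; rewrite oner_eq0.
by rewrite -(pmulr_lge0 _ c0); exact: le_trans (normr_ge0 _) h.
Qed.

Let q i h x := h^-1 * (f (h *: e_ i + x) - f x).

Let q_lipschitz i h x y : `|q i h x - q i h y| <= `|h^-1| * (2 * L) * `|x - y|.
Proof.
rewrite /q -mulrBr normrM -mulrA ler_wpM2l//.
have := fL (h *: e_ i + x) (h *: e_ i + y); have := fL x y.
rewrite opprD addrACA subrr add0r !ler_norml; lra.
Qed.

(** The points where the difference quotients along [e_ i] are not Cauchy, written as a countable
    combination of open sets: measurability is what [null_slices] asks for. *)
Let nderiv i := \bigcup_k \bigcap_j [set x : 'rV[R]_n.+1 | exists h h', [/\
  0 < `|h| < j.+1%:R^-1, 0 < `|h'| < j.+1%:R^-1 & k.+1%:R^-1 < `|q i h x - q i h' x|]].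

Let nderiv_measurable i : measurable (nderiv i : set (leb_space R n.+1)).
Proof.
apply: bigcupT_measurable => k; apply: bigcapT_measurable => j.
apply: open_lebesgue_measurable.
rewrite (_ : mkset _ = \bigcup_(h in [set h : R * R | 0 < `|h.1| < j.+1%:R^-1 /\ 0 < `|h.2| < j.+1%:R^-1])
   [set x | k.+1%:R^-1 < `|q i h.1 x - q i h.2 x|]).
  apply: bigcup_open => h _.
  apply: (@lipschitz_open_gt _ _ _ (`|h.1^-1| * (2 * L) + `|h.2^-1| * (2 * L))) => x y.
  apply: le_trans (ler_dist_dist _ _) _.
  have -> : q i h.1 x - q i h.2 x - (q i h.1 y - q i h.2 y) =
    (q i h.1 x - q i h.1 y) - (q i h.2 x - q i h.2 y) by ring.
  by rewrite (le_trans (ler_normB _ _))// mulrDl lerD ?q_lipschitz.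
apply/seteqP; split => x; first by move=> [h [h' [h1 h2 h3]]]; exists (h, h').
by move=> [[h h'] [/= h1 h2] h3]; exists h, h'.
Qed.

Let derivableE i x : ~ nderiv i x -> derivable f x (e_ i).
Proof.
move=> nd; apply/cauchy_cvgP; apply/cauchy_ballP => e e0.
have [k ke] : exists k : nat, k.+1%:R^-1 < e.
  exists (Num.truncn e^-1); rewrite invf_plt ?posrE//.
  exact: truncnS_gt.
have [j hj] : exists j : nat, forall h h', 0 < `|h| < j.+1%:R^-1 ->
    0 < `|h'| < j.+1%:R^-1 -> `|q i h x - q i h' x| <= k.+1%:R^-1.
  apply: contrapT => H; apply: nd; exists k => // j _.
  apply: contrapT => H'; apply: H; exists j => h h' h1 h2.
  by rewrite leNgt; apply/negP => h3; apply: H'; exists h, h'.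
pose A := [set r | exists2 h, 0 < `|h| < j.+1%:R^-1 & q i h x = r].
have nA : \forall h \near (0 : R)^', A (q i h x).
  near=> h; exists h => //; apply/andP; split.
    by rewrite normr_gt0; near: h; exact: nbhs_dnbhs_neq.
  by near: h; apply: dnbhs0_lt; rewrite invr_gt0.
exists (A, A); first by split; exact: nA.
move=> [_ _] [/= [h h1 <-] [h' h2 <-]].
by rewrite /ball/= (le_lt_trans (hj _ _ h1 h2)).
Unshelve. all: by end_near. Qed.

Let nderivE i x : derivable f x (e_ i) -> ~ nderiv i x.
Proof.
move=> /cvg_ex[l /cvgrPdist_lt dl] [k _ H].
have k0 : 0 < k.+1%:R^-1 / 2 :> R by rewrite divr_gt0.
have := dl _ k0; rewrite /dnbhs/within/= => /nbhs_ballP[d /= d0 hd].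
have [j jd] : exists j : nat, j.+1%:R^-1 < d.
  exists (Num.truncn d^-1); rewrite invf_plt ?posrE//.
  exact: truncnS_gt.
have [h [h' [/andP[h0 hj] /andP[h'0 h'j]]]] := H j I.
apply/negP; rewrite -leNgt.
have hh : `|l - q i h x| < k.+1%:R^-1 / 2.
  by apply: hd; rewrite ?/ball/= ?sub0r ?normrN ?(lt_trans hj)// -normr_gt0.
have hh' : `|l - q i h' x| < k.+1%:R^-1 / 2.
  by apply: hd; rewrite ?/ball/= ?sub0r ?normrN ?(lt_trans h'j)// -normr_gt0.
rewrite -(subrKA l) (le_trans (ler_normD _ _))// distrC.
by rewrite [leRHS]splitr lerD// ltW.
Qed.

(** On each line in direction [i] the function is Lipschitz in one variable, so the bad set has
    negligible slices. *)
Lemma partial_derivable_ae i :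
  lebesgue_outer [set x | ~ derivable f x (e_ i)] = 0%E.
Proof.
rewrite (_ : [set _ | _] = nderiv i); last first.
  apply/seteqP; split => x /=; last by move=> + /nderivE.
  by move=> nd; apply: contrapT => /derivableE.
apply: (@null_slices _ _ i) => [|x]; first exact: nderiv_measurable.
have insD t s : ins i (s + t) x = s *: e_ i + ins i t x.
  apply/rowP => j; rewrite !mxE eqxx/=; case: unliftP => [k ->|->].
    by rewrite eq_sym (negPf (neq_lift _ _)) mulr0 add0r.
  by rewrite eqxx mulr1.
have L0 := L_ge0.
have : forall s t, `|f (ins i s x) - f (ins i t x)| <= L * `|s - t|.
  move=> s t; apply: (le_trans (fL _ _)); rewrite ler_wpM2l//.
  apply: norm_row_le => // j; rewrite !mxE.
  by case: unliftP => [k _|_] //; rewrite subrr normr0.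
move=> /lipschitz_derivable_ae; apply: negligibleS => t /= nd d.
move: nd => /=; move/nderivE; apply.
move: d; rewrite /derivable.
set g := (X in cvg (X @ _) -> _); set g' := (X in _ -> cvg (X @ _)).
suff -> : g = g' by [].
by apply/funext => h; rewrite /g /g' /= [h *: 1]mulr1 insD.
Qed.

(** The points at which [p] predicts every coordinate step shorter than [1/(m+1)] with relative
    error [1/(k+1)]. [Eset] keeps those where the joint prediction by [p] still fails. All three
    parameters range over countable sets. *)
Let Fset (k m : nat) (p : 'rV[rat]_n.+1) := [set x | forall i t,
  `|t| < m.+1%:R^-1 ->
  `|f (x + t *: e_ i) - f x - t * ratr (p 0 i)| <= k.+1%:R^-1 * `|t|].

(** Along a coordinate path there are [n.+1] steps. Each costs [2 L] for moving both its ends to a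
    nearby point of [Fset], plus 1 for the error of the step taken there. *)
Let C := n.+1%:R * (2 * L + 1).

Let Eset k m p := Fset k m p `&` [set x | forall d, 0 < d -> exists h,
  0 < `|h| < d /\ C * k.+1%:R^-1 * `|h| <
    `|f (x + h) - f x - \sum_i h 0 i * ratr (p 0 i)|].

Let Fset_measurable k m p : measurable (Fset k m p : set (leb_space R n.+1)).
Proof.
rewrite -[Fset _ _ _]setCK; apply: measurableC; apply: open_lebesgue_measurable.
rewrite (_ : ~` _ = \bigcup_(u in [set u : 'I_n.+1 * R | `|u.2| < m.+1%:R^-1])
  [set x | k.+1%:R^-1 * `|u.2| < `|f (x + u.2 *: e_ u.1) - f x - u.2 * ratr (p 0 u.1)|]).
  apply: bigcup_open => u _; apply: (@lipschitz_open_gt _ _ _ (2 * L)) => x y.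
  apply: le_trans (ler_dist_dist _ _) _.
  have -> : forall A B C A' B' : R, A - B - C - (A' - B' - C) = (A - A') - (B - B').
    by move=> *; ring.
  have := fL (x + u.2 *: e_ u.1) (y + u.2 *: e_ u.1); have := fL x y.
  by rewrite opprD addrACA subrr addr0 !ler_norml; lra.
apply/seteqP; split => x /=; last first.
  by move=> [[i t] /= it]; rewrite ltNge => /negP nF Fx; apply: nF; exact: Fx.
move=> nF; apply: contrapT => H; apply: nF => i t it; rewrite leNgt; apply/negP => F.
by apply: H; exists (i, t).
Qed.

(* If a point of [Fset] lay near each vertex of the coordinate path from [x] to
   [x + h], the increments along the path would add up to a small error. *)
Let Eset_null k m p : lebesgue_outer (Eset k m p) = 0%E.
Proof.
have L0 := L_ge0.
have k0 : 0 < k.+1%:R^-1 :> R by [].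
have k1 : k.+1%:R^-1 <= 1 :> R by rewrite invf_le1 ?ler1n.
apply: (@vitali_null _ _ _ (Fset k m p) ((k.+1%:R^-1 / 3) ^+ n.+1)).
- exact: Fset_measurable.
- exact: subIsetl.
- by rewrite exprn_gt0// divr_gt0.
move=> x [Fx Ex] d d0.
have [|h [/andP[h0 hd] hE]] := Ex (Num.min (d / 3) m.+1%:R^-1).
  by rewrite lt_min divr_gt0/=.
move: hd; rewrite lt_min => /andP[hd hm].
pose y (j : nat) := x + \row_(i < n.+1) (if (i < j)%N then h 0 i else 0).
have y0 : y 0%N = x by rewrite /y; apply/rowP => i; rewrite !mxE ltn0 addr0.
have yn : y n.+1 = x + h by rewrite /y; apply/rowP => i; rewrite !mxE ltn_ord.
have yS (j : 'I_n.+1) : y j.+1 = y j + h 0 j *: e_ j.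
  apply/rowP => i; rewrite !mxE eqxx/= -addrA; congr (_ + _).
  rewrite ltnS leq_eqVlt -val_eqE/=.
  have [/val_inj->|ij] := eqVneq (val i) (val j); first by rewrite ltnn mulr1 add0r.
  by rewrite mulr0 addr0.
have hole : exists j : 'I_n.+1, forall z, Fset k m p z -> k.+1%:R^-1 * `|h| <= `|z - y j|.
  apply: contrapT => H.
  have {}H (j : 'I_n.+1) : exists z, Fset k m p z /\ `|z - y j| < k.+1%:R^-1 * `|h|.
    apply: contrapT => H'; apply: H; exists j => z Fz.
    by rewrite leNgt; apply/negP => zy; apply: H'; exists z.
  move: hE; apply/negP; rewrite -leNgt.
  have -> : f (x + h) - f x = \sum_(j < n.+1) (f (y j.+1) - f (y j)).
    by rewrite -(big_mkord xpredT (fun j => f (y j.+1) - f (y j))) telescope_sumr// yn y0.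
  rewrite -sumrB (le_trans (ler_norm_sum _ _ _))//.
  apply: (@le_trans _ _ (\sum_(j < n.+1) ((2 * L + 1) * (k.+1%:R^-1 * `|h|)))); last first.
    by rewrite sumr_const card_ord /C -[leLHS]mulr_natl !mulrA.
  apply: ler_sum => j _; have [z [Fz zy]] := H j.
  have hj : `|h 0 j| <= `|h| := coord_le_norm h j.
  have A1 := Fz j (h 0 j) (le_lt_trans hj hm).
  have A2 := fL (y j) z; have A3 := fL (z + h 0 j *: e_ j) (y j.+1).
  rewrite yS opprD addrACA subrr addr0 in A3.
  have A4 : L * `|z - y j| <= L * (k.+1%:R^-1 * `|h|) by rewrite ler_wpM2l// ltW.
  have A5 : k.+1%:R^-1 * `|h 0 j| <= k.+1%:R^-1 * `|h| by rewrite ler_wpM2l// ltW.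
  have key (a b c a' r u v w : R) : `|a - c - r| <= v -> `|a' - c| <= u ->
      `|a - b| <= u -> u <= L * w -> v <= w -> `|b - a' - r| <= (2 * L + 1) * w.
    by rewrite !ler_norml; lra.
  rewrite yS; apply: key A1 _ A3 A4 A5.
  by rewrite [`|z - y j|]distrC.
(* The ball of radius [|h|/(k+1)] around the vertex [y j] misses [Fset] and lies in the ball of
   radius [3 |h|] around [x]; this gives the proportion [(1/(3(k+1)))^(n+1)], and the bound [d / 3]
   on [|h|] above. *)
have [j hj] := hole; exists (3 * `|h|); split.
  by apply/andP; split; [rewrite mulr_gt0|rewrite mulrC -ltr_pdivlMr].
apply: (@le_trans _ _ (lebesgue_outer (ball (y j) (k.+1%:R^-1 * `|h|)))).
  apply: le_trans (lebesgue_ball_ge _ _); last by rewrite mulr_gt0.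
  by rewrite lee_fin -exprMn mulrA divfK.
apply: le_lebesgue_outer => z; rewrite !ball_rowE/= => zy; split; last first.
  by move=> /hj; rewrite leNgt zy.
rewrite /= -(subrKA (y j)) (le_lt_trans (ler_normD _ _))//.
have yx : `|y j - x| <= `|h|.
  rewrite /y addrAC subrr add0r; apply: norm_row_le => // i; rewrite mxE.
  by case: ifP => _; [exact: coord_le_norm|rewrite normr0].
have key (a b c u : R) : a < b -> c <= u -> 0 < u -> b <= u -> a + c < 3 * u by lra.
by apply: key zy yx h0 _; rewrite ler_piMl.
Qed.

(** Total differentiability, with an error uniform in direction: sup-convolutions test all
    directions of [K] at once. *)
Definition differential_at (x : 'rV[R]_n.+1) := forall e, 0 < e -> exists2 d, 0 < d &
  forall h, `|h| < d -> `|f (x + h) - f x - dot (grad f x) h| <= e * `|h|.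

(** Where the partial derivatives exist, a rational [p] close to the gradient and a small enough
    scale put [x] in some [Fset k m p]; being outside [Eset k m p] then bounds the joint error. *)
Lemma rademacher : lebesgue_outer [set x | ~ differential_at x] = 0%E.
Proof.
pose N := \bigcup_(i : 'I_n.+1) [set x | ~ derivable f x (e_ i)].
pose E := \bigcup_(u : nat * nat * 'rV[rat]_n.+1) Eset u.1.1 u.1.2 u.2.
have bigcup0 (T : countType) (A : T -> set 'rV[R]_n.+1) :
    (forall t, lebesgue_outer (A t) = 0%E) -> lebesgue_outer (\bigcup_t A t) = 0%E.
  move=> A0; apply/eqP; rewrite eq_le lebesgue_outer_ge0 andbT.
  pose B k := if unpickle k is Some t then A t else set0.
  apply: (@le_trans _ _ (lebesgue_outer (\bigcup_k B k))).
    apply: le_lebesgue_outer => x [t _ Atx]; exists (pickle t) => //.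
    by rewrite /B pickleK.
  rewrite (le_trans (lebesgue_outer_sigma_subadditive _))// eseries0// => k _ _.
  by rewrite /B; case: unpickle => [t|]; [exact: A0|exact: lebesgue_outer0].
have N0 : lebesgue_outer N = 0%E by apply: bigcup0 => i; exact: partial_derivable_ae.
have E0 : lebesgue_outer E = 0%E by apply: bigcup0 => -[[k m] p]; exact: Eset_null.
suff sub : [set x | ~ differential_at x] `<=` N `|` E.
  apply/eqP; rewrite eq_le lebesgue_outer_ge0 andbT.
  apply: le_trans (le_lebesgue_outer sub) _.
  rewrite (le_trans (outer_measureU2 _ _ _))//=.
  by rewrite [X in (X + _)%E]N0 [X in (_ + X)%E]E0 adde0.
move=> x ndx; apply: contrapT => /not_orP[Nx Ex]; apply: ndx => e e0.
have dx i : derivable f x (e_ i) by apply: contrapT => dx; apply: Nx; exists i.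
(* The added [n.+1] pays for replacing [p] by the gradient. *)
pose C' := C + n.+1%:R.
have L0 := L_ge0.
have C'0 : 0 < C' by rewrite /C' ltr_wpDl// /C mulr_ge0// addr_ge0// mulr_ge0.
have [k ke] : exists k : nat, k.+1%:R^-1 < e / C'.
  exists (Num.truncn (e / C')^-1); rewrite invf_plt ?posrE ?divr_gt0//.
  exact: truncnS_gt.
have k0 : 0 < k.+1%:R^-1 / 2 :> R by rewrite divr_gt0.
have gE i : grad f x 0 i = 'D_(e_ i) f x by rewrite mxE.
have /choice[p0 hp] : forall i, exists q : rat, `|ratr q - grad f x 0 i| < k.+1%:R^-1 / 2.
  move=> i; have [|r] := @rat_in_itvoo R (grad f x 0 i - k.+1%:R^-1 / 2) (grad f x 0 i + k.+1%:R^-1 / 2).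
    by rewrite ltrBlDr -addrA ltrDl addr_gt0.
  by rewrite in_itv/= => hr; exists r; rewrite ltr_norml; move: hr;
    move: (k.+1%:R^-1) => kk; lra.
pose p : 'rV[rat]_n.+1 := \row_i p0 i.
have /choice[d0 hd] : forall i, exists d : R, 0 < d /\ forall t, `|t| < d ->
    `|f (x + t *: e_ i) - f x - t * grad f x 0 i| <= k.+1%:R^-1 / 2 * `|t|.
  move=> i; have /cvgrPdist_lt /(_ _ k0) := dx i.
  rewrite /dnbhs/within/= => /nbhs_ballP[d /= dd0 dd]; exists d; split => // t td.
  have [->|t0] := eqVneq t 0; first by rewrite scale0r addr0 subrr mul0r subr0 normr0 mulr0.
  have := dd t; rewrite /ball/= sub0r normrN => /(_ td t0) /ltW.
  rewrite -/('D_(e_ i) f x) -gE => h.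
  have -> : f (x + t *: e_ i) - f x - t * grad f x 0 i =
      - (t * (grad f x 0 i - t^-1 *: (f (t *: e_ i + x) - f x))).
    have -> : t * (grad f x 0 i - t^-1 *: (f (t *: e_ i + x) - f x)) =
        t * grad f x 0 i - (f (t *: e_ i + x) - f x).
      by rewrite mulrBr; congr (_ - _); exact: mulVKf.
    by rewrite [t *: _ + _]addrC; ring.
  by rewrite normrN normrM mulrC ler_wpM2r.
have [m md] : exists m : nat, forall i, m.+1%:R^-1 < d0 i.
  exists (Num.truncn (\sum_i (d0 i)^-1)) => i.
  rewrite invf_plt ?posrE; [|by []|exact: (hd i).1].
  apply: le_lt_trans (truncnS_gt _); rewrite (bigD1 i)//= lerDl sumr_ge0// => j _.
  by rewrite invr_ge0 ltW// (hd j).1.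
have Fx : Fset k m p x.
  move=> i t tm; have := (hd i).2 t (lt_trans tm (md i)).
  have := hp i; rewrite [p 0 i]mxE; move: (grad f x 0 i) => G hpi A.
  have A' : `|t * G - t * ratr (p0 i)| <= k.+1%:R^-1 / 2 * `|t|.
    by rewrite -mulrBr normrM mulrC ler_wpM2r// distrC ltW.
  have -> : f (x + t *: e_ i) - f x - t * ratr (p0 i) =
    (f (x + t *: e_ i) - f x - t * G) + (t * G - t * ratr (p0 i)) by ring.
  by rewrite (le_trans (ler_normD _ _))//; move: A A'; move: (k.+1%:R^-1) => kk; lra.
have [d dd0 hd'] : exists2 d, 0 < d & forall h, `|h| < d ->
   `|f (x + h) - f x - \sum_i h 0 i * ratr (p 0 i)| <= C * k.+1%:R^-1 * `|h|.
  apply: contrapT => H; apply: Ex; exists ((k, m), p) => //; split => //= d dd0.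
  apply: contrapT => H'; apply: H; exists d => // h hh.
  have [->|h0] := eqVneq h 0.
    rewrite addr0 subrr normr0 mulr0 big1 ?subr0 ?normr0//.
    by move=> i _; rewrite mxE mul0r.
  rewrite leNgt; apply/negP => h1; apply: H'; exists h; split => //.
  by rewrite normr_gt0 h0.
exists d => // h /hd' A.
have B : `|\sum_i h 0 i * ratr (p 0 i) - dot (grad f x) h| <= n.+1%:R * k.+1%:R^-1 * `|h|.
  rewrite /dot -sumrB (le_trans (ler_norm_sum _ _ _))//.
  apply: (@le_trans _ _ (\sum_(i < n.+1) (k.+1%:R^-1 * `|h|))); last first.
    by rewrite sumr_const card_ord -[leLHS]mulr_natl mulrA.
  apply: ler_sum => i _; rewrite [grad f x 0 i * _]mulrC -mulrBr normrM mulrC.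
  apply: ler_pM => //; last exact: coord_le_norm.
  by rewrite [p 0 i]mxE (le_trans (ltW (hp i)))// ler_pdivrMr// ler_peMr// ler1n.
have -> : f (x + h) - f x - dot (grad f x) h =
  (f (x + h) - f x - \sum_i h 0 i * ratr (p 0 i)) + (\sum_i h 0 i * ratr (p 0 i) - dot (grad f x) h) by ring.
rewrite (le_trans (ler_normD _ _))//.
apply: (@le_trans _ _ (C' * k.+1%:R^-1 * `|h|)).
  by rewrite /C' mulrDl mulrDl lerD.
by rewrite ler_wpM2r// mulrC -ler_pdivlMr// ltW.
Qed.

End rademacher.

(** * Rearrangements and superlevel sets *)

Section ae_inclusion.
Context {R : realType} {n : nat}.
Implicit Types A B C : set 'rV[R]_n.

(** Phrased with the outer measure, so that transitivity and countable unions need no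
    measurability. *)
Definition ae_sub A B := lebesgue_outer (A `\` B) = 0%E.

Lemma lebesgue_outer_null_sub A B : A `<=` B -> lebesgue_outer B = 0%E ->
  lebesgue_outer A = 0%E.
Proof.
move=> AB B0; apply/eqP; rewrite eq_le lebesgue_outer_ge0 andbT -B0.
exact: le_lebesgue_outer.
Qed.

Lemma lebesgue_outer_bigcup0 (T : countType) (A : T -> set 'rV[R]_n) :
  (forall t, lebesgue_outer (A t) = 0%E) -> lebesgue_outer (\bigcup_t A t) = 0%E.
Proof.
move=> A0; pose B k := if unpickle k is Some t then A t else set0.
apply: (@lebesgue_outer_null_sub _ (\bigcup_k B k)).
  by move=> x [t _ Atx]; exists (pickle t) => //; rewrite /B pickleK.
apply/eqP; rewrite eq_le lebesgue_outer_ge0 andbT.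
rewrite (le_trans (lebesgue_outer_sigma_subadditive _))// eseries0// => k _ _.
by rewrite /B; case: unpickle => [t|]; [exact: A0|exact: lebesgue_outer0].
Qed.

Lemma lebesgue_outerU0 A B : lebesgue_outer A = 0%E -> lebesgue_outer B = 0%E ->
  lebesgue_outer (A `|` B) = 0%E.
Proof.
move=> A0 B0; apply: (@lebesgue_outer_null_sub _ (\bigcup_(b : bool) if b then A else B)).
  by move=> x [Ax|Bx]; [exists true|exists false].
by apply: lebesgue_outer_bigcup0 => -[].
Qed.

Lemma sub_ae A B : A `<=` B -> ae_sub A B.
Proof.
move=> AB; rewrite /ae_sub (_ : _ `\` _ = set0) ?lebesgue_outer0//.
by apply/seteqP; split => // x [/AB].
Qed.

Lemma ae_sub_trans B A C : ae_sub A B -> ae_sub B C -> ae_sub A C.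
Proof.
move=> AB BC; apply: lebesgue_outer_null_sub (lebesgue_outerU0 AB BC).
by move=> x [Ax nCx]; have [Bx|nBx] := pselect (B x); [right|left].
Qed.

Lemma ae_sub_bigcup (T : countType) (A : T -> set 'rV[R]_n) B :
  (forall t, ae_sub (A t) B) -> ae_sub (\bigcup_t A t) B.
Proof.
move=> AB; apply: lebesgue_outer_null_sub (lebesgue_outer_bigcup0 AB).
by move=> x [[t _ Ax] Bx]; exists t.
Qed.

Lemma ae_sub_bigcup2 (T : countType) (A B : T -> set 'rV[R]_n) :
  (forall t, ae_sub (A t) (B t)) -> ae_sub (\bigcup_t A t) (\bigcup_t B t).
Proof.
move=> AB; apply: ae_sub_bigcup => t; apply: (ae_sub_trans (AB t)).
by apply: sub_ae => x Bx; exists t.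
Qed.

Lemma ae_subI A B C : ae_sub A B -> ae_sub A C -> ae_sub A (B `&` C).
Proof.
move=> AB AC'; apply: lebesgue_outer_null_sub (lebesgue_outerU0 AB AC').
by move=> x [Ax /not_andP[|]]; [left|right].
Qed.

Lemma le_lebesgue_ae A B : ae_sub A B -> (lebesgue_outer A <= lebesgue_outer B)%E.
Proof.
move=> AB; apply: (@le_trans _ _ (lebesgue_outer (B `|` (A `\` B)))).
  apply: le_lebesgue_outer => x Ax.
  by have [Bx|Bx] := pselect (B x); [left|right].
apply: (le_trans (outer_measureU2 _ _ _)).
by rewrite /= [X in (_ + X)%E](AB : lebesgue_outer _ = _) adde0.
Qed.

(** An essential inclusion that loses no measure is an essential equality. The finiteness required
    here is what restricts later arguments to tame levels. *)
Lemma ae_sub_measure A B : measurable (A : set (leb_space R n)) ->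
  measurable (B : set (leb_space R n)) -> ae_sub A B ->
  (lebesgue_outer B <= lebesgue_outer A)%E -> (lebesgue_outer A < +oo)%E ->
  ae_sub B A.
Proof.
move=> mA mB AB; rewrite (lebesgue_split A mB) [X in (_ + X)%E]AB adde0.
rewrite (lebesgue_split B mA) [B `&` A]setIC => h fin.
apply/eqP; rewrite eq_le lebesgue_outer_ge0 andbT.
rewrite -(leeD2lE (x := lebesgue_outer (A `&` B))) ?adde0//.
by rewrite ge0_fin_numE// lebesgue_outer_ge0.
Qed.

Lemma ae_lebesgueP (P : 'rV[R]_n -> Prop) :
  {ae lebesgue R n, forall x, P x} <-> lebesgue_outer [set x | ~ P x] = 0%E.
Proof. exact: lebesgue_negligibleP. Qed.

End ae_inclusion.

Section minkowski.
Context {R : realType} {n : nat}.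
Implicit Types A B : set 'rV[R]_n.

Lemma minkowski_sum_open A B : open A -> open (minkowski_sum A B).
Proof.
move=> oA; rewrite openE => _ [x Ax [y By <-]].
have /nbhs_ballP[e /= e0 xeA] : nbhs x A by rewrite nbhsE; exists A.
apply/nbhs_ballP; exists e => //= z; rewrite ball_rowE/= => zxy.
exists (z - y); last by exists y => //; rewrite subrK.
by apply: xeA; rewrite ball_rowE/= -addrA -opprD [y + x]addrC.
Qed.

Lemma minkowski_sumS A A' B : A `<=` A' -> minkowski_sum A B `<=` minkowski_sum A' B.
Proof. by move=> AA' _ [x Ax [y By <-]]; exists x; [exact: AA'|exists y]. Qed.

End minkowski.

Section rearrangement_theory.
Context {R : realType} {n : nat}.
Variables (v : bool) (X : set ('rV[R]_n -> R)).
Hypothesis hX : X = if v then @class_V R n else @class_S R n.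
Variable T : ('rV[R]_n -> R) -> ('rV[R]_n -> R).
Hypothesis hT : rearrangement X T.
Implicit Types (f g : 'rV[R]_n -> R) (A B C : set 'rV[R]_n) (a b s t : R).
Local Notation mu := (@lebesgue_outer R n).
Local Notation lset f t := [set x | t < f x].

(* The levels above which [class_V] and [class_S] put no mass at infinity. *)
Definition tame_level f t := (v -> 0 <= t) /\ (mu (lset f t) < +oo)%E.

(** The lower values allowed for a two-valued function: any in [class_S], only 0 in [class_V]. *)
Let base a := v -> a = 0.

Lemma class_measurable f : X f ->
  measurable_fun [set: leb_space R n] (f : leb_space R n -> R).
Proof. by rewrite hX; case: ifP => _ []. Qed.

Lemma lset_measurable f t : X f -> measurable (lset f t : set (leb_space R n)).
Proof.
move=> /class_measurable mf; rewrite (_ : mkset _ = setT `&` f @^-1` `]t, +oo[%classic).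
  by apply: mf => //; exact: measurable_itv.
by rewrite setTI; apply/seteqP; split => x; rewrite /preimage/= in_itv/= andbT.
Qed.

Lemma T_class f : X f -> X (T f). Proof. by case: hT => h _ _; exact: h. Qed.

Lemma T_lset f t : X f -> mu (lset (T f) t) = mu (lset f t).
Proof. by case: hT => _ h _ /(h _ t). Qed.

Lemma T_mono f g t : X f -> X g -> (forall x, f x <= g x) ->
  ae_sub (lset (T f) t) (lset (T g) t).
Proof.
move=> Xf Xg fg; have [_ _ /(_ f g Xf Xg)] := hT.
have fg' : {ae lebesgue R n, forall x, f x <= g x}.
  by apply/ae_lebesgueP; rewrite (_ : mkset _ = set0) ?lebesgue_outer0//;
    apply/seteqP; split => // x /=; rewrite fg.
move=> /(_ fg') /ae_lebesgueP; apply: lebesgue_outer_null_sub => x [/= tf tg].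
by move=> le; apply: tg; exact: lt_le_trans le.
Qed.

Lemma T_tame f t : X f -> tame_level (T f) t <-> tame_level f t.
Proof. by move=> Xf; rewrite /tame_level T_lset. Qed.

(** A level that is not tame lies at or below the essential infimum in [class_S], and at or below 0
    in [class_V]. *)
Lemma not_tame_ge f t : X f -> ~ tame_level f t ->
  lebesgue_outer [set x | f x < t] = 0%E.
Proof.
rewrite /tame_level hX; case: (v) => [[mf f0 fin]|[mf fin]] nt.
  rewrite (_ : mkset _ = set0) ?lebesgue_outer0//.
  apply/seteqP; split => // x /= fxt; apply: nt.
  have t0 : 0 < t by exact: le_lt_trans (f0 x) fxt.
  by split => [_|]; [exact: ltW|exact: fin].
have : (t%:E <= ess_inf (lebesgue R n) (fun x => (f x)%:E))%E.
  by rewrite leNgt; apply/negP => /fin ft; apply: nt.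
move=> /ess_infP/ae_lebesgueP; apply: lebesgue_outer_null_sub => x /= fx.
by rewrite lee_fin leNgt fx.
Qed.

Definition two_level a b A : 'rV[R]_n -> R := fun x => a + (b - a) * \1_A x.

Lemma two_level_in a b A x : A x -> two_level a b A x = b.
Proof. by move=> Ax; rewrite /two_level indicE mem_set// mulr1 addrC subrK. Qed.

Lemma two_level_out a b A x : ~ A x -> two_level a b A x = a.
Proof. by move=> Ax; rewrite /two_level indicE memNset// mulr0 addr0. Qed.

Lemma two_level_lset a b A t : a <= t -> t < b -> lset (two_level a b A) t = A.
Proof.
move=> at_ tb; apply/seteqP; split => x /=.
  apply: contraPP => Ax; rewrite two_level_out// => h.
  by move: (lt_le_trans h at_); rewrite ltxx.
by move=> Ax; rewrite two_level_in.
Qed.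

Lemma two_level_class a b A : base a -> a <= b ->
  measurable (A : set (leb_space R n)) -> (mu A < +oo)%E -> X (two_level a b A).
Proof.
move=> ba ab mA fA.
have mf : measurable_fun [set: leb_space R n] (two_level a b A : leb_space R n -> R).
  apply: measurable_funD; first exact: measurable_cst.
  by apply: measurable_funM; [exact: measurable_cst|exact: measurable_indic].
have fin t : a <= t -> (mu (lset (two_level a b A) t) < +oo)%E.
  move=> at_; apply: le_lt_trans fA; apply: le_lebesgue_outer => x /=.
  apply: contraPP => Ax; rewrite two_level_out// => h.
  by move: (lt_le_trans h at_); rewrite ltxx.
have ge x : a <= two_level a b A x.
  by have [Ax|Ax] := pselect (A x); [rewrite two_level_in|rewrite two_level_out].
rewrite hX; move: ba; rewrite /base; case: (v) => ba.
  split => // [x|t t0]; first by rewrite -(ba _).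
  by apply: fin; rewrite ba// ltW.
split => // t ht; apply: fin; rewrite -lee_fin; apply: le_trans (ltW ht).
apply/ess_infP; apply/ae_lebesgueP.
rewrite (_ : mkset _ = set0) ?lebesgue_outer0//.
by apply/seteqP; split => // x /=; rewrite lee_fin ge.
Qed.

Section two_level_image.
Variable A : set 'rV[R]_n.
Hypothesis mA : measurable (A : set (leb_space R n)).
Hypothesis fA : (mu A < +oo)%E.

Let D a b := lset (T (two_level a b A)) a.

Let muD a b : base a -> a < b -> mu (D a b) = mu A.
Proof.
move=> ba ab; rewrite T_lset; last by apply: two_level_class => //; exact: ltW.
by rewrite two_level_lset.
Qed.

Let mD a b : base a -> a < b -> measurable (D a b : set (leb_space R n)).
Proof.
by move=> ba ab; apply: lset_measurable; apply: T_class; apply: two_level_class => //; exact: ltW.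
Qed.

(** All superlevel sets at levels in [[a, b[] are nested and have the measure of [A], so they
    coincide up to null sets. *)
Lemma two_level_image_cut a b t : base a -> a <= t -> t < b ->
  ae_sub (D a b) (lset (T (two_level a b A)) t).
Proof.
move=> ba at_ tb; have ab := le_lt_trans at_ tb.
have Xt := two_level_class ba (ltW ab) mA fA.
have tA : mu (lset (T (two_level a b A)) t) = mu A by rewrite T_lset// two_level_lset.
apply: ae_sub_measure; rewrite ?muD ?tA//.
- by apply: lset_measurable; exact: T_class.
- exact: mD.
- by apply: sub_ae => x; exact: le_lt_trans.
Qed.

Let D_shift a b a' b' : base a -> base a' -> a <= a' -> a' < b -> b <= b' ->
  ae_sub (D a b) (D a' b') /\ ae_sub (D a' b') (D a b).
Proof.
move=> ba ba' aa' a'b bb'.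
have ab := le_lt_trans aa' a'b; have a'b' := lt_le_trans a'b bb'.
suff DD' : ae_sub (D a b) (D a' b').
  by split => //; apply: (ae_sub_measure (mD ba ab) (mD ba' a'b')) => //; rewrite !muD.
apply: (ae_sub_trans (two_level_image_cut ba aa' a'b)).
apply: T_mono; [exact: two_level_class (ltW _) _ _|exact: two_level_class (ltW _) _ _|].
move=> x; have [Ax|Ax] := pselect (A x); first by rewrite !two_level_in.
by rewrite !two_level_out.
Qed.

(** [diamond T] sees only indicator functions; independence of the two values lets it describe
    superlevel sets at any height. The pairs are linked by the chain [(a, b)], [(a, M)], [(m, M)],
    [(a', M)], [(a', b')], in which neighbours overlap. *)
Lemma two_level_image a b a' b' : base a -> base a' -> a < b -> a' < b' ->
  ae_sub (D a b) (D a' b').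
Proof.
move=> ba ba' ab a'b'; pose M := Num.max b b'; pose m := Num.min a a'.
have bm : base m by move=> hv; rewrite /m (ba hv) (ba' hv) minxx.
have aM : a < M by rewrite lt_max ab.
have a'M : a' < M by rewrite lt_max a'b' orbT.
have bM : b <= M by rewrite le_max lexx.
have b'M : b' <= M by rewrite le_max lexx orbT.
have ma : m <= a by rewrite ge_min lexx.
have ma' : m <= a' by rewrite ge_min lexx orbT.
have [D1 _] := D_shift ba ba (lexx a) ab bM.
have [_ D2] := D_shift bm ba ma aM (lexx M).
have [D3 _] := D_shift bm ba' ma' a'M (lexx M).
have [_ D4] := D_shift ba' ba' (lexx a') a'b' b'M.
exact: ae_sub_trans D1 (ae_sub_trans D2 (ae_sub_trans D3 D4)).
Qed.

Let base0 : base 0. Proof. by []. Qed.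

Let indic_two_level : \1_A = two_level 0 1 A.
Proof. by apply/funext => x; rewrite /two_level subr0 mul1r add0r. Qed.

Lemma diamond_measurable : measurable (diamond T A : set (leb_space R n)).
Proof.
rewrite (_ : diamond T A = setT `&` (T \1_A) @^-1` [set 1]); last by rewrite setTI.
apply: class_measurable => //; rewrite indic_two_level; apply: T_class.
exact: two_level_class.
Qed.

(** [T \1_A] exceeds 1 only on a null set, and by [two_level_image_cut] nearly every point with a
    positive value is above each [1 - 1/(k+1)]; so the value there is 1. *)
Let D_sub_diamond : ae_sub (D 0 1) (diamond T A).
Proof.
pose N := lset (T \1_A) 1 `|` \bigcup_k (D 0 1 `\` lset (T \1_A) (1 - k.+1%:R^-1)).
apply: (@lebesgue_outer_null_sub _ _ _ N) => [x [x0 x1]|].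
  have [h|h|h] := ltgtP (T \1_A x) 1; [right|by left|by case: x1].
  exists (Num.truncn (1 - T \1_A x)^-1) => //; split => //=.
  apply/negP; rewrite -leNgt lerBrDr -lerBrDl invf_ple ?posrE ?subr_gt0//.
  by rewrite ltW// truncnS_gt.
apply: lebesgue_outerU0; last first.
  apply: lebesgue_outer_bigcup0 => k; rewrite indic_two_level.
  apply: two_level_image_cut; [exact: base0| |].
    by rewrite subr_ge0 invf_le1 ?ler1n.
  by rewrite ltrBlDr ltrDl.
rewrite indic_two_level T_lset; last exact: two_level_class.
rewrite (_ : mkset _ = set0) ?lebesgue_outer0//; apply/seteqP; split => // x /=.
by have [Ax|Ax] := pselect (A x); [rewrite two_level_in// ltxx|rewrite two_level_out// ltr10].
Qed.

Let diamond_sub_D : ae_sub (diamond T A) (D 0 1).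
Proof. by apply: sub_ae => x /= ; rewrite /D/= -indic_two_level => ->. Qed.

Lemma diamond_two_level a b : base a -> a < b ->
  ae_sub (diamond T A) (D a b) /\ ae_sub (D a b) (diamond T A).
Proof.
move=> ba ab; split.
  by apply: (ae_sub_trans diamond_sub_D); exact: two_level_image.
by apply: ae_sub_trans D_sub_diamond; exact: two_level_image.
Qed.

Lemma diamond_measure : mu (diamond T A) = mu A.
Proof.
rewrite -(muD base0 ltr01); apply/eqP.
rewrite eq_le; apply/andP; split; apply: le_lebesgue_ae; first exact: diamond_sub_D.
exact: D_sub_diamond.
Qed.

End two_level_image.

Lemma diamond_mono A B : measurable (A : set (leb_space R n)) ->
  measurable (B : set (leb_space R n)) -> (mu B < +oo)%E -> A `<=` B ->
  ae_sub (diamond T A) (diamond T B).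
Proof.
move=> mA mB fB AB.
have fA : (mu A < +oo)%E by apply: le_lt_trans fB; exact: le_lebesgue_outer.
have b0 : base 0 by [].
have [A0 _] := diamond_two_level mA fA b0 ltr01.
have [_ B0] := diamond_two_level mB fB b0 ltr01.
apply: ae_sub_trans A0 (ae_sub_trans _ B0).
apply: T_mono; [exact: two_level_class|exact: two_level_class|].
move=> x; have [Ax|Ax] := pselect (A x); first by rewrite !two_level_in//; exact: AB.
by rewrite two_level_out//; have [Bx|Bx] := pselect (B x); [rewrite two_level_in|rewrite two_level_out].
Qed.

(** The image of [C] intersected with [B] lies essentially in both images, so the images overlap at
    least as much as the sets do, while measures are preserved. *)
Lemma diamondD_le B C : measurable (B : set (leb_space R n)) ->
  measurable (C : set (leb_space R n)) -> (mu B < +oo)%E -> (mu C < +oo)%E ->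
  (mu (diamond T C `\` diamond T B) <= mu (C `\` B))%E.
Proof.
move=> mB mC fB fC; have mCB := measurableI _ _ mC mB.
have fCB : (mu (C `&` B) < +oo)%E.
  by apply: le_lt_trans fC; apply: le_lebesgue_outer; exact: subIsetl.
have h : (mu (C `&` B) <= mu (diamond T C `&` diamond T B))%E.
  rewrite -diamond_measure//; apply: le_lebesgue_ae; apply: ae_subI.
    by apply: diamond_mono => //; exact: subIsetl.
  by apply: diamond_mono => //; exact: subIsetr.
have := diamond_measure mC fC.
rewrite (lebesgue_split (diamond T C) (diamond_measurable mB fB)).
rewrite [in X in _ = X -> _](lebesgue_split C mB) => E.
rewrite -(leeD2lE (x := mu (C `&` B))); last first.
  by rewrite ge0_fin_numE// lebesgue_outer_ge0.
by rewrite -E leeD2r.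
Qed.

(** In [class_V] the two-valued function with base 0 lies below [f]. In [class_S], where [f] need
    not be bounded below, it is compared with the maximum of [f] and [s], which has the same
    superlevel set at [s]; equality of measures transfers this to [T f]. *)
Lemma tame_two_level f s t : X f -> tame_level f s -> s < t ->
  exists a, [/\ base a, a <= s & ae_sub (lset (T (two_level a t (lset f t))) s) (lset (T f) s)].
Proof.
move=> Xf [vs fs] st.
have mt : measurable (lset f t : set (leb_space R n)) by exact: lset_measurable.
have ft : (mu (lset f t) < +oo)%E.
  by apply: le_lt_trans fs; apply: le_lebesgue_outer => x; exact: lt_trans.
case: (boolP v) => [hv|/negP nv].
  exists 0; split; [by []|exact: vs|].
  apply: T_mono => //; first by apply: two_level_class => //; rewrite (le_trans (vs hv)) ?ltW.
  move=> x; have [tx|tx] := pselect (lset f t x); first by rewrite two_level_in// ltW.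
  rewrite two_level_out//.
  by move: Xf; rewrite hX hv => -[_ f0 _].
have bs : base s by move=> /nv.
exists s; split => //.
have Xm : X (fun x => Num.max (f x) s).
  move: Xf; rewrite hX (negbTE (introN idP nv)) => -[mf ff]; split.
    by apply: measurable_maxr => //; exact: measurable_cst.
  move=> r hr; have sr : s <= r.
    rewrite -lee_fin; apply: le_trans (ltW hr); apply/ess_infP/ae_lebesgueP.
    rewrite (_ : mkset _ = set0) ?lebesgue_outer0//.
    by apply/seteqP; split => // x /=; rewrite lee_fin le_max lexx orbT.
  apply: le_lt_trans fs; apply: le_lebesgue_outer => x /=.
  rewrite /level_set/= lt_max => /orP[|h]; first exact: le_lt_trans.
  by move: (lt_le_trans h sr); rewrite ltxx.
apply: (@ae_sub_trans _ _ (lset (T (fun x => Num.max (f x) s)) s)).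
  apply: T_mono => //; first by apply: two_level_class => //; exact: ltW.
  move=> x; have [tx|tx] := pselect (lset f t x).
    by rewrite two_level_in// le_max ltW.
  by rewrite two_level_out// le_max lexx orbT.
have E : lset (fun x => Num.max (f x) s) s = lset f s.
  by apply/seteqP; split => x /=; rewrite lt_max ltxx orbF.
apply: ae_sub_measure; rewrite ?T_lset ?E//.
- by apply: lset_measurable; exact: T_class.
- by apply: lset_measurable; exact: T_class.
- by apply: T_mono => // x; rewrite le_max lexx.
Qed.

Lemma lebesgue_bigcup_le (A : nat -> set 'rV[R]_n) (c : \bar R) :
  (forall k, measurable (A k : set (leb_space R n))) -> {homo A : i j / (i <= j)%N >-> i `<=` j} ->
  (forall k, mu (A k) <= c)%E -> (mu (\bigcup_k A k) <= c)%E.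
Proof.
move=> mA ndA Ac.
have : (lebesgue R n \o A) k @[k --> \oo] --> lebesgue R n (\bigcup_k A k).
  apply: nondecreasing_cvg_mu => //; first exact: bigcupT_measurable.
  by move=> i j ij; apply/subsetPset; exact: ndA.
move=> h; rewrite -[leLHS](cvg_lim _ h)//; apply: lime_le; first by apply/cvg_ex; eexists; exact: h.
by apply: nearW => k; exact: Ac.
Qed.

(** A two-valued minorant reaching above [s] needs a top value larger than [s]. Hence the sets
    [{f > s + 1/(k+1)}], whose images lie in [{T f > s}] and exhaust it in measure. *)
Lemma diamond_lset f s : X f -> tame_level f s ->
  ae_sub (diamond T (lset f s)) (lset (T f) s) /\ ae_sub (lset (T f) s) (diamond T (lset f s)).
Proof.
move=> Xf hs; have [vs fs] := hs.
have ms : measurable (lset f s : set (leb_space R n)) by exact: lset_measurable.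
pose A k := lset f (s + k.+1%:R^-1).
have mA k : measurable (A k : set (leb_space R n)) by exact: lset_measurable.
have As k : A k `<=` lset f s by move=> x; apply: lt_trans; rewrite ltrDl.
have fA k : (mu (A k) < +oo)%E by apply: le_lt_trans fs; exact: le_lebesgue_outer.
have sub k : ae_sub (diamond T (A k)) (lset (T f) s).
  have sk : s < s + k.+1%:R^-1 by rewrite ltrDl.
  have [a [ba as_ h]] := tame_two_level Xf hs sk.
  apply: ae_sub_trans h; have [h _] := diamond_two_level (mA k) (fA k) ba (le_lt_trans as_ sk).
  by apply: (ae_sub_trans h); exact: two_level_image_cut.
pose U := \bigcup_k diamond T (A k).
have mU : measurable (U : set (leb_space R n)).
  by apply: bigcupT_measurable => k; exact: diamond_measurable.
have US : ae_sub U (lset (T f) s) by exact: ae_sub_bigcup.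
have mTs : measurable (lset (T f) s : set (leb_space R n)).
  by apply: lset_measurable; exact: T_class.
have sU : (mu (lset f s) <= mu U)%E.
  have -> : lset f s = \bigcup_k A k.
    apply/seteqP; split => x; last by move=> [k _ /As].
    move=> /= sf; exists (Num.truncn (f x - s)^-1) => //=.
    rewrite /A/= addrC -ltrBrDr invf_plt ?posrE ?subr_gt0//.
    exact: truncnS_gt.
  apply: lebesgue_bigcup_le => // [i j ij x|k].
    by apply: le_lt_trans; rewrite lerD2l lef_pV2 ?posrE// ler_nat.
  rewrite -diamond_measure//; apply: le_lebesgue_outer => x h; by exists k.
have SU : ae_sub (lset (T f) s) U.
  apply: ae_sub_measure => //; first by rewrite T_lset.
  by apply: le_lt_trans fs; rewrite -(T_lset s Xf); exact: le_lebesgue_ae.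
have Sd : ae_sub (lset (T f) s) (diamond T (lset f s)).
  by apply: (ae_sub_trans SU); apply: ae_sub_bigcup => k; exact: diamond_mono.
split => //; apply: ae_sub_measure => //.
- exact: diamond_measurable.
- by rewrite diamond_measure// T_lset.
- by rewrite T_lset.
Qed.

End rearrangement_theory.

(** * Smoothing rearrangements of Lipschitz functions *)

Section lipschitz_extension.
Context {R : realType} {n : nat}.

(** McShane's formula: the supremum over [z] in [G] of [phi z - L |x - z|]. *)
Lemma lipschitz_extension (G : set 'rV[R]_n) (phi : 'rV[R]_n -> R) (L : R) :
  0 <= L -> G !=set0 ->
  (forall x y, G x -> G y -> phi x - phi y <= L * `|x - y|) ->
  exists g : 'rV[R]_n -> R, (forall x y, `|g x - g y| <= L * `|x - y|) /\
    (forall x, G x -> g x = phi x).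
Proof.
move=> L0 [z0 Gz0] phiL.
pose S x := [set phi z - L * `|x - z| | z in G].
have hS x : has_sup (S x).
  split; first by exists (phi z0 - L * `|x - z0|); exists z0.
  exists (phi z0 + L * `|x - z0|) => _ [z Gz <-].
  have := phiL _ _ Gz Gz0.
  have : L * `|z - z0| <= L * (`|x - z| + `|x - z0|).
    by rewrite ler_wpM2l// -[z - z0](subrKA x) (le_trans (ler_normD _ _))// [`|z - x|]distrC.
  by rewrite mulrDr; lra.
exists (fun x => sup (S x)); split.
  suff H x y : sup (S x) - sup (S y) <= L * `|x - y|.
    move=> x y; rewrite ler_norml H andbT lerNl opprB.
    by rewrite distrC; exact: H.
  rewrite lerBlDr; apply: ge_sup; first by have [] := hS x.
  move=> _ [z Gz <-].
  have h1 : phi z - L * `|y - z| <= sup (S y).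
    by apply: ub_le_sup; [have [] := hS y|exists z].
  have : L * `|y - z| <= L * (`|x - y| + `|x - z|).
    by rewrite ler_wpM2l// -[y - z](subrKA x) (le_trans (ler_normD _ _))// [`|y - x|]distrC.
  by rewrite mulrDr; move: h1; lra.
move=> x Gx; apply/eqP; rewrite eq_le; apply/andP; split; last first.
  apply: ub_le_sup; first by have [] := hS x.
  by exists x => //; rewrite subrr normr0 mulr0 subr0.
apply: ge_sup; first by have [] := hS x.
by move=> _ [z Gz <-]; have := phiL _ _ Gz Gx; rewrite [`|z - x|]distrC; lra.
Qed.

End lipschitz_extension.

Section smoothing_theory.
Context {R : realType} {n : nat}.
Variables (v : bool) (X : set ('rV[R]_n.+1 -> R)).
Hypothesis hX : X = if v then @class_V R n.+1 else @class_S R n.+1.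
Variable T : ('rV[R]_n.+1 -> R) -> ('rV[R]_n.+1 -> R).
Hypothesis hT : rearrangement X T.
Variable K : set 'rV[R]_n.+1.
Hypothesis hTK : smoothing K T.
Implicit Types (f g : 'rV[R]_n.+1 -> R) (A B C U : set 'rV[R]_n.+1) (d s t : R).
Local Notation mu := (@lebesgue_outer R n.+1).
Local Notation lset f t := [set x | t < f x].

(* Smoothing is only assumed for bounded sets: [dense_core A] is [diamond T A]
   up to a null set, and consists of points to which smoothing applies. *)
Definition dense_core A :=
  \bigcup_k diamond_star T (A `&` ball (0 : 'rV[R]_n.+1) k.+1%:R).

(** The truncated sets exhaust [A], so their images exhaust [diamond T A] in measure, and nearly
    every point of an image is a density point of it. *)
Lemma dense_coreP A : open A -> (mu A < +oo)%E ->
  ae_sub (diamond T A) (dense_core A).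
Proof.
move=> oA fA; pose Ak k := A `&` ball (0 : 'rV[R]_n.+1) k.+1%:R.
have mA : measurable (A : set (leb_space R n.+1)) by exact: open_lebesgue_measurable.
have mAk k : measurable (Ak k : set (leb_space R n.+1)).
  by apply: measurableI => //; exact: ball_lebesgue_measurable.
have fAk k : (mu (Ak k) < +oo)%E.
  by apply: le_lt_trans fA; apply: le_lebesgue_outer; exact: subIsetl.
have mD k := diamond_measurable hX hT (mAk k) (fAk k).
have mDA := diamond_measurable hX hT mA fA.
apply: (@ae_sub_trans _ _ (\bigcup_k diamond T (Ak k))); last first.
  by apply: ae_sub_bigcup2 => k; exact: subset_density_points_ae.
apply: ae_sub_measure.
- exact: bigcupT_measurable.
- exact: mDA.
- by apply: ae_sub_bigcup => k; apply: (diamond_mono hX hT) => //; exact: subIsetl.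
- rewrite (diamond_measure hX hT mA fA) -{1}(setIT A) -bigcup_ball0 setI_bigcupr.
  apply: lebesgue_bigcup_le => // [i j ij x [Ax xi]|k].
    by split => //; apply: le_ball xi; rewrite ler_nat.
  rewrite -(diamond_measure hX hT (mAk k) (fAk k)).
  by apply: le_lebesgue_outer => x h; exists k.
- apply: (@le_lt_trans _ _ (mu (diamond T A))).
    apply: le_lebesgue_ae; apply: ae_sub_bigcup => k.
    by apply: (diamond_mono hX hT) => //; exact: subIsetl.
  by rewrite (diamond_measure hX hT mA fA).
Qed.

(** Each truncation of [A] is bounded and open, so smoothing applies to it and its Minkowski sum is
    measurable; monotonicity then enlarges that sum to [C]. *)
Lemma dense_core_smoothing A C d : 0 < d -> open A ->
  measurable (C : set (leb_space R n.+1)) -> (mu C < +oo)%E ->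
  minkowski_sum A (dilate d K) `<=` C ->
  ae_sub (minkowski_sum (dense_core A) (dilate d K)) (diamond T C).
Proof.
move=> d0 oA mC fC AC'.
pose Ak k := A `&` ball (0 : 'rV[R]_n.+1) k.+1%:R.
have oAk k : open (Ak k) by apply: openI => //; exact: ball_open.
have mAk k : measurable (Ak k : set (leb_space R n.+1)) by exact: open_lebesgue_measurable.
pose S k := minkowski_sum (Ak k) (dilate d K).
have mS k : measurable (S k : set (leb_space R n.+1)).
  by apply: open_lebesgue_measurable; exact: minkowski_sum_open.
have SC k : S k `<=` C.
  by apply: subset_trans AC'; apply: minkowski_sumS; exact: subIsetl.
have fS k : (mu (S k) < +oo)%E by apply: le_lt_trans fC; exact: le_lebesgue_outer.
have sub k : ae_sub (minkowski_sum (diamond_star T (Ak k)) (dilate d K)) (diamond T C).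
  have bAk : bounded_set (Ak k).
    exists k.+1%:R; split => [|r kr x [_]]; first exact: num_real.
    by rewrite ball_rowE/= subr0 => /ltW/le_trans; apply; exact: ltW.
  have /ae_lebesgueP h := hTK d0 (mAk k) bAk.
  apply: (@ae_sub_trans _ _ (diamond_star T (S k))).
    by apply: lebesgue_outer_null_sub h => x [x1 x2] /(_ x1).
  apply: (@ae_sub_trans _ _ (diamond T (S k))).
    have mD := diamond_measurable hX hT (mS k) (fS k).
    exact: density_points_subset_ae mD.
  exact: (diamond_mono hX hT).
apply: ae_sub_trans (ae_sub_bigcup sub); apply: sub_ae.
by move=> _ [x [k _ kx] [y Ky <-]]; exists k => //; exists x => //; exists y.
Qed.

Hypothesis hK : convex_body_o K.

Lemma convex_body_bounded : exists2 M, 0 < M & forall y, K y -> `|y| <= M.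
Proof.
have [cK _ _] := hK; have [M [_ hM]] := compact_bounded cK.
exists (Num.max (M + 1) 1); first by rewrite lt_max ltr01 orbT.
by move=> y Ky; apply: hM => //; rewrite lt_max ltrDl ltr01.
Qed.

Lemma convex_body_ball : exists2 r, 0 < r & forall y, `|y| < r -> K y.
Proof.
have [_ _ /nbhs_ballP[r /= r0 rK]] := hK; exists r => // y yr.
by apply: rK; rewrite ball_rowE/= subr0.
Qed.

Lemma convex_body_combine (x y : 'rV[R]_n.+1) (l : R) : K x -> K y -> 0 <= l <= 1 ->
  K (l *: x + (1 - l) *: y).
Proof.
move=> Kx Ky /andP[l0 l1]; have [_ cK _] := hK.
have := cK x y (@Itv01 R l l0 l1) (mem_set Kx) (mem_set Ky).
by rewrite inE.
Qed.

(* A point [x + d y] is also [x' + d (l y + (1 - l) z)], where [x'] is any point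
   of [dense_core A] close to [x + d (1 - l) y]. *)
Lemma open_core_smoothing U A C d : 0 < d -> open U -> open A -> (mu A < +oo)%E ->
  measurable (C : set (leb_space R n.+1)) -> (mu C < +oo)%E ->
  minkowski_sum A (dilate d K) `<=` C -> ae_sub U (diamond T A) ->
  ae_sub (minkowski_sum U (dilate d K)) (diamond T C).
Proof.
move=> d0 oU oA fA mC fC AC' UA.
have UP : ae_sub U (dense_core A) by apply: (ae_sub_trans UA); exact: dense_coreP.
apply: ae_sub_trans (dense_core_smoothing d0 oA mC fC AC').
apply: sub_ae => _ [x Ux [_ [y Ky <-] <-]].
have [M M0 KM] := convex_body_bounded; have [rho r0 Kr] := convex_body_ball.
have /nbhs_ballP[e /= e0 xeU] : nbhs x U by rewrite nbhsE; exists U.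
(* This [l] keeps [x0] within [e / 2] of [x]. The radius [e1] then keeps the ball around [x0] inside
   [U], so that it meets the dense core, and puts [(x0 - x') / (d l)] in [K]. *)
pose l := e / (2 * (e + d * M)).
have eM0 : 0 < 2 * (e + d * M) by rewrite mulr_gt0// addr_gt0// mulr_gt0.
have l0 : 0 < l by rewrite divr_gt0.
have l1 : l < 1.
  rewrite ltr_pdivrMr// mul1r; have : 0 < d * M by rewrite mulr_gt0.
  by move: e0; lra.
have lM : l * (d * M) < e / 2.
  rewrite /l mulrAC ltr_pdivrMr// (_ : e / 2 * _ = e * (e + d * M)); last by field.
  by rewrite ltr_pM2l// ltrDr.
pose x0 := x + (d * l) *: y.
have d1 : 0 < d * l * rho by rewrite mulr_gt0// mulr_gt0.
pose e1 := Num.min (e / 2) (d * l * rho).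
have e10 : 0 < e1 by rewrite lt_min divr_gt0.
have [x' [Px' x'x0]] : exists x', dense_core A x' /\ `|x' - x0| < e1.
  apply: contrapT => H.
  have : (mu (ball x0 e1) <= 0)%E.
    rewrite -UP; apply: le_lebesgue_outer => z; rewrite ball_rowE/= => zx0; split.
      apply: xeU; rewrite ball_rowE/= -(subrKA x0) (le_lt_trans (ler_normD _ _))//.
      have h1 : `|z - x0| < e / 2 by move: zx0; rewrite lt_min => /andP[].
      have h2 : `|x0 - x| <= l * (d * M).
        rewrite /x0 addrAC subrr add0r normrZ ger0_norm; last by rewrite mulr_ge0// ltW.
        by rewrite [d * l]mulrC -mulrA ler_wpM2l ?(ltW l0)// ler_wpM2l ?(ltW d0)// KM.
      by move: lM h1 h2; lra.
    by move=> Pz; apply: H; exists z.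
  apply/negP; rewrite -ltNge; apply: lt_le_trans (lebesgue_ball_ge _ e10).
  by rewrite lte_fin exprn_gt0.
have dl0 : d * l != 0 by rewrite mulf_neq0 ?gt_eqF.
exists x' => //; exists (d *: (l *: ((d * l)^-1 *: (x0 - x')) + (1 - l) *: y)); last first.
  rewrite scalerDr !scalerA mulfV// scale1r addrA [x' + _]addrC subrK /x0.
  by rewrite -addrA -scalerDl -mulrDr [l + _]addrC subrK mulr1.
exists (l *: ((d * l)^-1 *: (x0 - x')) + (1 - l) *: y) => //.
apply: convex_body_combine => //; last by rewrite !ltW.
have dlp : 0 < d * l by rewrite mulr_gt0.
apply: Kr; rewrite normrZ gtr0_norm ?invr_gt0// ltr_pdivrMl// distrC.
by rewrite (lt_le_trans x'x0)// ge_min lexx orbT.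
Qed.

Lemma lebesgue_setT_gt0 : (0 < mu setT)%E.
Proof.
apply: lt_le_trans (le_lebesgue_outer (@subsetT _ (ball 0 1))).
by apply: lt_le_trans (lebesgue_ball_ge _ ltr01); rewrite lte_fin exprn_gt0.
Qed.

Lemma lipschitz_lset_minkowski f (L M d s : R) : 0 <= d -> 0 <= L ->
  (forall x y, `|f x - f y| <= L * `|x - y|) -> (forall y, K y -> `|y| <= M) ->
  minkowski_sum (lset f s) (dilate d K) `<=` lset f (s - L * M * d).
Proof.
move=> d0 L0 fL KM _ [x /= sx [_ [y Ky <-] <-]].
have := fL x (x + d *: y); rewrite opprD addrA subrr sub0r normrN normrZ ger0_norm//.
move=> h; have {}h : `|f x - f (x + d *: y)| <= L * M * d.
  apply: (le_trans h); rewrite -mulrA ler_wpM2l// mulrC ler_wpM2r//; exact: KM.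
by move: h; rewrite ler_norml => /andP[_]; lra.
Qed.

(** [K] contains a ball of radius [rho]. So for rational [s] and [d], outside a null set, [s < F x]
    and [|y - x| < d rho] force [F y >= s - L M d]. Off the countable union of these null sets [F]
    is Lipschitz with constant [L M / rho], and it is extended from there. *)
Lemma rearrangement_lipschitz f (L : R) : X f -> 0 <= L ->
  (forall x y, `|f x - f y| <= L * `|x - y|) ->
  exists g (L' : R), [/\ 0 <= L', forall x y, `|g x - g y| <= L' * `|x - y| &
    lebesgue_outer [set x | T f x <> g x] = 0%E].
Proof.
move=> Xf L0 fL.
have [M M0 KM] := convex_body_bounded; have [rho r0 Kr] := convex_body_ball.
pose F := T f; pose s' (q : rat * rat) : R := ratr q.1 - L * M * ratr q.2.
have mono (q : rat * rat) : 0 < (ratr q.2 : R) -> exists N, lebesgue_outer N = 0%E /\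
    forall x y, ~ N x -> ~ N y -> ratr q.1 < F x -> `|y - x| < ratr q.2 * rho -> s' q <= F y.
  move: q => [s d] /= d0; rewrite /s' /=.
  (* If the lower level is not tame, [T f] lies at or above it almost everywhere, whatever [x]
     is. *)
  have [tame|ntame] := pselect (tame_level v f (ratr s - L * M * ratr d)); last first.
    exists [set x | F x < ratr s - L * M * ratr d]; split.
      apply: (not_tame_ge hX); first exact: T_class hT _ Xf.
      by move=> /(T_tame v hT _ Xf).
    by move=> x y _ /= Ny _ _; rewrite leNgt; exact/negP.
  have LM0 : 0 <= L * M by rewrite mulr_ge0// ltW.
  have LMd : 0 <= L * M * ratr d by rewrite mulr_ge0// ltW.
  have [vs fC] := tame.
  have fA : (mu (lset f (ratr s)) < +oo)%E.
    apply: le_lt_trans fC; apply: le_lebesgue_outer => x /=; apply: le_lt_trans.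
    by rewrite gerBl.
  have tA : tame_level v f (ratr s).
    by split => // /vs /le_trans; apply; rewrite gerBl.
  have oA : open (lset f (ratr s)) by exact: lipschitz_open_gt fL.
  have [_ h1] := diamond_lset hX hT Xf tA.
  have [h2 _] := diamond_lset hX hT Xf tame.
  have h3 := dense_coreP oA fA.
  have h4 := dense_core_smoothing d0 oA (lset_measurable hX (ratr s - L * M * ratr d) Xf) fC
    (lipschitz_lset_minkowski (ltW d0) L0 fL KM).
  have h5 := ae_sub_trans h1 h3; have h6 := ae_sub_trans h4 h2.
  eexists; split; first exact: lebesgue_outerU0 h5 h6.
  move=> x y /not_orP[Nx _] /not_orP[_ Ny] sx yx.
  have Px : dense_core (lset f (ratr s)) x.
    by apply: contrapT => nP; apply: Nx.
  have Py : minkowski_sum (dense_core (lset f (ratr s))) (dilate (ratr d) K) y.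
    exists x => //; exists (y - x); last by rewrite addrC subrK.
    exists ((ratr d)^-1 *: (y - x)); last by rewrite scalerA mulfV ?gt_eqF// scale1r.
    apply: Kr; rewrite normrZ gtr0_norm ?invr_gt0// mulrC ltr_pdivrMr//.
    by rewrite mulrC.
  by apply: ltW; apply: contrapT => nF; apply: Ny; split.
have /choice[N hN] : forall q : rat * rat, exists N, lebesgue_outer N = 0%E /\
    (0 < (ratr q.2 : R) ->
    forall x y, ~ N x -> ~ N y -> ratr q.1 < F x -> `|y - x| < ratr q.2 * rho -> s' q <= F y).
  move=> q; have [/mono[N [N0 hN]]|q0] := ltP 0 (ratr q.2 : R); first by exists N.
  by exists set0; split => //; exact: lebesgue_outer0.
have N0 : lebesgue_outer (\bigcup_q N q) = 0%E.
  by apply: lebesgue_outer_bigcup0 => q; have [] := hN q.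
pose G := ~` \bigcup_q N q; pose L' := L * M / rho.
have LM0 : 0 <= L * M by rewrite mulr_ge0// ltW.
have L'0 : 0 <= L' by rewrite divr_ge0// ltW.
have [z0 Gz0] : G !=set0.
  apply: contrapT => /set0P/negP; rewrite negbK => /eqP G0.
  have := lebesgue_setT_gt0; rewrite -[setT]setC0 -G0 /G setCK N0 ltxx//.
have FL x y : G x -> G y -> F x - F y <= L' * `|x - y|.
  move=> Gx Gy; apply/ler_addgt0Pr => e e0.
  have e1 : 0 < e / 2 by rewrite divr_gt0.
  have LM1 : 0 < L * M + 1 by rewrite ltr_wpDl.
  have e2 : 0 < e / 2 / (L * M + 1) by rewrite divr_gt0.
  have [s] := @rat_in_itvoo R (F x - e / 2) (F x) (ltac:(by rewrite ltrBlDr ltrDl)).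
  rewrite in_itv/= => /andP[s1 s2].
  have [d] := @rat_in_itvoo R (`|x - y| / rho) (`|x - y| / rho + e / 2 / (L * M + 1))
    (ltac:(by rewrite ltrDl)).
  rewrite in_itv/= => /andP[d1 d2].
  have d0 : 0 < ratr d :> R by apply: le_lt_trans d1; rewrite divr_ge0// ltW.
  have [_ /(_ d0 x y)] := hN (s, d); rewrite /s' /=.
  have Nx : ~ N (s, d) x by move=> h; apply: Gx; exists (s, d).
  have Ny : ~ N (s, d) y by move=> h; apply: Gy; exists (s, d).
  rewrite distrC -ltr_pdivrMr// => /(_ Nx Ny s2 d1) h.
  have h3 : L * M * ratr d <= L' * `|x - y| + e / 2.
    apply: (@le_trans _ _ (L * M * (`|x - y| / rho + e / 2 / (L * M + 1)))).
      by rewrite ler_wpM2l// ltW.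
    rewrite mulrDr; apply: lerD; first by rewrite /L' mulrA mulrAC.
    rewrite mulrCA ler_piMr ?(ltW e1)// ler_pdivrMr// mul1r lerDl//.
  by move: h h3 s1; lra.
have [g [gL gF]] := lipschitz_extension L'0 (ex_intro _ z0 Gz0) FL.
exists g, L'; split => //; apply: lebesgue_outer_null_sub N0 => x /= nFg.
by apply: contrapT => Gx; apply: nFg; rewrite gF.
Qed.

End smoothing_theory.

(** * Sup-convolutions and the anisotropic gradient *)

Section sup_convolution.
Context {R : realType} {n : nat}.
Variables (K : set 'rV[R]_n) (M : R).
Hypothesis K0 : K 0.
Hypothesis KM : forall y, K y -> `|y| <= M.
Implicit Types (f : 'rV[R]_n -> R) (d s L : R) (x y : 'rV[R]_n).
Local Notation lset f t := [set x | t < f x].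

Definition sup_conv d f x := sup [set f (x - d *: y) | y in K].

Let M0 : 0 <= M. Proof. by have := KM K0; rewrite normr0. Qed.

Section lipschitz.
Variables (f : 'rV[R]_n -> R) (L : R).
Hypothesis L0 : 0 <= L.
Hypothesis fL : forall x y, `|f x - f y| <= L * `|x - y|.

Let f_shift d x y : 0 <= d -> K y -> f (x - d *: y) <= f x + L * M * d.
Proof.
move=> d0 Ky; have := fL (x - d *: y) x.
rewrite addrAC subrr add0r normrN normrZ ger0_norm//.
have : L * (d * `|y|) <= L * M * d.
  by rewrite -mulrA ler_wpM2l// mulrC ler_wpM2r// KM.
move=> h1 h2; have := le_trans h2 h1; rewrite ler_norml; lra.
Qed.

Lemma has_sup_conv d x : 0 <= d -> has_sup [set f (x - d *: y) | y in K].
Proof.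
move=> d0; split; first by exists (f (x - d *: 0)); exists 0.
by exists (f x + L * M * d) => _ [y Ky <-]; exact: f_shift.
Qed.

Lemma sup_conv_ge d x y : 0 <= d -> K y -> f (x - d *: y) <= sup_conv d f x.
Proof.
by move=> d0 Ky; apply: ub_le_sup; [have [] := has_sup_conv x d0|exists y].
Qed.

Lemma sup_conv_le d x c : 0 <= d -> (forall y, K y -> f (x - d *: y) <= c) ->
  sup_conv d f x <= c.
Proof.
move=> d0 h; apply: ge_sup; first by have [] := has_sup_conv x d0.
by move=> _ [y Ky <-]; exact: h.
Qed.

Lemma sup_conv_ub d x : 0 <= d -> sup_conv d f x <= f x + L * M * d.
Proof. by move=> d0; apply: sup_conv_le => // y; exact: f_shift. Qed.

Lemma sup_conv_lset d s : 0 <= d ->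
  lset (sup_conv d f) s = minkowski_sum (lset f s) (dilate d K).
Proof.
move=> d0; apply/seteqP; split => [x /= sx|_ [z /= sz [_ [y Ky <-] <-]]].
  have [_ [y Ky <-] h] : exists2 r, [set f (x - d *: y) | y in K] r & s < r.
    by apply: sup_gt => //; have [] := has_sup_conv x d0.
  exists (x - d *: y) => //; exists (d *: y); first by exists y.
  by rewrite subrK.
by apply: lt_le_trans sz _; have := sup_conv_ge (z + d *: y) d0 Ky; rewrite addrK.
Qed.

Lemma sup_conv_lset_open d s : 0 <= d -> open (lset (sup_conv d f) s).
Proof.
move=> d0; rewrite sup_conv_lset//; apply: minkowski_sum_open.
exact: lipschitz_open_gt fL.
Qed.

End lipschitz.

End sup_convolution.

Section measurable_lset.
Context {R : realType} {d : measure_display} {T : measurableType d}.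

Lemma measurable_fun_lset (f : T -> R) :
  (forall t, measurable [set x | t < f x]) -> measurable_fun setT f.
Proof.
move=> mf _; apply: (measurability _ (RGenOInfty.measurableE R)) => // _ [_ [t ->] <-].
rewrite setTI (_ : _ @^-1` _ = [set x | t < f x])//.
by apply/seteqP; split => x; rewrite /preimage/= in_itv/= andbT.
Qed.

End measurable_lset.

(** * Layer-cake comparison *)

Section layer_cake.
Context {R : realType} {n : nat}.
Implicit Types (u v : 'rV[R]_n -> R) (t tau : R).
Local Notation mu := (lebesgue R n).
Local Notation lset f t := [set x | t < f x].

(** The length of the set of [t > tau] with [v x <= t < u x]. By Tonelli its integral is that of the
    measures of [{u > t} \ {v > t}] over [t > tau]. *)
Definition excess u v tau x : \bar R := (Num.max 0 (u x - Num.max (v x) tau))%:E.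

Let S u v tau : set (leb_space R n * R) := [set p | [/\ v p.1 <= p.2, p.2 < u p.1 & tau < p.2]].

Let S_measurable u v tau :
  measurable_fun [set: leb_space R n] (u : leb_space R n -> R) ->
  measurable_fun [set: leb_space R n] (v : leb_space R n -> R) ->
  measurable (S u v tau).
Proof.
move=> mu_ mv.
have mu1 : measurable_fun [set: leb_space R n * R] (fun p => u p.1).
  exact: (measurableT_comp mu_ measurable_fst).
have mv1 : measurable_fun [set: leb_space R n * R] (fun p => v p.1).
  exact: (measurableT_comp mv measurable_fst).
have m2 : measurable_fun [set: leb_space R n * R] (fun p => p.2 : R) by exact: measurable_snd.
rewrite (_ : S u v tau = (setT `&` (fun p => p.2 - v p.1) @^-1` `[0, +oo[) `&`
  ((setT `&` (fun p => u p.1 - p.2) @^-1` `]0, +oo[) `&`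
   (setT `&` (fun p => p.2) @^-1` `]tau, +oo[))).
  apply: measurableI.
    by apply: (measurable_funB m2 mv1) => //; exact: measurable_itv.
  apply: measurableI.
    by apply: (measurable_funB mu1 m2) => //; exact: measurable_itv.
  by apply: m2 => //; exact: measurable_itv.
rewrite !setTI; apply/seteqP; split => -[x t]; rewrite /preimage/= !in_itv/= !andbT subr_ge0 subr_gt0.
  by case.
by case=> ? [].
Qed.

Let S_slice1 u v tau x : ((\int[@lebesgue_measure R]_t (\1_(S u v tau) (x, t))%:E) = excess u v tau x)%E.
Proof.
have [b E] : exists b : bool, [set t | S u v tau (x, t)] =
    [set` Interval (BSide b (Num.max (v x) tau)) (BLeft (u x))].
  have [h|h] := ltP tau (v x).
    exists true; apply/seteqP; split => t; rewrite /S/= in_itv/=; first by case=> -> ->.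
    by case/andP => vt tu; split => //; exact: lt_le_trans vt.
  exists false; apply/seteqP; split => t; rewrite /S/= in_itv/=; first by case=> _ -> ->.
  by case/andP => vt tu; split => //; rewrite (le_trans h)// ltW.
rewrite (_ : (fun t => _) = (fun t => (\1_[set t | S u v tau (x, t)] t)%:E)); last first.
  by apply/funext => t; rewrite !indicE; congr (_%:R%:E); apply/idP/idP; rewrite !inE.
rewrite integral_indic//; last by rewrite E; exact: measurable_itv.
rewrite setIT E [LHS]lebesgue_measure_itv/= lte_fin /excess.
move: (Num.max (v x) tau) => w.
case: ltP => h; first by rewrite -EFinB max_r// subr_ge0 ltW.
by rewrite max_l// subr_le0.
Qed.

Let S_slice2 u v tau t :
  measurable_fun [set: leb_space R n] (u : leb_space R n -> R) ->
  measurable_fun [set: leb_space R n] (v : leb_space R n -> R) ->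
  ((\int[mu]_x (\1_(S u v tau) (x, t))%:E) =
    if (tau < t)%R then lebesgue_outer (lset u t `\` lset v t) else 0)%E.
Proof.
move=> mu_ mv; case: ltP => h; last first.
  apply: integral0_eq => x _; rewrite indicE memNset// => -[_ _ /=].
  by rewrite ltNge h.
rewrite (_ : (fun x => _) = (fun x => (\1_(lset u t `\` lset v t) x)%:E)); last first.
  apply/funext => x; rewrite !indicE; congr ((nat_of_bool _)%:R%:E).
  apply/idP/idP; rewrite !inE.
    by move=> [/= h1 h2 _]; split => //=; apply/negP; rewrite -leNgt.
  by move=> [/= h1 /negP]; rewrite -leNgt => h2; split.
rewrite integral_indic//; first by rewrite setIT.
apply: measurableD.
  rewrite (_ : mkset _ = setT `&` u @^-1` `]t, +oo[%classic).
    by apply: mu_ => //; exact: measurable_itv.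
  by rewrite setTI; apply/seteqP; split => x; rewrite /preimage/= in_itv/= andbT.
rewrite (_ : mkset _ = setT `&` v @^-1` `]t, +oo[%classic).
  by apply: mv => //; exact: measurable_itv.
by rewrite setTI; apply/seteqP; split => x; rewrite /preimage/= in_itv/= andbT.
Qed.

Lemma integral_excess u v tau :
  measurable_fun [set: leb_space R n] (u : leb_space R n -> R) ->
  measurable_fun [set: leb_space R n] (v : leb_space R n -> R) ->
  (\int[mu]_x excess u v tau x = \int[@lebesgue_measure R]_t
    if (tau < t)%R then lebesgue_outer (lset u t `\` lset v t) else 0)%E.
Proof.
move=> mu_ mv.
under eq_integral do rewrite -S_slice1.
under [RHS]eq_integral do rewrite -S_slice2//.
apply: (@fubini_tonelli _ _ _ _ _ (lebesgue R n) (@lebesgue_measure R)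
  (fun p => (\1_(S u v tau) p)%:E)).
  by apply/measurable_EFinP; apply: measurable_indic; exact: S_measurable.
by move=> p; rewrite lee_fin.
Qed.

Lemma le_integral_excess u v u' v' tau :
  measurable_fun [set: leb_space R n] (u : leb_space R n -> R) ->
  measurable_fun [set: leb_space R n] (v : leb_space R n -> R) ->
  measurable_fun [set: leb_space R n] (u' : leb_space R n -> R) ->
  measurable_fun [set: leb_space R n] (v' : leb_space R n -> R) ->
  (forall t, tau < t -> (lebesgue_outer (lset u t `\` lset v t) <=
    lebesgue_outer (lset u' t `\` lset v' t))%E) ->
  (\int[mu]_x excess u v tau x <= \int[mu]_x excess u' v' tau x)%E.
Proof.
move=> mu1 mv1 mu2 mv2 h; rewrite !integral_excess//.
have mF a b : measurable_fun [set: leb_space R n] (a : leb_space R n -> R) ->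
    measurable_fun [set: leb_space R n] (b : leb_space R n -> R) ->
    measurable_fun setT (fun t : R => (if (tau < t)%R then lebesgue_outer (lset a t `\` lset b t) else 0)%E : \bar R).
  move=> ma mb; rewrite (_ : (fun t => _) = (fun t => \int[mu]_x (\1_(S a b tau) (x, t))%:E)%E).
    apply: (@measurable_fun_fubini_tonelli_G _ _ _ _ _ (lebesgue R n)
      (fun p => (\1_(S a b tau) p)%:E)).
      by apply/measurable_EFinP; apply: measurable_indic; exact: S_measurable.
    by move=> p; rewrite lee_fin.
  by apply/funext => t; rewrite S_slice2.
apply: ge0_le_integral; [exact: measurableT| |exact: mF|exact: mF|].
  by move=> t _; case: ifP => // _; exact: lebesgue_outer_ge0.
by move=> t _; case: ifPn => // tt; exact: h.
Qed.

End layer_cake.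

Section anisotropic_gradient.
Context {R : realType} {n : nat}.
Variable K : set 'rV[R]_n.+1.
Hypothesis hK : convex_body_o K.
Implicit Types (f g : 'rV[R]_n.+1 -> R) (x y : 'rV[R]_n.+1) (d e b : R).
Local Notation mu := (lebesgue R n.+1).
Local Notation lset f t := [set x | t < f x].

Definition aniso f x := support_fun (reflect_set K) (grad f x).

Lemma convex_body0 : K 0.
Proof. by have [r r0] := convex_body_ball hK; apply; rewrite normr0. Qed.

Lemma dotZr x y (d : R) : dot x (d *: y) = d * dot x y.
Proof. by rewrite /dot mulr_sumr; apply: eq_bigr => i _; rewrite mxE mulrCA. Qed.

Lemma support_has_sup x : has_sup [set dot x y | y in reflect_set K].
Proof.
split; first by exists (dot x 0), 0 => //; exists 0; [exact: convex_body0|exact: oppr0].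
have [M M0 KM] := convex_body_bounded hK.
exists (\sum_i `|x 0 i| * M) => _ [_ [y Ky <-] <-].
apply: ler_sum => i _; rewrite (le_trans (ler_norm _))// normrM ler_wpM2l//.
by rewrite mxE normrN (le_trans (coord_le_norm _ _))// KM.
Qed.

Lemma le_support_fun x y : K y -> dot x (- y) <= support_fun (reflect_set K) x.
Proof.
move=> Ky; apply: ub_le_sup; first by have [] := support_has_sup x.
by exists (- y) => //; exists y.
Qed.

Lemma support_fun_le x c : (forall y, K y -> dot x (- y) <= c) ->
  support_fun (reflect_set K) x <= c.
Proof.
move=> h; apply: ge_sup; first by have [] := support_has_sup x.
by move=> _ [_ [y Ky <-] <-]; exact: h.
Qed.

Lemma aniso_ge0 f x : 0 <= aniso f x.
Proof.
have := le_support_fun (grad f x) convex_body0; apply: le_trans.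
by rewrite oppr0 /dot big1// => i _; rewrite [X in _ * X]mxE mulr0.
Qed.

Section lipschitz.
Variables (f : 'rV[R]_n.+1 -> R) (L : R).
Hypothesis L0 : 0 <= L.
Hypothesis fL : forall x y, `|f x - f y| <= L * `|x - y|.

(** The differential is uniform over the bounded set [K], so the supremum over [y] of
    [f (x - d y) - f x] is, up to [e d], [d] times that of the gradient paired with [- y]. The sign
    is what produces [-K]. *)
Lemma sup_conv_diff x e : differential_at f x -> 0 < e ->
  exists2 del, 0 < del & forall d, 0 < d < del ->
    `|(sup_conv K d f x - f x) / d - aniso f x| <= e.
Proof.
move=> dfx e0; have [M M0 KM] := convex_body_bounded hK.
have M1 : 0 < M + 1 by rewrite ltr_wpDl// ltW.
have [|del del0 hdel] := dfx (e / (M + 1)); first by rewrite divr_gt0.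
exists (del / (M + 1)); first by rewrite divr_gt0.
move=> d /andP[d0 dd].
have key y : K y -> `|f (x - d *: y) - f x - d * dot (grad f x) (- y)| <= e * d.
  move=> Ky; have yd : `|- (d *: y)| <= M * d.
    by rewrite normrN normrZ gtr0_norm// mulrC ler_wpM2r ?KM// ltW.
  have Md : M * d <= (M + 1) * d by rewrite ler_wpM2r ?lerDl// ltW.
  rewrite -dotZr scalerN; apply: le_trans (hdel _ _) _.
    apply: (le_lt_trans yd); apply: (le_lt_trans Md).
    by move: dd; rewrite ltr_pdivlMr// mulrC.
  apply: (@le_trans _ _ (e / (M + 1) * ((M + 1) * d))).
    rewrite ler_wpM2l ?divr_ge0 ?(ltW e0) ?(ltW M1)//.
    exact: le_trans yd Md.
  by rewrite mulrA divfK// gt_eqF.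
have up : sup_conv K d f x - f x <= d * (aniso f x + e).
  rewrite lerBlDr; apply: (sup_conv_le convex_body0 KM L0 fL (ltW d0)) => y Ky.
  have : d * dot (grad f x) (- y) <= d * aniso f x.
    by rewrite ler_wpM2l ?(ltW d0)//; exact: le_support_fun.
  by have := key y Ky; rewrite ler_norml => /andP[_]; lra.
have lo : aniso f x <= (sup_conv K d f x - f x) / d + e.
  apply: support_fun_le => y Ky.
  rewrite -lerBlDr ler_pdivlMr// mulrC mulrBr.
  have := sup_conv_ge convex_body0 KM L0 fL x (ltW d0) Ky.
  by have := key y Ky; rewrite ler_norml => /andP[+ _]; lra.
rewrite ler_norml; apply/andP; split; first by move: lo; lra.
by rewrite lerBlDr ler_pdivrMr// mulrC [e + _]addrC.
Qed.

Lemma sup_conv_cvg N x : differential_at f x ->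
  (sup_conv K ((k + N).+1%:R^-1) f x - f x) / ((k + N).+1%:R^-1) @[k --> \oo]
    --> aniso f x.
Proof.
move=> dfx; apply/cvgrPdist_le => e e0.
have [del del0 h] := sup_conv_diff dfx e0.
near=> k; rewrite distrC; apply: h; rewrite invr_gt0 ltr0Sn/=.
rewrite invf_plt ?posrE//; apply: (lt_le_trans (truncnS_gt _)).
rewrite ler_nat ltnS (leq_trans _ (leq_addr _ _))//.
by near: k; exact: nbhs_infty_ge.
Unshelve. all: by end_near. Qed.

Lemma sup_conv_measurable d : 0 <= d ->
  measurable_fun [set: leb_space R n.+1] (sup_conv K d f : leb_space R n.+1 -> R).
Proof.
move=> d0; have [M M0 KM] := convex_body_bounded hK.
apply: measurable_fun_lset => t; apply: open_lebesgue_measurable.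
exact: (sup_conv_lset_open convex_body0 KM L0 fL).
Qed.

Lemma lipschitz_measurable :
  measurable_fun [set: leb_space R n.+1] (f : leb_space R n.+1 -> R).
Proof.
apply: measurable_fun_lset => t; apply: open_lebesgue_measurable.
exact: lipschitz_open_gt fL.
Qed.

(** The offset [N] keeps every step at most [1/(N+1)], so that one gap between two levels suits the
    whole sequence. *)
Let quot N k : leb_space R n.+1 -> R := fun x =>
  (sup_conv K ((k + N).+1%:R^-1) f x - f x) / ((k + N).+1%:R^-1).

Let quot_measurable N k : measurable_fun [set: leb_space R n.+1] (quot N k).
Proof.
apply: measurable_funM; last exact: measurable_cst.
by apply: measurable_funB; [exact: sup_conv_measurable|exact: lipschitz_measurable].
Qed.

(** Almost everywhere the limit of the quotients, which are measurable; completeness of the measure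
    takes care of the exceptional null set. *)
Lemma aniso_measurable :
  measurable_fun [set: leb_space R n.+1] (aniso f : leb_space R n.+1 -> R).
Proof.
apply/measurable_EFinP.
pose h : leb_space R n.+1 -> \bar R := fun x => limn_esup (fun k => (quot 0 k x)%:E).
apply: (@ae_measurable_fun _ _ _ mu _ setT h).
- exact: measure_is_complete_caratheodory.
- apply/ae_lebesgueP; apply: lebesgue_outer_null_sub (rademacher fL) => x /= nx dx.
  apply: nx => _; rewrite /h.
  have : ((quot 0 k x)%:E @[k --> \oo] --> (aniso f x)%:E)%E.
    by apply/cvg_EFin; [exact: nearW|exact: sup_conv_cvg].
  by move=> /cvg_limn_einf_sup[_ ->].
- rewrite /h; apply: measurable_fun_limn_esup => k.
  by apply/measurable_EFinP; exact: quot_measurable.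
Qed.

Definition hinge b (N k : nat) x : \bar R := (Num.max 0 (quot N k x - b))%:E.

Definition aniso_hinge b x : \bar R := (Num.max 0 (aniso f x - b))%:E.

Lemma hinge_measurable b N k D : measurable D ->
  measurable_fun (D : set (leb_space R n.+1)) (hinge b N k : leb_space R n.+1 -> \bar R).
Proof.
move=> mD; apply/measurable_EFinP; apply: measurable_funTS.
apply: measurable_maxr; first exact: measurable_cst.
by apply: measurable_funB; [exact: quot_measurable|exact: measurable_cst].
Qed.

Lemma aniso_hinge_measurable b D : measurable D ->
  measurable_fun (D : set (leb_space R n.+1)) (aniso_hinge b : leb_space R n.+1 -> \bar R).
Proof.
move=> mD; apply/measurable_EFinP; apply: measurable_funTS.
apply: measurable_maxr; first exact: measurable_cst.
by apply: measurable_funB; [exact: aniso_measurable|exact: measurable_cst].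
Qed.

Lemma hinge_cvg b N x : differential_at f x ->
  (hinge b N k x @[k --> \oo] --> aniso_hinge b x)%E.
Proof.
move=> dfx; apply/cvg_EFin; first exact: nearW.
apply/cvgrPdist_le => e e0; have /cvgrPdist_le/(_ _ e0) := sup_conv_cvg N dfx.
apply: filterS => k; rewrite -/(quot N k x) /=.
move: (quot N k x) (aniso f x) => u w; rewrite !ler_norml.
by rewrite /Num.max; do 2 case: ifPn; rewrite -?leNgt; lra.
Qed.

End lipschitz.

End anisotropic_gradient.

Section limn_einf.
Context {R : realType}.
Implicit Types u w : (\bar R)^nat.

Lemma le_limn_einf u w : (forall k, (u k <= w k)%E) -> (limn_einf u <= limn_einf w)%E.
Proof.
move=> uw; rewrite !limn_einf_lim; apply: lee_lim; [exact: is_cvg_einfs..|].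
apply: nearW => k; apply: le_ereal_inf_tmp => _ [j kj <-]; apply: le_trans (uw j).
by apply: ereal_inf_lbound; exists j.
Qed.

Lemma limn_einf_cst (c : \bar R) : limn_einf (fun _ => c) = c.
Proof. by have [] := cvg_limn_einf_sup (cvg_cst c). Qed.

End limn_einf.

Lemma integrable_cst_finite d (U : measurableType d) (R : realType)
    (m : {measure set U -> \bar R}) (A : set U) (r : R) :
  measurable A -> (m A < +oo)%E -> m.-integrable A (EFin \o cst r).
Proof.
move=> mA fA; apply: measurable_bounded_integrable => //.
by exists `|r|; split => // x rx y _; exact: ltW.
Qed.

Lemma measurable_fun_limn_einf d (U : measurableType d) (R : realType) (A : set U)
    (h : (U -> \bar R)^nat) : (forall k, measurable_fun A (h k)) ->
  measurable_fun A (fun x => limn_einf (h ^~ x)).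
Proof.
move=> mh; rewrite (_ : (fun x => _) =
    fun x => (- limn_esup (fun k => - h k x))%E).
  apply: measurableT_comp; first exact: oppe_measurable.
  apply: measurable_fun_limn_esup => k.
  by apply: measurableT_comp; [exact: oppe_measurable|exact: mh].
by apply/funext => x; rewrite -limn_einfN; congr limn_einf; apply/funext => k /=;
  rewrite oppeK.
Qed.

Lemma ae_sub_setD {R : realType} {n : nat} (A A' B B' : set 'rV[R]_n) :
  ae_sub A A' -> ae_sub B' B -> ae_sub (A `\` B) (A' `\` B').
Proof.
move=> AA' BB'; apply: lebesgue_outer_null_sub (lebesgue_outerU0 AA' BB').
move=> x [[Ax Bx] nx]; have [A'x|] := pselect (A' x); last by left.
by right; split => //; apply: contrapT => B'x; apply: nx; split.
Qed.

(** * The inequality for hinges *)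

Section hinge_inequality.
Context {R : realType} {n : nat}.
Variables (v : bool) (X : set ('rV[R]_n.+1 -> R)).
Hypothesis hX : X = if v then @class_V R n.+1 else @class_S R n.+1.
Variable T : ('rV[R]_n.+1 -> R) -> ('rV[R]_n.+1 -> R).
Hypothesis hT : rearrangement X T.
Variable K : set 'rV[R]_n.+1.
Hypothesis hTK : smoothing K T.
Hypothesis hK : convex_body_o K.
Variables (f g : 'rV[R]_n.+1 -> R) (L L' : R).
Hypothesis L0 : 0 <= L.
Hypothesis fL : forall x y, `|f x - f y| <= L * `|x - y|.
Hypothesis Xf : X f.
Hypothesis L'0 : 0 <= L'.
Hypothesis gL : forall x y, `|g x - g y| <= L' * `|x - y|.
Hypothesis Tfg : lebesgue_outer [set x | T f x <> g x] = 0%E.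
Variable M : R.
Hypothesis M0 : 0 < M.
Hypothesis KM : forall y, K y -> `|y| <= M.
Implicit Types (x y : 'rV[R]_n.+1) (b c d t tau : R).
Local Notation mu := (@lebesgue R n.+1).
Local Notation lset f t := [set x | (t < f x)%R].

Let K0 : K 0. Proof. exact: convex_body0. Qed.

Lemma tame_level_le t tau : tame_level v f tau -> tau <= t -> tame_level v f t.
Proof.
move=> [v0 fin] le; split; first by move=> /v0 h; exact: le_trans le.
by apply: le_lt_trans fin; apply: le_lebesgue_outer => x /=; exact: le_lt_trans.
Qed.

Let lset_Tg t : ae_sub (lset (T f) t) (lset g t) /\ ae_sub (lset g t) (lset (T f) t).
Proof.
by split; apply: lebesgue_outer_null_sub Tfg => x /= [h1 h2] e; apply: h2;
  rewrite -?e// e.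
Qed.

(** Smoothing puts [{g_d > t + c}] essentially inside the image of [{f_d > t + c}], while [{g > t}]
    is the image of [{f > t}]; [diamondD_le] compares the differences. The last hypothesis places
    [{f_d > t + c}] inside [{f > tau}], which has finite measure. *)
Lemma sup_conv_level_le d c t tau : 0 < d -> 0 <= c ->
  tame_level v f tau -> tau <= t -> tau <= t + c - L * M * d ->
  (lebesgue_outer (lset (sup_conv K d g) (t + c) `\` lset g t) <=
   lebesgue_outer (lset (sup_conv K d f) (t + c) `\` lset f t))%E.
Proof.
move=> d0 c0 tau_f tau_t tau_c.
have t_f := tame_level_le tau_f tau_t.
have tc_f : tame_level v f (t + c) by apply: (tame_level_le t_f); rewrite lerDl.
have Cf : ((lebesgue_outer (lset (sup_conv K d f) (t + c))) < +oo)%E.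
  apply: le_lt_trans tau_f.2; rewrite (sup_conv_lset K0 KM L0 fL _ (ltW d0)).
  apply: le_lebesgue_outer => x.
  move=> /(lipschitz_lset_minkowski (ltW d0) L0 fL KM); exact: le_lt_trans.
have mC : measurable (lset (sup_conv K d f) (t + c) : set (leb_space R n.+1)).
  apply: open_lebesgue_measurable.
  by apply: (sup_conv_lset_open K0 KM L0 fL); exact: ltW.
have mB : measurable (lset f t : set (leb_space R n.+1)).
  exact/open_lebesgue_measurable/(lipschitz_open_gt fL).
apply: le_trans (diamondD_le hX hT mB mC t_f.2 Cf).
apply/le_lebesgue_ae/ae_sub_setD.
  rewrite [X in ae_sub X _](sup_conv_lset K0 KM L'0 gL _ (ltW d0)).
  apply: (open_core_smoothing hX hT hTK hK d0 _ _ tc_f.2 mC Cf).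
  - exact: lipschitz_open_gt gL.
  - exact: lipschitz_open_gt fL.
  - by rewrite (sup_conv_lset K0 KM L0 fL _ (ltW d0)).
  - apply: (ae_sub_trans (lset_Tg _).2).
    by have [] := diamond_lset hX hT Xf tc_f.
apply: ae_sub_trans (lset_Tg _).1.
by have [] := diamond_lset hX hT Xf t_f.
Qed.

Lemma lset_excess (w : 'rV[R]_n.+1 -> R) c t :
  lset (fun x => w x - c) t = lset w (t + c).
Proof. by apply/seteqP; split => x /=; rewrite ltrBrDr. Qed.

Lemma excess_measurable (u w : 'rV[R]_n.+1 -> R) tau :
  measurable_fun [set: leb_space R n.+1] (u : leb_space R n.+1 -> R) ->
  measurable_fun [set: leb_space R n.+1] (w : leb_space R n.+1 -> R) ->
  measurable_fun [set: leb_space R n.+1] (excess u w tau : leb_space R n.+1 -> \bar R).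
Proof.
move=> mu_ mw; apply/measurable_EFinP; apply: measurable_maxr.
  exact: measurable_cst.
apply: measurable_funB; first exact: mu_.
by apply: measurable_maxr; [exact: mw|exact: measurable_cst].
Qed.

(** Multiplied by [d], a hinge is the positive part of [f_d - d b - f], and [excess] compares these
    parts above [tau]. The gap [tau - tau'] dominates [L M d] for all steps [d] in use. *)
Lemma hinge_step b (N k : nat) tau tau' : 0 <= b -> tame_level v f tau' ->
  tau' <= tau -> L * M / N.+1%:R <= tau - tau' ->
  (\int[mu]_(x in lset g tau) hinge K g b N k x <=
   \int[mu]_(x in lset f tau') hinge K f b N k x)%E.
Proof.
move=> b0 tame' tt' LMN.
have mg : measurable (lset g tau : set (leb_space R n.+1)).
  exact/open_lebesgue_measurable/(lipschitz_open_gt gL).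
have mf : measurable (lset f tau' : set (leb_space R n.+1)).
  exact/open_lebesgue_measurable/(lipschitz_open_gt fL).
pose d : R := (k + N).+1%:R^-1.
have d0 : 0 < d by rewrite invr_gt0.
have LMd : L * M * d <= tau - tau'.
  apply: le_trans LMN; rewrite ler_wpM2l ?mulr_ge0 ?(ltW M0)//.
  by rewrite /d lef_pV2 ?posrE// ler_nat ltnS leq_addl.
have sub w Lw (Lw0 : 0 <= Lw) (wL : forall x y, `|w x - w y| <= Lw * `|x - y|) :
    measurable_fun [set: leb_space R n.+1] ((fun x => sup_conv K d w x - d * b) : leb_space R n.+1 -> R).
  apply: measurable_funB; last exact: measurable_cst.
  exact: (sup_conv_measurable hK Lw0 wL (ltW d0)).
have hingeE (w : 'rV[R]_n.+1 -> R) x :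
    (d%:E * hinge K w b N k x = (Num.max 0 (sup_conv K d w x - d * b - w x))%:E)%E.
  rewrite /hinge -/d -EFinM maxr_pMr ?(ltW d0)// mulr0 mulrBr mulrCA divff ?mulr1 ?gt_eqF//.
  by rewrite addrAC.
have h0 w x : (0 <= hinge K w b N k x)%E by rewrite lee_fin le_max lexx.
have e0 (u w : 'rV[R]_n.+1 -> R) s x : (0 <= excess u w s x)%E by rewrite lee_fin le_max lexx.
have key : (d%:E * \int[mu]_(x in lset g tau) hinge K g b N k x <=
    d%:E * \int[mu]_(x in lset f tau') hinge K f b N k x)%E.
  rewrite -!ge0_integralZl ?lee_fin ?(ltW d0)//; last first.
  - exact: (hinge_measurable hK L'0 gL).
  - exact: (hinge_measurable hK L0 fL).
  pose u w x := sup_conv K d w x - d * b.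
  apply: (@le_trans _ _ (\int[mu]_x excess (u g) g tau x)%E).
    apply: (@le_trans _ _ (\int[mu]_(x in lset g tau) excess (u g) g tau x)%E).
      rewrite le_eqVlt; apply/orP; left; apply/eqP/eq_integral => x.
      by rewrite inE/= => tx; rewrite hingeE /excess /u (max_idPl (ltW tx)).
    apply: ge0_subset_integral => //.
    apply: excess_measurable; [exact: (sub _ _ L'0 gL)|exact: (lipschitz_measurable gL)].
  apply: (@le_trans _ _ (\int[mu]_x excess (u f) f tau x)%E).
    apply: le_integral_excess.
    - exact: (sub _ _ L'0 gL).
    - exact: (lipschitz_measurable gL).
    - exact: (sub _ _ L0 fL).
    - exact: (lipschitz_measurable fL).
    - move=> t taut; rewrite /u !lset_excess.
      apply: (sup_conv_level_le d0 _ tame'); first by rewrite mulr_ge0// ltW.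
        by rewrite (le_trans tt')// ltW.
      by have := mulr_ge0 (ltW d0) b0; move: LMd; lra.
  rewrite [leRHS]integral_mkcond; apply: ge0_le_integral.
  - exact: measurableT.
  - by move=> x _; exact: e0.
  - apply: excess_measurable; [exact: (sub _ _ L0 fL)|exact: (lipschitz_measurable fL)].
  - apply/(measurable_restrictT _ mf).
    apply: measurable_funeM; exact: (hinge_measurable hK L0 fL).
  - move=> x _; rewrite /patch; case: ifPn => [_|/negP nx].
      rewrite hingeE /excess /u lee_fin ge_max le_max lexx/= le_max; apply/orP; right.
      by rewrite lerB// le_max lexx.
    (* Here [f_d x <= f x + L M d <= tau], so nothing of the excess above [tau] lies outside
       [{f > tau'}]. *)
    have {}nx : f x <= tau' by rewrite leNgt; apply: contra_notN nx => ?; rewrite inE.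
    rewrite /excess /u lee_fin ge_max lexx/= subr_le0 le_max; apply/orP; right.
    have := sup_conv_ub K0 KM L0 fL x (ltW d0).
    by have := mulr_ge0 (ltW d0) b0; move: LMd nx; lra.
by move: key; rewrite lee_pmul2l// ?lte_fin.
Qed.

Lemma hinge_le b N k x : 0 <= b -> (hinge K f b N k x <= (L * M)%:E)%E.
Proof.
move=> b0; rewrite /hinge; set d : R := _^-1.
have d0 : 0 < d by rewrite invr_gt0.
rewrite lee_fin ge_max mulr_ge0 ?(ltW M0)//=.
apply: (@le_trans _ _ ((sup_conv K d f x - f x) / d)); first by rewrite lerBlDr lerDl.
rewrite ler_pdivrMr// lerBlDl.
exact: (sup_conv_ub K0 KM L0 fL x (ltW d0)).
Qed.

(** Limit of [hinge_step] in [k]. On [{f > tau'}], of finite measure, the hinges are bounded by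
    [L M] and dominated convergence applies; for [g] Fatou's lemma gives the direction needed. *)
Lemma aniso_hinge_level b tau tau' : 0 <= b -> tame_level v f tau' -> tau' < tau ->
  (\int[mu]_(x in lset g tau) aniso_hinge K g b x <= \int[mu]_x aniso_hinge K f b x)%E.
Proof.
move=> b0 tame' tt'.
have mg : measurable (lset g tau : set (leb_space R n.+1)).
  exact/open_lebesgue_measurable/(lipschitz_open_gt gL).
have mf : measurable (lset f tau' : set (leb_space R n.+1)).
  exact/open_lebesgue_measurable/(lipschitz_open_gt fL).
have [N LMN] : exists N, L * M / N.+1%:R <= tau - tau'.
  exists (Num.truncn (L * M / (tau - tau'))).
  rewrite ler_pdivrMr ?ltr0Sn// [leRHS]mulrC -ler_pdivrMr ?subr_gt0//.
  exact: ltW (truncnS_gt _).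
have h0 (w : 'rV[R]_n.+1 -> R) k x : (0 <= hinge K w b N k x)%E by rewrite lee_fin le_max lexx.
have a0 (w : 'rV[R]_n.+1 -> R) x : (0 <= aniso_hinge K w b x)%E by rewrite lee_fin le_max lexx.
apply: (@le_trans _ _ (\int[mu]_(x in lset f tau') aniso_hinge K f b x)%E); last first.
  apply: ge0_subset_integral => //; exact: (aniso_hinge_measurable hK L0 fL).
have [_ _ fcvg] : [/\ mu.-integrable (lset f tau') (aniso_hinge K f b),
    [sequence (\int[mu]_(x in lset f tau') `|hinge K f b N k x - aniso_hinge K f b x|)%E]_k @ \oo --> 0%E &
    [sequence (\int[mu]_(x in lset f tau') hinge K f b N k x)%E]_k @ \oo -->
      (\int[mu]_(x in lset f tau') aniso_hinge K f b x)%E].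
  apply: (@dominated_convergence _ _ _ _ _ mf _ _ (EFin \o cst (L * M))).
  - by move=> k; exact: (hinge_measurable hK L0 fL).
  - exact: (aniso_hinge_measurable hK L0 fL).
  - apply/ae_lebesgueP; apply: lebesgue_outer_null_sub (rademacher fL) => x /= nx dx.
    by apply: nx => _; exact: (hinge_cvg hK L0 fL).
  - by apply: integrable_cst_finite => //; exact: tame'.2.
  - apply: aeW => x k _; rewrite gee0_abs//; exact: hinge_le.
have [<- _] := cvg_limn_einf_sup fcvg.
apply: (@le_trans _ _ (\int[mu]_(x in lset g tau) limn_einf (fun k => hinge K g b N k x))%E).
  rewrite le_eqVlt; apply/orP; left; apply/eqP; apply: ae_eq_integral.
  - exact: mg.
  - exact: (aniso_hinge_measurable hK L'0 gL).
  - apply: measurable_fun_limn_einf => k; exact: (hinge_measurable hK L'0 gL).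
  - apply/ae_lebesgueP; apply: lebesgue_outer_null_sub (rademacher gL) => x /= nx dx.
    apply: nx => _; have := hinge_cvg hK L'0 gL (b := b) N dx.
    by move=> /cvg_limn_einf_sup[-> _].
apply: (le_trans (fatou mu mg _ _)).
- by move=> k; exact: (hinge_measurable hK L'0 gL).
- by [].
- by apply: le_limn_einf => k; exact: (hinge_step _ b0 tame' (ltW tt') LMN).
Qed.

(** Moving from a minimum in a direction of [K] cannot decrease [g]. Points above no tame level thus
    contribute nothing to a hinge with [b >= 0]. *)
Lemma aniso_global_min x : differential_at g x -> (forall y, g x <= g y) ->
  aniso K g x = 0.
Proof.
move=> dgx gmin; apply/eqP; rewrite eq_le aniso_ge0// andbT.
apply/ler_addgt0Pr => e e0; rewrite add0r; apply: (support_fun_le hK) => y Ky.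
have [|del del0 h] := dgx (e / M); first by rewrite divr_gt0.
pose s := del / (M + M).
have s0 : 0 < s by rewrite divr_gt0// addr_gt0.
have sy : `|s *: y| <= s * M by rewrite normrZ gtr0_norm// ler_wpM2l ?KM// ltW.
have sM : s * M < del.
  by rewrite /s mulrAC ltr_pdivrMr ?addr_gt0// mulrDr ltrDl mulr_gt0.
have := h (s *: y) (le_lt_trans sy sM); rewrite dotZr ler_norml => /andP[_].
have -> : dot (grad g x) (- y) = - dot (grad g x) y by rewrite -scaleN1r dotZr mulN1r.
have : e / M * `|s *: y| <= s * e.
  apply: (le_trans (ler_wpM2l _ sy)); first by rewrite divr_ge0// ltW.
  by rewrite mulrCA divfK// gt_eqF.
have := gmin (x + s *: y).
move: (`|_|) (dot _ _) (e / M) (g (_ + _)) => a p eM gs g1 g2 g3.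
suff : s * - p <= s * e by rewrite ler_pM2l.
by rewrite mulrN; lra.
Qed.

(** The tame level strictly below supplies the gap between [tau'] and [tau]. The sets [D i] then
    exhaust, increasingly, the region above such rationals. *)
Let good (q : rat) := exists2 t, tame_level v f t & t < ratr q.

Let D i : set 'rV[R]_n.+1 :=
  \bigcup_(q in [set q | good q /\ (pickle q < i)%N]) lset g (ratr q).

Let D_open i : open (D i).
Proof. by apply: bigcup_open => q _; exact: lipschitz_open_gt gL. Qed.

(** Superlevel sets are nested, so a finite union of them is the one of lowest level. *)
Let D_level i : (exists2 q, good q & D i `<=` lset g (ratr q)) \/ D i = set0.
Proof.
elim: i => [|i IH].
  by right; apply/seteqP; split => // x [q []].
have [[q0 gq0 iq0]|nq] := pselect (exists2 q, good q & pickle q = i); last first.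
  rewrite (_ : D i.+1 = D i) //; apply/seteqP; split => x [q [gq qi] gx]; exists q => //.
    split => //; move: qi; rewrite ltnS leq_eqVlt => /orP[/eqP qi|//].
    by exfalso; apply: nq; exists q.
  by split => //; exact: ltnW.
have DS : D i.+1 `<=` D i `|` lset g (ratr q0).
  move=> x [q [gq]]; rewrite ltnS leq_eqVlt => /orP[/eqP qi|qi] gx; last by left; exists q.
  by right; rewrite (pcan_inj pickleK (etrans iq0 (esym qi))).
left; case: IH => [[q1 gq1 D1]|D0]; last first.
  by exists q0 => // x /DS; rewrite D0 => -[].
have [q01|q10] := leP q0 q1.
  exists q0 => // x /DS[/D1|//] /=; apply: le_lt_trans; by rewrite ler_rat.
exists q1 => // x /DS[/D1//|] /=; apply: le_lt_trans; by rewrite ler_rat ltW.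
Qed.

(** Outside all [D i], a point where [g] is differentiable is a global minimum of [g] and its hinge
    vanishes; on each [D i] the bound at a single level applies, and the integrals over [D i]
    converge increasingly. *)
Lemma aniso_hinge_le b : 0 <= b ->
  (\int[mu]_x aniso_hinge K g b x <= \int[mu]_x aniso_hinge K f b x)%E.
Proof.
move=> b0.
have a0 (w : 'rV[R]_n.+1 -> R) x : (0 <= aniso_hinge K w b x)%E by rewrite lee_fin le_max lexx.
have mD i : measurable (D i : set (leb_space R n.+1)) by exact: open_lebesgue_measurable.
have mU : measurable (\bigcup_i D i : set (leb_space R n.+1)) by exact: bigcupT_measurable.
have off x : differential_at g x -> ~ (\bigcup_i D i) x -> aniso_hinge K g b x = 0%E.
  move=> dgx nx; rewrite /aniso_hinge aniso_global_min ?(max_idPl _)// ?sub0r ?oppr_le0//.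
  move=> y; rewrite leNgt; apply/negP => gyx.
  have [q] := rat_in_itvoo gyx; rewrite in_itv/= => /andP[yq qx].
  have [p] := rat_in_itvoo yq; rewrite in_itv/= => /andP[yp pq].
  (* If [p] is tame then [q] is good and [x] lies in some [D i]. Otherwise [T f >= p] almost
     everywhere, whereas [g < p] on a ball around [y]. *)
  have [tf|ntf] := pselect (tame_level v f (ratr p)).
    apply: nx; exists (pickle q).+1 => //; exists q => //=; split => //.
    by exists (ratr p).
  have ntT : ~ tame_level v (T f) (ratr p) by move=> /(T_tame v hT _ Xf).
  have := not_tame_ge hX (T_class hT Xf) ntT.
  have oy : nbhs y [set z | g z < ratr p].
    apply: open_nbhs_nbhs; split; last exact: yp.
    rewrite (_ : mkset _ = [set z | - ratr p < - g z]).
      by apply: (lipschitz_open_gt (M := L')) => z w; rewrite -opprD normrN.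
    by apply/seteqP; split => z /=; rewrite ltrN2.
  have /nbhs_ballP[r /= r0 rB] := oy => Tp.
  have : lebesgue_outer (ball y r) = 0%E.
    apply: lebesgue_outer_null_sub (lebesgue_outerU0 Tp Tfg) => z /rB /= gz.
    by have [e|] := pselect (T f z = g z); [left; rewrite /= e|right].
  by have := lebesgue_ball_ge y r0; move=> /[swap] ->; rewrite leNgt lte_fin exprn_gt0.
have -> : (\int[mu]_x aniso_hinge K g b x = \int[mu]_(x in \bigcup_i D i) aniso_hinge K g b x)%E.
  rewrite [RHS]integral_mkcond; apply: ae_eq_integral.
  - exact: measurableT.
  - exact: (aniso_hinge_measurable hK L'0 gL).
  - apply/(measurable_restrictT _ mU); exact: (aniso_hinge_measurable hK L'0 gL).
  - apply/ae_lebesgueP; apply: lebesgue_outer_null_sub (rademacher gL) => x /= nx dx.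
    apply: nx => _; rewrite patchE; case: ifPn => // /negP xU; apply: off => //.
    by apply: contra_not xU; rewrite inE.
have cvgD : (\int[mu]_(x in D i) aniso_hinge K g b x @[i --> \oo] -->
    \int[mu]_(x in \bigcup_i D i) aniso_hinge K g b x)%E.
  apply: ge0_nondecreasing_set_cvg_integral.
  - move=> i j ij; apply/subsetPset => x [q [gq qi] gx]; exists q => //; split => //.
    exact: leq_trans ij.
  - exact: mD.
  - by move=> i; exact: (aniso_hinge_measurable hK L'0 gL).
  - by move=> i x _; exact: a0.
rewrite -(cvg_lim _ cvgD)//; apply: lime_le; first by apply/cvg_ex; eexists; exact: cvgD.
apply: nearW => i; have [[q [t tt tq] Dq]|->] := D_level i; last first.
  by rewrite integral_set0; apply: integral_ge0.
apply: le_trans (aniso_hinge_level b0 tt tq).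
apply: ge0_subset_integral => //.
- exact/open_lebesgue_measurable/(lipschitz_open_gt gL).
- apply: (aniso_hinge_measurable hK L'0 gL).
  exact/open_lebesgue_measurable/(lipschitz_open_gt gL).
Qed.

End hinge_inequality.

(** * Young functions *)

Lemma le_ereal_of_lt {R : realType} (x y : \bar R) :
  (forall c : R, (c%:E < x)%E -> (c%:E <= y)%E) -> (x <= y)%E.
Proof.
move=> h; case: x y h => [x| |] [y| |]//= h; rewrite ?leey ?leNye ?lee_fin//.
- apply/ler_addgt0Pr => e e0; rewrite -lerBlDr -lee_fin; apply: h.
  by rewrite lte_fin ltrBlDr ltrDl.
- by have := h (x - 1); rewrite lte_fin ltrBlDr ltrDl ltr01 => /(_ isT).
- by have := h (y + 1); rewrite ltry lee_fin gerDl ler10 => /(_ isT).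
- by have := h 0; rewrite ltry => /(_ isT).
Qed.

Section young_approximation.
Context {R : realType}.
Variable Phi : R -> \bar R.
Hypothesis hPhi : young_function Phi.
Implicit Types a b c t h M : R.
Local Notation F t := (fine (Phi t)).

Lemma young_ge0 t : 0 <= t -> (0 <= Phi t)%E.
Proof. by have [_ + _ _] := hPhi; exact. Qed.

Lemma young_mono a t : 0 <= a -> a <= t -> (Phi a <= Phi t)%E.
Proof.
move=> a0 at_; have [->//|ant] := eqVneq a t.
have t0 : 0 < t by rewrite (le_lt_trans a0)// lt_neqAle ant.
have [P0 _ cvx _] := hPhi.
have l01 : 0 <= a / t <= 1 
  by apply/andP; split; [rewrite divr_ge0// ltW|rewrite ler_pdivrMr// mul1r].
have := cvx t 0 (a / t) (ltW t0) (lexx _) l01.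
rewrite mulr0 addr0 divfK ?gt_eqF// P0 mule0 adde0 => /le_trans; apply.
by rewrite gee_pMl ?lee_fin ?young_ge0 ?(ltW t0)//; case/andP: l01.
Qed.

Lemma young_fin a t : 0 <= a -> a <= t -> (Phi t < +oo)%E -> Phi a = (F a)%:E.
Proof.
move=> a0 at_ ft; rewrite fineK// ge0_fin_numE ?young_ge0//.
by apply: le_lt_trans ft; exact: young_mono.
Qed.

(** Monotonicity of chord slopes, multiplied out. *)
Lemma young_chord a b t : 0 <= a -> a < b -> b <= t -> (Phi t < +oo)%E ->
  (F b - F a) * (t - b) <= (F t - F b) * (b - a).
Proof.
move=> a0 ab bt ft; have ta : 0 < t - a by rewrite subr_gt0 (lt_le_trans ab).
have [_ _ cvx _] := hPhi; pose l := (t - b) / (t - a).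
have l01 : 0 <= l <= 1.
  apply/andP; split; first by apply: divr_ge0; [rewrite subr_ge0|exact: ltW].
  by rewrite ler_pdivrMr// mul1r lerB// ltW.
have := cvx a t l a0 (le_trans a0 (le_trans (ltW ab) bt)) l01.
have -> : l * a + (1 - l) * t = b by rewrite /l; field; rewrite gt_eqF.
have at_ : a <= t by rewrite (le_trans (ltW ab)).
have t0 := le_trans a0 at_.
rewrite (young_fin (le_trans a0 (ltW ab)) bt ft) (young_fin a0 at_ ft).
rewrite (young_fin t0 (lexx _) ft) -!EFinM -EFinD lee_fin.
move: (F a) (F b) (F t) => A B C.
rewrite -(ler_pM2l ta).
have -> : (t - a) * (l * A + (1 - l) * C) = (t - b) * A + (b - a) * C.
  by rewrite /l; field; rewrite gt_eqF.
by move=> /= hh; rewrite -subr_ge0; move: hh; rewrite -subr_ge0; congr (0 <= _); ring.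
Qed.

Section mesh.
Variables h M : R.
Hypothesis h0 : 0 < h.
Hypothesis M0 : 0 < M.
Local Notation node j := (j%:R * h).

(* Slopes of the chords of [Phi] over the mesh, cut off at [M]. *)
Definition mesh_slope (j : nat) : R := if j is i.+1 then
  if Phi (node i.+1) == +oo%E then M
  else Num.min M ((F (node i.+1) - F (node i)) / h) else 0.

(** A piecewise affine function whose slope to the right of a node is the capped slope of the chord
    over the cell to the left of that node. This delay by one cell keeps it below [Phi]. *)
Definition mesh_approx (J : nat) t : R :=
  \sum_(j < J) (mesh_slope j.+1 - mesh_slope j) * Num.max 0 (t - node j.+1).

Let node_ge0 j : 0 <= node j. Proof. by rewrite mulr_ge0// ltW. Qed.

Let nodeS j : node j.+1 = node j + h.
Proof. by rewrite -natr1 mulrDl mul1r. Qed.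

Let node_diff j : node j.+1 - node j = h.
Proof. by rewrite nodeS addrAC subrr add0r. Qed.

Let node_le i j : (i <= j)%N -> node i <= node j.
Proof. by move=> ij; rewrite ler_wpM2r ?(ltW h0)// ler_nat. Qed.

Lemma mesh_slope_le j : mesh_slope j <= M.
Proof. by case: j => [|j] /=; [exact: ltW|case: ifP => // _; rewrite ge_min lexx]. Qed.

Lemma mesh_slope_mono j : mesh_slope j <= mesh_slope j.+1.
Proof.
have [e|ne] := eqVneq (Phi (node j.+1)) +oo%E.
  by rewrite [leRHS]/= e eqxx mesh_slope_le.
have fin : (Phi (node j.+1) < +oo)%E by rewrite ltey.
rewrite [leRHS]/= (negbTE ne) le_min mesh_slope_le/=.
have mono i : (i <= j)%N -> F (node i) <= F (node i.+1).
  move=> ij; rewrite -lee_fin -!(@young_fin _ (node j.+1)) ?node_le// ?leqW//.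
  exact: young_mono (node_ge0 _) (node_le _).
case: j ne fin mono => [|i] ne fin mono.
  by apply: divr_ge0; [rewrite subr_ge0; exact: (mono 0%N)|exact: ltW].
rewrite /=; case: ifPn => [/eqP e|_].
  by have := young_mono (node_ge0 i.+1) (node_le (leqnSn _)); rewrite e leye_eq (negbTE ne).
rewrite ge_min; apply/orP; right; rewrite ler_pM2r ?invr_gt0//.
have ltn : node i < node i.+1 by rewrite nodeS ltrDl.
have := young_chord (node_ge0 i) ltn (node_le (leqnSn i.+1)) fin.
by rewrite !node_diff ler_pM2r.
Qed.

Lemma mesh_slope_ge0 j : 0 <= mesh_slope j.
Proof. by elim: j => [//|j IH]; exact: le_trans (mesh_slope_mono j). Qed.

Lemma mesh_approxS J t : mesh_approx J.+1 t = mesh_approx J t +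
  (mesh_slope J.+1 - mesh_slope J) * Num.max 0 (t - node J.+1).
Proof. by rewrite /mesh_approx big_ord_recr. Qed.

Lemma mesh_approx_ge0 J t : 0 <= mesh_approx J t.
Proof.
by apply: sumr_ge0 => j _; rewrite mulr_ge0 ?subr_ge0 ?mesh_slope_mono// le_max lexx.
Qed.

Lemma mesh_approx_mono i j t : (i <= j)%N -> mesh_approx i t <= mesh_approx j t.
Proof.
move=> /subnK <-; elim: (j - i)%N => [|k IH]; first by rewrite add0n.
rewrite addSn mesh_approxS (le_trans IH)// lerDl.
by rewrite mulr_ge0 ?subr_ge0 ?mesh_slope_mono// le_max lexx.
Qed.

Lemma mesh_approx_affine J a t : node J <= a -> a <= t ->
  mesh_approx J t = mesh_approx J a + mesh_slope J * (t - a).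
Proof.
move=> + at_; elim: J => [|J IH] Ja; first by rewrite /mesh_approx !big_ord0 mul0r addr0.
rewrite !mesh_approxS IH; last by rewrite (le_trans _ Ja)// node_le.
rewrite !(max_idPr _) ?subr_ge0// ?(le_trans Ja)//.
move: (mesh_approx _ _) (mesh_slope _) (mesh_slope _) => u s s'; ring.
Qed.

Lemma mesh_approxS_node J : mesh_approx J.+1 (node J.+1) = mesh_approx J (node J.+1).
Proof. by rewrite mesh_approxS subrr maxxx mulr0 addr0. Qed.

Lemma mesh_approx_le J t : 0 <= t -> ((mesh_approx J t)%:E <= Phi t)%E.
Proof.
elim: J t => [|J IH] t t0; first by rewrite /mesh_approx big_ord0 young_ge0.
have [tJ|Jt] := leP t (node J.+1).
  by rewrite mesh_approxS (max_idPl _) ?subr_le0// mulr0 addr0 IH.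
have [e|ne] := eqVneq (Phi t) +oo%E; first by rewrite e leey.
have fin : (Phi t < +oo)%E by rewrite ltey.
rewrite (mesh_approx_affine (lexx _) (ltW Jt)) mesh_approxS_node.
have := IH _ (node_ge0 J.+1).
rewrite (young_fin (node_ge0 _) (ltW Jt) fin) (young_fin t0 (lexx _) fin) !lee_fin.
have chord := @young_chord (node J) _ _ (node_ge0 _) _ (ltW Jt) fin.
have {}chord : (F (node J.+1) - F (node J)) / h * (t - node J.+1) <= F t - F (node J.+1).
  rewrite mulrAC ler_pdivrMr//; move: chord; rewrite [X in _ < X]nodeS ltrDl h0 => /(_ isT).
  by rewrite node_diff.
have : mesh_slope J.+1 * (t - node J.+1) <= (F (node J.+1) - F (node J)) / h * (t - node J.+1).
  rewrite ler_wpM2r ?subr_ge0 ?(ltW Jt)// /= ifF ?ge_min ?lexx ?orbT//.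
  apply/negbTE; rewrite -ltey; apply: le_lt_trans fin.
  exact: young_mono (node_ge0 _) (ltW Jt).
have key (p q u A C : R) : q <= C - A -> p <= q -> u <= A -> u + p <= C by lra.
exact: key chord.
Qed.

Lemma mesh_approx_ge_slope J t : node J <= t -> mesh_slope J * (t - node J) <= mesh_approx J t.
Proof.
by move=> Jt; rewrite (mesh_approx_affine (lexx _) Jt) lerDr mesh_approx_ge0.
Qed.

(** While no slope has been capped, the increments telescope, and the delay shows as a shift by
    exactly one node. *)
Lemma mesh_approx_node J : mesh_slope J < M ->
  Phi (node J) = (mesh_approx J (node J.+1))%:E.
Proof.
elim: J => [|J IH] sM.
  by rewrite mul0r /mesh_approx big_ord0; have [] := hPhi.
have := IH (le_lt_trans (mesh_slope_mono _) sM).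
rewrite (mesh_approx_affine (lexx _) (node_le (leqnSn J.+1))) mesh_approxS_node.
rewrite node_diff.
move: sM => /=; case: ifPn => [_|ne]; first by rewrite ltxx.
have fin : (Phi (node J.+1) < +oo)%E by rewrite ltey.
move=> sM; rewrite (young_fin (node_ge0 _) (node_le (leqnSn J)) fin) => -[<-].
rewrite (young_fin (node_ge0 _) (lexx _) fin); congr _%:E.
move: sM; rewrite /Num.min; case: ifP => [_|_ _]; first by rewrite ltxx.
by rewrite divfK ?gt_eqF// addrC subrK.
Qed.

End mesh.

(** Mesh [1/(k+1)], cap [k+1]; the [(k+1)^2] cells reach up to [k+1]. *)
Definition young_approx (k : nat) t : R :=
  mesh_approx k.+1%:R^-1 k.+1%:R (k.+1 * k.+1) t.

Let inv0 (k : nat) : 0 < k.+1%:R^-1 :> R. Proof. by rewrite invr_gt0. Qed.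

Let pos0 (k : nat) : 0 < k.+1%:R :> R. Proof. by []. Qed.

Lemma young_approx_le k t : 0 <= t -> ((young_approx k t)%:E <= Phi t)%E.
Proof. by move=> t0; exact: mesh_approx_le. Qed.

Lemma young_approx_ge0 k t : 0 <= young_approx k t.
Proof. exact: mesh_approx_ge0. Qed.

(** Left-continuity gives [t' < t] with [c < Phi t']; the node [J] is the first one beyond [t'], at
    distance at most [h]. *)
Lemma young_approx_ge t c : 0 < t -> (c%:E < Phi t)%E ->
  \forall k \near \oo, c <= young_approx k t.
Proof.
move=> t0 ct; have [_ _ _ /(_ t t0) lc] := hPhi.
have [t' [t'0 t't ct']] : exists t', [/\ 0 <= t', t' < t & (c%:E < Phi t')%E].
  have : \forall s \near t^'-, (c%:E < Phi s)%E.
    by apply: (lc [set u | (c%:E < u)%E]); apply: open_nbhs_nbhs; split => //;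
      exact: open_ereal_gt_ereal.
  move=> ? ; near t^'- => s; exists s; split; near: s => //.
  - exact: nbhs_left_ge.
  - exact: nbhs_left_lt.
have tt' : 0 < t - t' by rewrite subr_gt0.
near=> k.
have M0 := pos0 k; have h0 := inv0 k.
have hM : k.+1%:R * k.+1%:R^-1 = 1 :> R by rewrite divff.
have kt : t <= k.+1%:R.
  rewrite (@le_trans _ _ k%:R)// ?ler_nat//; near: k; exact: nbhs_infty_ger.
(* The 2 serves twice: it gives [2 h <= t - t'], room for one more node before [t], and makes up for
   the loss [M h = 1] in the capped case. *)
have kc : (`|c| + 2) / (t - t') <= k.+1%:R.
  rewrite (@le_trans _ _ k%:R)// ?ler_nat//; near: k; exact: nbhs_infty_ger.
rewrite ler_pdivrMr// in kc.
have mh := hM; move: M0 h0 kt kc hM; rewrite /young_approx.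
set M : R := k.+1%:R; set h : R := _^-1 => M0 h0 kt kc hM.
pose J := (Num.truncn (t' / h)).+1.
have Jt' : t' < J%:R * h by rewrite -ltr_pdivrMr//; exact: truncnS_gt.
have tJ : J%:R * h <= t' + h.
  rewrite -natr1 mulrDl mul1r lerD2r -ler_pdivlMr//.
  by rewrite truncn_le divr_ge0// ltW.
have h2 : 2 * h <= t - t'.
  rewrite -(ler_pM2l M0) mulrCA hM mulr1; apply: le_trans kc.
  by rewrite lerDr.
have JM : (J <= k.+1 * k.+1)%N.
  rewrite -(ler_nat R) natrM -/M -(ler_pM2r h0) -mulrA hM mulr1.
  by apply: le_trans kt; lra.
apply: (@le_trans _ _ (mesh_approx h M J t)); last exact: mesh_approx_mono.
(* Uncapped, the approximation at the node after [J] equals [Phi] at [J], which is at least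
   [Phi t']. Capped, its slope [M] over a length of at least [t - t' - h] already exceeds [c]. *)
have [sM|sM] := ltP (mesh_slope h M J) M.
  have le1 : mesh_approx h M J (J.+1%:R * h) <= mesh_approx h M J t.
    have l1 : J%:R * h <= J.+1%:R * h by rewrite ler_pM2r// ler_nat.
    have l2 : J.+1%:R * h <= t by rewrite -natr1; move: tJ h2; lra.
    have -> := mesh_approx_affine M h0 l1 l2.
    by rewrite lerDl mulr_ge0 ?mesh_slope_ge0// subr_ge0.
  apply: le_trans le1; rewrite -lee_fin -mesh_approx_node//.
  by apply: ltW; apply: (lt_le_trans ct'); apply: young_mono => //; exact: ltW.
apply: le_trans (mesh_approx_ge_slope h0 M0 _); last by move: tJ h2; lra.
have -> : mesh_slope h M J = M by apply/eqP; rewrite eq_le sM mesh_slope_le.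
apply: (@le_trans _ _ (M * (t - t' - h))).
  by rewrite mulrBr hM; move: (ler_norm c) kc; lra.
by rewrite ler_pM2l//; move: tJ; lra.
Unshelve. all: by end_near. Qed.

(** The meshes are not nested, so the limit is taken as a lower limit, the form that Fatou's lemma
    uses. *)
Lemma young_approx_limn t : 0 <= t ->
  limn_einf (fun k => (young_approx k t)%:E) = Phi t.
Proof.
move=> t0; apply/eqP; rewrite eq_le; apply/andP; split.
  by rewrite -[leRHS]limn_einf_cst; apply: le_limn_einf => k; exact: young_approx_le.
apply: le_ereal_of_lt => c ct; rewrite limn_einf_lim; apply: lime_ge; first exact: is_cvg_einfs.
have [e|tn0] := eqVneq t 0.
  apply: nearW => k; apply: le_ereal_inf_tmp => _ [j _ <-]; move: ct; rewrite e.
  have [-> _ _ _] := hPhi; rewrite lte_fin lee_fin => /ltW /le_trans; apply.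
  exact: young_approx_ge0.
have {tn0}t0 : 0 < t by rewrite lt_neqAle eq_sym tn0.
have [N _ hN] := young_approx_ge t0 ct.
exists N => // k /= Nk; apply: le_ereal_inf_tmp => _ [j /= kj <-].
by rewrite lee_fin; apply: hN; exact: leq_trans kj.
Qed.

Section integral.
Context {d : measure_display} {U : measurableType d} (m : {measure set U -> \bar R}).
Variables a c : U -> R.
Hypothesis ma : measurable_fun setT a.
Hypothesis mc : measurable_fun setT c.
Hypothesis a0 : forall x, 0 <= a x.
Hypothesis c0 : forall x, 0 <= c x.
Hypothesis hinge_ac : forall b, 0 <= b ->
  (\int[m]_x (Num.max 0 (a x - b))%:E <= \int[m]_x (Num.max 0 (c x - b))%:E)%E.

Let hinge_meas (e : U -> R) b : measurable_fun setT e ->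
  measurable_fun setT (fun x => (Num.max 0 (e x - b))%:E).
Proof.
move=> me; apply/measurable_EFinP; apply: measurable_maxr => //.
by apply: measurable_funB.
Qed.

Lemma mesh_approx_measurable h M J (e : U -> R) : measurable_fun setT e ->
  measurable_fun setT (fun x => (mesh_approx h M J (e x))%:E).
Proof.
move=> me; elim: J => [|J IH].
  by under eq_fun do rewrite /mesh_approx big_ord0; exact: measurable_cst.
under eq_fun do rewrite mesh_approxS EFinD EFinM.
apply: emeasurable_funD => //; apply: measurable_funeM; exact: hinge_meas.
Qed.

Lemma le_integral_mesh_approx h M J : 0 < h -> 0 < M ->
  (\int[m]_x (mesh_approx h M J (a x))%:E <= \int[m]_x (mesh_approx h M J (c x))%:E)%E.
Proof.
move=> h0 M0; elim: J => [|J IH].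
  by rewrite /mesh_approx; under eq_integral do rewrite big_ord0;
    under [leRHS]eq_integral do rewrite big_ord0.
have split_ (e : U -> R) : measurable_fun setT e -> (\int[m]_x (mesh_approx h M J.+1 (e x))%:E =
    \int[m]_x (mesh_approx h M J (e x))%:E + (mesh_slope h M J.+1 - mesh_slope h M J)%:E *
    \int[m]_x (Num.max 0 (e x - J.+1%:R * h))%:E)%E.
  move=> me; under eq_integral do rewrite mesh_approxS EFinD EFinM.
  rewrite ge0_integralD//.
  - rewrite ge0_integralZl//.
    + exact: hinge_meas.
    + by move=> x _; rewrite lee_fin le_max lexx.
    + by rewrite lee_fin subr_ge0 mesh_slope_mono.
  - by move=> x _; rewrite lee_fin mesh_approx_ge0.
  - exact: mesh_approx_measurable.
  - move=> x _; rewrite mule_ge0// lee_fin ?subr_ge0 ?mesh_slope_mono//.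
    by rewrite le_max lexx.
  - by apply: measurable_funeM; exact: hinge_meas.
rewrite !split_//; apply: leeD => //; apply: lee_pmul => //.
- by rewrite lee_fin subr_ge0 mesh_slope_mono.
- by apply: integral_ge0 => x _; rewrite lee_fin le_max lexx.
- by apply: hinge_ac; rewrite mulr_ge0// ltW.
Qed.

(** Fatou's lemma handles [a]; for [c] the approximations lie below [Phi], so no convergence of
    integrals is required. *)
Lemma le_integral_young : (\int[m]_x Phi (a x) <= \int[m]_x Phi (c x))%E.
Proof.
have mk (e : U -> R) k : measurable_fun setT e -> measurable_fun setT (fun x => (young_approx k (e x))%:E).
  exact: mesh_approx_measurable.
have PhiE (e : U -> R) : (forall x, 0 <= e x) ->
    (fun x => Phi (e x)) = (fun x => limn_einf (fun k => (young_approx k (e x))%:E)).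
  by move=> e0; apply/funext => x; rewrite young_approx_limn.
have mPhi (e : U -> R) : measurable_fun setT e -> (forall x, 0 <= e x) ->
    measurable_fun setT (fun x => Phi (e x)).
  by move=> me e0; rewrite PhiE//; apply: measurable_fun_limn_einf => k; exact: mk.
rewrite (PhiE a)//; apply: (le_trans (fatou m measurableT _ _)).
- by move=> k; exact: mk.
- by move=> k x _; rewrite lee_fin young_approx_ge0.
rewrite -[leRHS]limn_einf_cst; apply: le_limn_einf => k.
apply: (le_trans (le_integral_mesh_approx _ _ _)) => //.
apply: ge0_le_integral => //.
- by move=> x _; rewrite lee_fin young_approx_ge0.
- exact: mk.
- exact: mPhi.
- by move=> x _; exact: young_approx_le.
Qed.

End integral.

End young_approximation.

Lemma lipschitzP {R : realType} {n : nat} (f : 'rV[R]_n -> R) :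
  lipschitz f <-> exists2 L, 0 <= L & forall x y, `|f x - f y| <= L * `|x - y|.
Proof.
split=> [[L0 [_ hL]]|[L _ fL]].
  exists (Num.max (L0 + 1) 0); first by rewrite le_max lexx orbT.
  move=> x y; apply: (le_trans (hL (L0 + 1) _ (x, y) _)) => //=.
    by rewrite ltrDl.
  by rewrite ler_wpM2r// le_max lexx.
exists L; split; first exact: num_real.
move=> k Lk [x y] _ /=; apply: (le_trans (fL x y)).
by rewrite ler_wpM2r// ltW.
Qed.

Theorem theorem7p1 (R : realType) (n : nat) (hn : (2 <= n)%N)
    (X : set ('rV[R]_n -> R)) (hX : X = @class_S R n \/ X = @class_V R n)
    (K : set 'rV[R]_n) (hK : convex_body_o K)
    (T : ('rV[R]_n -> R) -> ('rV[R]_n -> R)) (hT : rearrangement X T)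
    (Phi : R -> \bar R) (hPhi : young_function Phi)
    (hTK : smoothing K T)
    (f : 'rV[R]_n -> R) (hXf : X f) (hf : lipschitz f) :
  exists g : 'rV[R]_n -> R,
    [/\ lipschitz g,
        {ae lebesgue R n, forall x, T f x = g x} &
        (\int[lebesgue R n]_x Phi (support_fun (reflect_set K) (grad g x)) <=
         \int[lebesgue R n]_x Phi (support_fun (reflect_set K) (grad f x)))%E].
Proof.
case: n hn X hX K hK T hT hTK f hXf hf => [//|n] _ X hX K hK T hT hTK f Xf /lipschitzP[L L0 fL].
have [v {}hX] : exists v : bool, X = if v then @class_V R n.+1 else @class_S R n.+1.
  by case: hX => ->; [exists false|exists true].
have [g [L' [L'0 gL' Tfg]]] := rearrangement_lipschitz hX hT hTK hK Xf L0 fL.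
have [M M0 KM] := convex_body_bounded hK.
exists g; split; [by apply/lipschitzP; exists L'|exact/ae_lebesgueP|].
apply: (le_integral_young hPhi (m := lebesgue R n.+1) (a := aniso K g) (c := aniso K f)).
- exact: (aniso_measurable hK L'0 gL').
- exact: (aniso_measurable hK L0 fL).
- exact: (aniso_ge0 hK).
- exact: (aniso_ge0 hK).
- move=> b b0; exact: (aniso_hinge_le hX hT hTK hK L0 fL Xf L'0 gL' Tfg M0 KM b0).
Qed.
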